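(* For $\alpha>0$ consider the equation $$(E_\alpha)\qquad \alpha\left[(1-x^2)^2u'\right]'''+6-\frac{8e^{4u}}{\int_{-1}^1(1-x^2)e^{4u}\,dx}=0,\qquad x\in(-1,1).$$ For every $\alpha\in(\frac15,\frac12)$ there exists a non-constant solution $u_\alpha$ of $(E_\alpha)$. Moreover, there exist a sequence $\alpha_m\in\left(\frac15,\frac{473+\sqrt{209329}}{1800}\right)$ and non-constant solutions $u_{\alpha_m}$ of $(E_{\alpha_m})$, $m=1,2,\dots$, such that $\alpha_m\to\frac12$, $\int_{-1}^1(1-x^2)e^{4u_{\alpha_m}}dx=\frac43$ for all $m$, and $\|u_{\alpha_m}\|_{L^\infty([-1,1])}\to\infty$ as $m\to\infty$.
   Context: $(E_\alpha)$ is the form taken, for functions of $x=\xi_1$ only, by the equation $$\alpha P_4u+6\left(1-\frac{e^{4u}}{\int_{\mathbb S^4}e^{4u}dw}\right)=0\quad\text{on }\mathbb S^4\subset\mathbb R^5,$$ where $P_4=\Delta^2-2\Delta$, $\Delta$ is the Laplace–Beltrami operator, and $dw$ is the volume form normalized so that $\int_{\mathbb S^4}dw=1$. A solution of $(E_\alpha)$ means a function $u=u(x)$ such that $\xi\mapsto u(\xi_1)$ belongs to $H^2(\mathbb S^4)$ and is a (weak, hence smooth) solution on all of $\mathbb S^4$. *)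

(* Defs.v *)
From HB Require Import structures.
From mathcomp Require Import all_boot all_order all_algebra.
From mathcomp Require Import all_classical all_reals all_analysis.
Set Implicit Arguments.
Unset Strict Implicit.
Unset Printing Implicit Defensive.
Import Order.TTheory GRing.Theory Num.Theory.
Import numFieldNormedType.Exports.
Local Open Scope classical_set_scope.
Local Open Scope ring_scope.

(* The library norm of 'rV[R]_5 is the sup norm, which induces the right
   topology but is not the norm defining the round sphere. *)
Definition enorm (R : realType) (y : 'rV[R]_5) : R :=
  Num.sqrt (\sum_(i < 5) y 0 i ^+ 2).

Definition sphere4 (R : realType) : set 'rV[R]_5 := [set xi | enorm xi = 1].
Arguments sphere4 R : clear implicits.

(* A function f on the sphere is represented by a function on R^5 of which only
   the values on the sphere matter; [hext f] is its extension to R^5 \ {0} that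
   is homogeneous of degree 0. *)
Definition hext (R : realType) (f : 'rV[R]_5 -> R) : 'rV[R]_5 -> R :=
  fun y => f ((enorm y)^-1 *: y).

Definition partial (R : realType) (i : 'I_5) (F : 'rV[R]_5 -> R) :
    'rV[R]_5 -> R :=
  fun y => 'D_(delta_mx 0 i) F y.

(* C^oo on R^5 \ {0}: partial derivatives of all orders exist and are
   continuous there. *)
Definition smooth_off0 (R : realType) (F : 'rV[R]_5 -> R) : Prop :=
  forall (s : seq 'I_5) (y : 'rV[R]_5), y != 0 ->
    {for y, continuous (foldr (@partial R) F s)} /\
    forall i : 'I_5, derivable (foldr (@partial R) F s) y (delta_mx 0 i).

(* f is C^oo on S^4 iff its pull-back under the smooth retraction y |-> y/|y|
   of R^5 \ {0} onto S^4 is. *)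
Definition smooth_sphere (R : realType) (f : 'rV[R]_5 -> R) : Prop :=
  smooth_off0 (hext f).

(* On S^4 the Laplace-Beltrami operator is the Euclidean Laplacian of the
   extension homogeneous of degree 0 (both the radial part and the curvature
   term (4/r) d/dr of the Euclidean Laplacian vanish on it). *)
Definition laplace_beltrami (R : realType) (f : 'rV[R]_5 -> R) :
    'rV[R]_5 -> R :=
  fun xi => \sum_(i < 5) partial i (partial i (hext f)) xi.

Definition P4 (R : realType) (f : 'rV[R]_5 -> R) : 'rV[R]_5 -> R :=
  fun xi => laplace_beltrami (laplace_beltrami f) xi
            - 2%:R * laplace_beltrami f xi.

Definition spherical_point (R : realType) (t1 t2 t3 t4 : R) : 'rV[R]_5 :=
  \row_(i < 5) nth 0
    [:: cos t1;
        sin t1 * cos t2;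
        sin t1 * sin t2 * cos t3;
        sin t1 * sin t2 * sin t3 * cos t4;
        sin t1 * sin t2 * sin t3 * sin t4] i.

(* Integral against the round volume form, whose expression in the angles is
   sin^3 t1 sin^2 t2 sin t3 dt1 dt2 dt3 dt4. *)
Definition sphere_vol_int (R : realType) (f : 'rV[R]_5 -> R) : R :=
  \int[lebesgue_measure]_(t1 in `[0, pi])
   \int[lebesgue_measure]_(t2 in `[0, pi])
    \int[lebesgue_measure]_(t3 in `[0, pi])
     \int[lebesgue_measure]_(t4 in `[0, 2%:R * pi])
       (f (spherical_point t1 t2 t3 t4)
        * (sin t1 ^+ 3 * sin t2 ^+ 2 * sin t3)).

(* Integral against the volume form dw of total mass 1. *)
Definition sphere_int (R : realType) (f : 'rV[R]_5 -> R) : R :=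
  sphere_vol_int f / sphere_vol_int (fun=> 1).

Definition sphere_solution (R : realType) (alpha : R) (f : 'rV[R]_5 -> R) :
    Prop :=
  smooth_sphere f /\
  forall xi, sphere4 R xi ->
    alpha * P4 f xi
    + 6%:R * (1 - expR (4%:R * f xi)
                  / sphere_int (fun z => expR (4%:R * f z))) = 0.

Definition axial (R : realType) (u : R -> R) : 'rV[R]_5 -> R :=
  fun xi => u (xi 0 ord0).

Definition mass (R : realType) (u : R -> R) : R :=
  \int[lebesgue_measure]_(x in `[-1, 1])
    ((1 - x ^+ 2) * expR (4%:R * u x)).

Definition ode_E (R : realType) (alpha : R) (u : R -> R) : Prop :=
  forall x : R, -1 < x < 1 ->
    alpha * derive1n 3 (fun t : R => (1 - t ^+ 2) ^+ 2 * derive1 u t) x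
    + 6%:R - 8%:R * expR (4%:R * u x) / mass u = 0.

(* The equation on the interval alone would admit solutions singular at
   x = 1 or x = -1; [sphere_solution] is the equation on all of S^4, poles
   included, in the smooth class to which weak H^2 solutions belong.  Only the
   values of u on [-1, 1] are relevant. *)
Definition solution_E (R : realType) (alpha : R) (u : R -> R) : Prop :=
  ode_E alpha u /\ sphere_solution alpha (axial u).

Definition nonconstant (R : realType) (u : R -> R) : Prop :=
  ~ exists c : R, forall x : R, -1 <= x <= 1 -> u x = c.

(* The L^oo([-1,1]) norm: the essential supremum over R of the absolute value
   of the extension of u by 0 outside [-1, 1]. *)
Definition Linfty_norm (R : realType) (u : R -> R) : \bar R :=
  Lnorm lebesgue_measure +oo%E (EFin \o (u \_ `[-1, 1])).

(* Main.v *)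
(* Normalise the mass to 4/3 and put l = 6/alpha and s = 1 - x.  With
   G = (1 - x^2)^2 u' and f = l exp (4 u) the equation becomes G''' = l - f in s,
   to be solved from the pole s = 0, where f = e > l and G'' = K; the pole is a
   regular singular point, so the solution exists and depends on (e, l, K) in a
   Lipschitz way by a Picard iteration in a weighted sup norm.  For given (e, l)
   there is a critical K such that G >= 0 on the hemisphere 0 <= s <= 1 and
   G / s^2 vanishes somewhere on it.  Strict monotonicity in K makes this K, hence
   the end value kappa(e, l) = G''(1), Lipschitz in (e, l).  If kappa <= 0 the
   zero of G is the equator s = 1; if kappa = 0 the even reflection of u across
   the equator is a smooth solution on the whole sphere.

   Testing the equation against a multiple of (x - x1)(1 - x^2)^2, x1 being the
   zero of G, shows that kappa < 0 for e < 30.  If e tends to infinity along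
   parameters with kappa <= 0, then u concentrates at the pole, a local Pohozaev
   identity forces the first moment of f near the pole to tend to 4, and kappa
   approaches (2/3)(l - 12).  For l in (12, 30), that is alpha in (1/5, 1/2),
   kappa therefore changes sign in e.  For fixed large a it also changes sign
   along e = l exp (4 a) for some l close to 12; since u(1) = a, these solutions
   blow up as alpha tends to 1/2. *)

(* Evenness across the equator imposes two conditions at s = 1, G = 0 and G'' = 0. Fixing K by the
   tangency of G / s^2 to zero, rather than by G(1) = 0, builds G >= 0 into the construction, so
   that f decreases on the hemisphere; the a priori bounds rest on this. What remains is one scalar
   function of (e, l), for which Lipschitz continuity and the intermediate value theorem suffice.

   Let b and c be the first and second moments of f on the hemisphere. Where G(1) = 0, integration
   by parts gives kappa = 2 l / 3 - 2 b + c. Concentration means c -> 0, and the Pohozaev identity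
   then degenerates to (b - c)(b - c - 4) -> 0. The root 0 is excluded because a fixed amount of b
   lies within distance 1/K of the pole; the root 4 gives the limit (2/3)(l - 12).

   These asymptotics hold only where kappa <= 0, since only there is the zero of G known to be the
   equator. Positivity of kappa is therefore always obtained by contradiction. In the blow-up
   construction l may a priori be small along the path, so that e = l exp (4 a) is not obviously
   large; a lower bound for K, coming from the fact that f drops below l, repairs this. *)
Require Import Defs.
From HB Require Import structures.
From mathcomp Require Import all_boot all_order all_algebra.
From mathcomp Require Import all_classical all_reals all_analysis.
From mathcomp Require Import ess_sup_inf ring lra.
Set Implicit Arguments.
Unset Strict Implicit.
Unset Printing Implicit Defensive.
Import Order.TTheory GRing.Theory Num.Theory.
Import numFieldNormedType.Exports.
Local Open Scope classical_set_scope.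
Local Open Scope ring_scope.

(** * Calculus on the line *)

Section calculus.
Context {R : realType}.
Implicit Types (f g : R -> R) (a b c d x y : R).

Lemma is_deriveD_fun f g x a b :
  is_derive x 1 f a -> is_derive x 1 g b ->
  is_derive x 1 (fun t => f t + g t) (a + b).
Proof. exact: is_deriveD. Qed.

Lemma is_deriveN_fun f x a :
  is_derive x 1 f a -> is_derive x 1 (fun t => - f t) (- a).
Proof. exact: is_deriveN. Qed.

Lemma is_deriveM_fun f g x a b :
  is_derive x 1 f a -> is_derive x 1 g b ->
  is_derive x 1 (fun t => f t * g t) (f x * b + g x * a).
Proof. exact: is_deriveM. Qed.

Lemma is_deriveX_fun f n x a :
  is_derive x 1 f a ->
  is_derive x 1 (fun t => f t ^+ n) (n%:R * f x ^+ n.-1 * a).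
Proof.
move=> fa; have -> : (fun t => f t ^+ n) = f ^+ n.
  by apply/funext => t; rewrite exprfctE.
exact: is_deriveX.
Qed.

Lemma is_deriveV_fun f x a : f x != 0 ->
  is_derive x 1 f a -> is_derive x 1 (fun t => (f t)^-1) (- (f x ^- 2) * a).
Proof.
move=> fx0 [fa <-]; apply: DeriveDef; first exact: derivableV.
by rewrite deriveV// scalerAl.
Qed.

Lemma is_derive_cst_fun c x : is_derive x 1 (fun _ : R => c) 0.
Proof. exact: is_derive_cst. Qed.

Lemma is_derive_id_fun x : is_derive x 1 (fun t : R => t) 1.
Proof. exact: is_derive_id. Qed.

Lemma is_derive_expR_fun f x a :
  is_derive x 1 f a -> is_derive x 1 (fun t => expR (f t)) (expR (f x) * a).
Proof. by move=> fa; apply: is_derive1_comp. Qed.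

Lemma is_derive_comp_fun f g x a b :
  is_derive (g x) 1 f a -> is_derive x 1 g b ->
  is_derive x 1 (fun t => f (g t)) (a * b).
Proof. by move=> fa gb; apply: is_derive1_comp. Qed.

Lemma is_derive_continuous f x a : is_derive x 1 f a -> {for x, continuous f}.
Proof. by move=> [fa _]; apply/differentiable_continuous/derivable1_diffP. Qed.

Lemma le_of_derive f f' a b : a <= b ->
  (forall x, a <= x <= b -> is_derive x 1 f (f' x)) ->
  (forall x, a < x < b -> 0 <= f' x) -> f a <= f b.
Proof.
move=> ab df f'0.
case: (ltgtP a b) ab => // [ab _|-> //].
have [c cab] : exists2 c, c \in `]a, b[%R & f b - f a = f' c * (b - a).
  apply: MVT => //.
    move=> x; rewrite in_itv/= => /andP[ax xb]; apply: df.
    by rewrite !ltW.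
  apply: derivable_within_continuous => x; rewrite in_itv/= => xab.
  by have [] := df _ xab.
rewrite in_itv/= in cab * => E.
by rewrite -subr_ge0 E mulr_ge0// ?f'0// subr_ge0 ltW.
Qed.

Lemma ge_of_derive f f' a b : a <= b ->
  (forall x, a <= x <= b -> is_derive x 1 f (f' x)) ->
  (forall x, a < x < b -> f' x <= 0) -> f b <= f a.
Proof.
move=> ab df f'0; rewrite -lerN2.
apply: (@le_of_derive (fun t => - f t) (fun t => - f' t)) => // x xab.
  exact/is_deriveN_fun/df.
by rewrite oppr_ge0 f'0.
Qed.

Lemma lt_of_derive f f' a b : a < b ->
  (forall x, a <= x <= b -> is_derive x 1 f (f' x)) ->
  (forall x, a < x < b -> 0 < f' x) -> f a < f b.
Proof.
move=> ab df f'0.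
have [c cab] : exists2 c, c \in `]a, b[%R & f b - f a = f' c * (b - a).
  apply: MVT => //.
    move=> x; rewrite in_itv/= => /andP[ax xb]; apply: df.
    by rewrite !ltW.
  apply: derivable_within_continuous => x; rewrite in_itv/= => xab.
  by have [] := df _ xab.
rewrite in_itv/= in cab * => E.
by rewrite -subr_gt0 E mulr_gt0// ?f'0// subr_gt0.
Qed.

Lemma gt_of_derive f f' a b : a < b ->
  (forall x, a <= x <= b -> is_derive x 1 f (f' x)) ->
  (forall x, a < x < b -> f' x < 0) -> f b < f a.
Proof.
move=> ab df f'0; rewrite -ltrN2.
apply: (@lt_of_derive (fun t => - f t) (fun t => - f' t)) => // x xab.
  exact/is_deriveN_fun/df.
by rewrite oppr_gt0 f'0.
Qed.

Lemma eq_of_derive f g h a b : a <= b ->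
  (forall x, a <= x <= b -> is_derive x 1 f (h x)) ->
  (forall x, a <= x <= b -> is_derive x 1 g (h x)) ->
  f a = g a -> f b = g b.
Proof.
move=> ab df dg fga.
have dfg x : a <= x <= b -> is_derive x 1 (fun t => f t + - g t) (h x - h x).
  by move=> xab; apply: is_deriveD_fun; [exact: df|exact/is_deriveN_fun/dg].
have le1 : f b + - g b <= f a + - g a.
  by apply: (ge_of_derive ab dfg) => x _; rewrite subrr.
have le2 : f a + - g a <= f b + - g b.
  by apply: (le_of_derive ab dfg) => x _; rewrite subrr.
lra.
Qed.

Lemma continuous_gt_near f x z : {for x, continuous f} -> z < f x ->
  exists2 r, 0 < r & forall y, `|y - x| < r -> z < f y.
Proof.
move=> cf zf.
have /nbhs_ballP[r /= r0 fr] : \forall y \near x, z < f y by exact: cvgr_gt cf _ zf.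
by exists r => // y yx; apply: fr; rewrite /ball/= distrC.
Qed.

Lemma continuous_lt_near f x z : {for x, continuous f} -> f x < z ->
  exists2 r, 0 < r & forall y, `|y - x| < r -> f y < z.
Proof.
move=> cf zf.
have /nbhs_ballP[r /= r0 fr] : \forall y \near x, f y < z by exact: cvgr_lt cf _ zf.
by exists r => // y yx; apply: fr; rewrite /ball/= distrC.
Qed.

Lemma continuous_near_eq f g x r : 0 < r ->
  (forall y, `|y - x| < r -> f y = g y) ->
  {for x, continuous f} -> {for x, continuous g}.
Proof.
move=> r0 fg cf.
have fgx : f x = g x by apply: fg; rewrite subrr normr0.
have {}cf : f y @[y --> x] --> g x by rewrite -fgx.
apply: cvg_trans cf; apply: near_eq_cvg.
by exists r => //= y /= yx; apply: fg; rewrite distrC.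
Qed.

Lemma is_derive_near_eq f g x r a : 0 < r ->
  (forall y, `|y - x| < r -> f y = g y) ->
  is_derive x 1 f a -> is_derive x 1 g a.
Proof.
move=> r0 fg; apply: near_eq_is_derive.
by exists r => //= y /= yx; apply: fg; rewrite distrC.
Qed.

Local Notation mu := (@lebesgue_measure R).

(** At most one of the two integrals is over a nontrivial interval, so this is the oriented integral
    from 0 to [s]. Negative [s] are needed because the solution is continued past the pole s = 0 in
    order to prove smoothness there. *)
Definition prim f s : R :=
  \int[mu]_(t in `[0, s]) f t - \int[mu]_(t in `[s, 0]) f t.

Lemma prim0 f : prim f 0 = 0.
Proof. by rewrite /prim subrr. Qed.

Lemma within_continuous_itv f a b :
  (forall x, a <= x <= b -> {for x, continuous f}) ->
  {within `[a, b], continuous f}.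
Proof.
move=> cf; apply: continuous_in_subspaceT => x.
by rewrite inE/= in_itv/= => /cf.
Qed.

Lemma integrable_itv f a b : {within `[a, b], continuous f} ->
  mu.-integrable `[a, b] (EFin \o f).
Proof.
by move=> cf; apply: continuous_compact_integrable => //; exact: segment_compact.
Qed.

Lemma prim_derive f c d : c < 0 < d ->
  (forall x, c < x < d -> {for x, continuous f}) ->
  forall x, c < x < d -> is_derive x 1 (prim f) (f x).
Proof.
move=> /andP[c0 d0] cf x /andP[cx xd].
pose m := Num.min 0 x; pose M := Num.max 0 x.
have [cm m0 mx] : [/\ c < m, m <= 0 & m <= x].
  by rewrite /m lt_min c0 cx !ge_min !lexx orbT.
have [dM M0 Mx] : [/\ M < d, 0 <= M & x <= M].
  by rewrite /M gt_max d0 xd !le_max !lexx orbT.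
pose c' := (c + m) / 2; pose d' := (d + M) / 2.
have [cc' c'm] : c < c' /\ c' < m by rewrite /c'; split; lra.
have [dd' d'M] : d' < d /\ M < d' by rewrite /d'; split; lra.
have intf : mu.-integrable `[c', d'] (EFin \o f).
  apply/integrable_itv/within_continuous_itv => y /andP[cy yd]; apply: cf.
  by rewrite (lt_le_trans cc' cy) (le_lt_trans yd dd').
have c'x : c' < x by lra.
have xd' : x < d' by lra.
have [dF F'] : derivable (fun y => \int[mu]_(t in `[c', y]) f t) x 1 /\
   derive1 (fun y => \int[mu]_(t in `[c', y]) f t) x = f x.
  apply: continuous_FTC1_closed xd' intf _ _ => //.
  by apply: cf; rewrite cx xd.
have dF' : is_derive x 1 (fun y => \int[mu]_(t in `[c', y]) f t) (f x).
  by apply: (DeriveDef dF); rewrite -derive1E; exact: F'.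
pose k := \int[mu]_(t in `[c', 0]) f t.
have dFk : is_derive x 1 (fun y => \int[mu]_(t in `[c', y]) f t + - k) (f x).
  have := is_deriveD_fun dF' (is_deriveN_fun (is_derive_cst_fun k x)).
  by rewrite oppr0 addr0.
apply: near_eq_is_derive dFk.
have : \forall y \near x, y \in `]c', d'[.
  by apply: near_in_itvoo; rewrite in_itv/= c'x.
apply: filterS => y; rewrite in_itv/= => /andP[cy yd].
have intS u v : c' <= u -> v <= d' -> mu.-integrable `[u, v] (EFin \o f).
  move=> cu vd; apply: integrableS intf => //.
  by apply: subset_itv; rewrite bnd_simp.
rewrite /prim /k; have [y0|y0] := leP 0 y.
- have -> : \int[mu]_(t in `[y, 0]) f t = 0.
    move: y0; rewrite le_eqVlt => /predU1P[<-|y0].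
      by rewrite set_itv1 Rintegral_set1.
    by rewrite set_itv_ge ?Rintegral_set0// bnd_simp -ltNge.
  rewrite subr0 Rintegral_itvB; [|by apply: intS; lra|by rewrite bnd_simp; lra..].
  rewrite -Rintegral_itv_obnd_cbnd//.
  by apply: integrableS (intS 0 y _ _) => //; [exact: subset_itv_oc_cc|lra|lra].
- have -> : \int[mu]_(t in `[0, y]) f t = 0.
    by rewrite set_itv_ge ?Rintegral_set0// bnd_simp -ltNge.
  rewrite sub0r -opprB; congr (- _).
  rewrite Rintegral_itvB; [|by apply: intS; lra|by rewrite bnd_simp; lra..].
  rewrite -Rintegral_itv_obnd_cbnd//.
  by apply: integrableS (intS y 0 _ _) => //; [exact: subset_itv_oc_cc|lra|lra].
Qed.

Lemma prim_deriveT f : continuous f -> forall x, is_derive x 1 (prim f) (f x).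
Proof.
move=> cf x; have x0 := normr_ge0 x; have := ler_norm x; have := ler_norm (- x).
rewrite normrN => ? ?.
apply: (@prim_derive f (- (`|x| + 1)) (`|x| + 1)); rewrite ?ltrDl.
- by apply/andP; split; lra.
- by move=> *; exact: cf.
- by apply/andP; split; lra.
Qed.

End calculus.

Section calculus01.
Context {R : realType}.
Implicit Types (f : R -> R) (a b : R).

Lemma le_of_derive01 f f' a b : 0 <= a -> a <= b -> b <= 1 ->
  (forall x : R, 0 <= x <= 1 -> is_derive x 1 f (f' x)) ->
  (forall x, a < x < b -> 0 <= f' x) -> f a <= f b.
Proof. by move=> a0 ab b1 df; apply: le_of_derive => // x ?; apply: df; lra. Qed.

Lemma ge_of_derive01 f f' a b : 0 <= a -> a <= b -> b <= 1 ->
  (forall x : R, 0 <= x <= 1 -> is_derive x 1 f (f' x)) ->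
  (forall x, a < x < b -> f' x <= 0) -> f b <= f a.
Proof. by move=> a0 ab b1 df; apply: ge_of_derive => // x ?; apply: df; lra. Qed.

Lemma lt_of_derive01 f f' a b : 0 <= a -> a < b -> b <= 1 ->
  (forall x : R, 0 <= x <= 1 -> is_derive x 1 f (f' x)) ->
  (forall x, a < x < b -> 0 < f' x) -> f a < f b.
Proof. by move=> a0 ab b1 df; apply: lt_of_derive => // x ?; apply: df; lra. Qed.

Lemma gt_of_derive01 f f' a b : 0 <= a -> a < b -> b <= 1 ->
  (forall x : R, 0 <= x <= 1 -> is_derive x 1 f (f' x)) ->
  (forall x, a < x < b -> f' x < 0) -> f b < f a.
Proof. by move=> a0 ab b1 df; apply: gt_of_derive => // x ?; apply: df; lra. Qed.

End calculus01.

(** The derivative is computed from the syntax of the function; [isd] leaves as its goal the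
    equation between the computed value and the announced one. *)
Ltac isd_step :=
  lazymatch goal with
  | |- is_derive _ _ (fun _ => ?c) _ => apply: is_derive_cst_fun
  | |- is_derive _ _ (fun t => t) _ => apply: is_derive_id_fun
  | |- is_derive _ _ (fun t => (@?f t + @?g t)%R) _ =>
      eapply (@is_deriveD_fun _ f g)
  | |- is_derive _ _ (fun t => (@?f t * @?g t)%R) _ =>
      eapply (@is_deriveM_fun _ f g)
  | |- is_derive _ _ (fun t => (- @?f t)%R) _ => eapply (@is_deriveN_fun _ f)
  | |- is_derive _ _ (fun t => (@?f t ^+ ?n)%R) _ =>
      eapply (@is_deriveX_fun _ f n)
  | |- is_derive _ _ (fun t => expR (@?f t)) _ =>
      eapply (@is_derive_expR_fun _ f)
  | _ => eassumption
  end.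

Ltac isd := eapply is_derive_eq; [repeat isd_step|].

(** * Weighted averages *)

Section averages.
Context {R : realType}.
Implicit Types (f g : R -> R) (c d s t x : R) (m : nat).

Definition continuous_oo c d f := forall x : R, c < x < d -> {for x, continuous f}.

Lemma continuous_oo_mono c d f m : continuous_oo c d f ->
  continuous_oo c d (fun t => t ^+ m * f t).
Proof.
move=> cf x cx; apply: continuousM; last exact: cf.
exact: exprn_continuous.
Qed.

Lemma prim_unique c d f F : c < 0 < d -> continuous_oo c d f ->
  (forall x : R, c < x < d -> is_derive x 1 F (f x)) -> F 0 = 0 ->
  forall x : R, c < x < d -> prim f x = F x.
Proof.
move=> cd cf dF F0 x cx; have dp := prim_derive cd cf.
have [x0|x0] := leP 0 x.
  apply: (eq_of_derive x0 (h := f)); last by rewrite prim0 F0.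
    by move=> y yx; apply: dp; lra.
  by move=> y yx; apply: dF; lra.
have dN f' (y : R) : is_derive (- y) 1 f' (f (- y)) ->
    is_derive y 1 (fun t => f' (- t)) (- f (- y)).
  move=> h; rewrite -mulrN1.
  exact: is_derive_comp_fun h (is_deriveN_fun (is_derive_id_fun y)).
have x0' : 0 <= - x by rewrite oppr_ge0 ltW.
have := @eq_of_derive _ (fun t => prim f (- t)) (fun t => F (- t))
  (fun t => - f (- t)) 0 (- x) x0'.
rewrite opprK oppr0 prim0 F0; apply => //.
  by move=> y yx; apply/dN/dp; lra.
by move=> y yx; apply/dN/dF; lra.
Qed.

(* For m = 0, 1 these invert (s y)' = f and (s^2 y)' = s f across s = 0. *)
Definition avg m f s : R :=
  if s == 0 then f 0 / m.+1%:R
  else prim (fun t => t ^+ m * f t) s / s ^+ m.+1.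

Lemma avgE m f s : s ^+ m.+1 * avg m f s = prim (fun t => t ^+ m * f t) s.
Proof.
rewrite /avg; have [->|s0] := eqVneq s 0; first by rewrite prim0 expr0n mul0r.
by rewrite mulrC divfK// expf_neq0.
Qed.

Lemma avg_derive m f c d : c < 0 < d -> continuous_oo c d f ->
  forall s : R, c < s < d ->
  is_derive s 1 (fun t => t ^+ m.+1 * avg m f t) (s ^+ m * f s).
Proof.
move=> cd cf s cs.
have -> : (fun t => t ^+ m.+1 * avg m f t) = prim (fun t => t ^+ m * f t).
  by apply/funext => t; rewrite avgE.
apply: (@prim_derive _ (fun t => t ^+ m * f t) c d) => //.
exact: continuous_oo_mono.
Qed.

Lemma avg_lin m f g (a b : R) c d : c < 0 < d ->
  continuous_oo c d f -> continuous_oo c d g -> forall s : R, c < s < d ->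
  avg m (fun t => a * f t + b * g t) s = a * avg m f s + b * avg m g s.
Proof.
move=> cd cf cg s cs; rewrite /avg.
have [_|s0] := eqVneq s 0; first by rewrite mulrDl !mulrA.
rewrite !mulrA -mulrDl; congr (_ / _).
have cfg : continuous_oo c d (fun t => t ^+ m * (a * f t + b * g t)).
  apply: continuous_oo_mono => x cx; apply: continuousD.
    by apply: continuousM; [exact: cst_continuous|exact: cf].
  by apply: continuousM; [exact: cst_continuous|exact: cg].
apply: (prim_unique (F := fun x => a * prim (fun t => t ^+ m * f t) x +
  b * prim (fun t => t ^+ m * g t) x) cd cfg _ _ cs).
- move=> x cx.
  have df := prim_derive cd (continuous_oo_mono (m := m) cf) cx.
  have dg := prim_derive cd (continuous_oo_mono (m := m) cg) cx.
  by isd; rewrite /=; ring.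
- by rewrite !prim0 !mulr0 addr0.
Qed.

Lemma avg_cst m (a : R) s : avg m (fun=> a) s = a / m.+1%:R.
Proof.
rewrite /avg; have [//|s0] := eqVneq s 0.
have sn := normr_ge0 s; have [s1 s2] := (ler_norm s, ler_norm (- s)).
rewrite normrN in s2.
suff -> : prim (fun t => t ^+ m * a) s = a / m.+1%:R * s ^+ m.+1.
  by rewrite mulfK// expf_neq0.
have s0' : - (`|s| + 1) < 0 < `|s| + 1 by lra.
have cf : continuous_oo (- (`|s| + 1)) (`|s| + 1) (fun t => t ^+ m * a).
  by apply: continuous_oo_mono => x _; exact: cst_continuous.
apply: (prim_unique (F := fun t => a / m.+1%:R * t ^+ m.+1) s0' cf).
- move=> x _; isd; rewrite /=.
  have : m.+1%:R != 0 :> R by rewrite pnatr_eq0.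
  by move: (m.+1%:R : R) => q q0; field.
- by rewrite expr0n mulr0.
- lra.
Qed.

(** The conditions on [t] describe the segment between 0 and [s] for either sign of [s], so that
    comparison of averages works on both sides of the pole. *)
Lemma avg_ge0 m f c d s : c < 0 < d -> continuous_oo c d f -> c < s < d ->
  (forall t : R, `|t| <= `|s| -> 0 <= t * s -> 0 <= f t) -> 0 <= avg m f s.
Proof.
move=> cd cf cs f0; rewrite /avg.
have [_|s0] := eqVneq s 0.
  by rewrite divr_ge0// f0 ?mul0r// normr0.
pose p := prim (fun t => t ^+ m * f t).
have dp := prim_derive cd (continuous_oo_mono (m := m) cf).
have [sp|sn] := ltP 0 s.
  rewrite divr_ge0 ?exprn_ge0 ?(ltW sp)//.
  suff : p 0 <= p s by rewrite [p 0]prim0.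
  apply: (@le_of_derive _ p (fun t => t ^+ m * f t)) => [|x xs|x xs].
  - exact: ltW.
  - by apply: dp; lra.
  rewrite mulr_ge0 ?exprn_ge0//; first lra.
  apply: f0; last by rewrite mulr_ge0//; lra.
  by rewrite !ger0_norm; lra.
have {s0}sn : s < 0 by rewrite lt_neqAle s0.
(* For negative arguments t ^+ m has the sign of (- 1) ^+ m, which this factor compensates. *)
have : (- 1) ^+ m * p s <= (- 1) ^+ m * p 0.
  apply: (@le_of_derive _ (fun t => (- 1) ^+ m * p t)
    (fun t => (- 1) ^+ m * (t ^+ m * f t))); first exact: ltW.
    move=> x xs; have d1 : is_derive x 1 p (x ^+ m * f x) by apply: dp; lra.
    by isd; rewrite /=; ring.
  move=> x xs; rewrite mulrA -exprMn mulN1r mulr_ge0 ?exprn_ge0//; first lra.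
  apply: f0; last by rewrite nmulr_rge0; lra.
  by rewrite !ler0_norm; lra.
rewrite [p 0]prim0 mulr0 => p0.
have -> : p s / s ^+ m.+1 = (- 1) ^+ m * p s / ((- s) ^+ m * s).
  rewrite [(- s) ^+ m]exprNn exprSr.
  have sm : s ^+ m != 0 by rewrite expf_neq0// lt_eqF.
  have : (- 1) ^+ m != 0 :> R by rewrite signr_eq0.
  move: ((- 1) ^+ m) (s ^+ m) sm => q u u0 q0; field.
  by rewrite u0 q0 lt_eqF.
rewrite mulr_le0// invr_le0 nmulr_lle0// exprn_ge0//; lra.
Qed.

Lemma le_avg m f g c d s : c < 0 < d -> continuous_oo c d f ->
  continuous_oo c d g -> c < s < d ->
  (forall t : R, `|t| <= `|s| -> 0 <= t * s -> f t <= g t) ->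
  avg m f s <= avg m g s.
Proof.
move=> cd cf cg cs fg.
have : 0 <= avg m (fun t => 1 * g t + (- 1) * f t) s.
  apply: avg_ge0 cd _ cs _.
    move=> x cx; apply: continuousD.
      by apply: continuousM; [exact: cst_continuous|exact: cg].
    by apply: continuousM; [exact: cst_continuous|exact: cf].
  by move=> t ts tss; have := fg _ ts tss; lra.
by rewrite (avg_lin _ _ _ cd cg cf cs); lra.
Qed.

Lemma avg_bound m f c d s (w : R) : c < 0 < d -> continuous_oo c d f ->
  c < s < d -> (forall t : R, `|t| <= `|s| -> `|f t| <= w) ->
  `|avg m f s| <= w.
Proof.
move=> cd cf cs fw.
have w0 : 0 <= w by apply: le_trans (fw s (lexx _)).
have ww : w / m.+1%:R <= w by rewrite ler_pdivrMr// ler_peMr// ler1n.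
have cc (a : R) : continuous_oo c d (fun=> a) by move=> x _; exact: cst_continuous.
have h1 : avg m f s <= w / m.+1%:R.
  rewrite -(avg_cst _ _ s); apply: le_avg cd cf (cc w) cs _ => t ts _.
  by have := fw _ ts; rewrite ler_norml => /andP[].
have h2 : - w / m.+1%:R <= avg m f s.
  rewrite -(avg_cst _ _ s); apply: le_avg cd (cc (- w)) cf cs _ => t ts _.
  by have := fw _ ts; rewrite ler_norml => /andP[].
rewrite ler_norml (le_trans h1 ww) andbT.
by apply: le_trans h2; rewrite mulNr lerN2.
Qed.

(** Away from 0 this is continuity of a quotient. At 0, the value f(0) / (m + 1) is the exact
    average of the constant f(0), so the difference is the average of f - f(0), which is small near
    0. *)
Lemma avg_continuous m f c d : c < 0 < d -> continuous_oo c d f ->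
  continuous_oo c d (avg m f).
Proof.
move=> cd cf s cs.
have dp := prim_derive cd (continuous_oo_mono (m := m) cf).
have [s0|s0] := eqVneq s 0; last first.
  have cq : {for s, continuous (fun t => prim (fun t => t ^+ m * f t) t / t ^+ m.+1)}.
    apply: continuousM; first exact: is_derive_continuous (dp _ cs).
    apply: continuousV; first by rewrite expf_neq0.
    exact: exprn_continuous.
  apply: (continuous_near_eq (r := `|s|) _ _ cq); first by rewrite normr_gt0.
  move=> t ts; rewrite /avg ifF//; apply: contraTF ts => /eqP->.
  by rewrite sub0r normrN ltxx.
rewrite {}s0 in cs *.
apply/cvgrPdist_le => /= ep ep0.
have [r r0 fr] : exists2 r, 0 < r & forall t, `|t| < r -> c < t < d /\ `|f t - f 0| <= ep.
  have cfa : {for 0, continuous (fun t => `|f t - f 0|)}.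
    apply: continuous_comp; last exact: norm_continuous.
    by apply: continuousB; [exact: cf|exact: cst_continuous].
  have [|r r0 fr] := continuous_lt_near (z := ep) cfa; first by rewrite subrr normr0.
  exists (Num.min r (Num.min (- c) d)); first by rewrite !lt_min r0; lra.
  move=> t; rewrite !lt_min => /andP[tr /andP[tc td]]; split.
    by move: tc td; rewrite !ltr_norml; lra.
  by rewrite ltW// fr// subr0.
near=> t.
have tr : `|t| < r.
  by near: t; apply: (@nbhs0_lt _ R).
have [ct _] := fr _ tr.
rewrite distrC.
have cc (a : R) : continuous_oo c d (fun=> a) by move=> x _; exact: cst_continuous.
have -> : avg m f t - avg m f 0 = avg m (fun t => 1 * f t + (- 1) * f 0) t.
  have E0 : avg m f 0 = f 0 / m.+1%:R by rewrite /avg eqxx.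
  by rewrite (avg_lin _ _ _ cd cf (cc (f 0)) ct) avg_cst E0 mul1r mulN1r.
apply: avg_bound cd _ ct _.
  move=> x cx; apply: continuousD; last exact: cst_continuous.
  by apply: continuousM; [exact: cst_continuous|exact: cf].
move=> x xt; rewrite mul1r mulN1r.
by have [] := fr _ (le_lt_trans xt tr).
Unshelve. all: by end_near. Qed.

End averages.

(** * The Picard map *)

Section picard.
Context {R : realType}.
Implicit Types (f g v w : R -> R) (e l K : R).

Let T01 (s : R) : - (`|s| + 1) < 0 < `|s| + 1.
Proof. by have := normr_ge0 s; lra. Qed.

Let Ts (s : R) : - (`|s| + 1) < s < `|s| + 1.
Proof. by have := ler_norm s; have := ler_norm (- s); rewrite normrN; lra. Qed.

Let sqr_normr (s : R) : `|s| ^+ 2 = s ^+ 2.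
Proof. exact: real_normK (num_real s). Qed.

Let cT f c d : continuous f -> continuous_oo c d f.
Proof. by move=> cf x _; exact: cf. Qed.

Lemma continuousT_D f g : continuous f -> continuous g ->
  continuous (fun t => f t + g t).
Proof. by move=> cf cg x; exact: (continuousD (cf x) (cg x)). Qed.

Lemma continuousT_N f : continuous f -> continuous (fun t => - f t).
Proof. by move=> cf x; exact: (continuousN (cf x)). Qed.

Lemma continuousT_M f g : continuous f -> continuous g ->
  continuous (fun t => f t * g t).
Proof. by move=> cf cg x; exact: (continuousM (cf x) (cg x)). Qed.

Lemma continuousT_V f : (forall x, f x != 0) -> continuous f ->
  continuous (fun t => (f t)^-1).
Proof. by move=> f0 cf x; exact: (continuousV (f0 x) (cf x)). Qed.

Lemma continuousT_comp f g : continuous f -> continuous g ->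
  continuous (fun t => f (g t)).
Proof. by move=> cf cg x; exact: (continuous_comp (cg x) (cf (g x))). Qed.

Lemma continuousT_cst (a : R) : continuous (fun _ : R => a).
Proof. exact: cst_continuous. Qed.

Lemma continuousT_min1 : continuous (fun t : R => Num.min t 1).
Proof. by move=> x; apply: continuous_min; [exact: cvg_id|exact: cst_continuous]. Qed.

Lemma avg_derivez m f : continuous f -> forall s : R,
  is_derive s 1 (fun t => t ^+ m.+1 * avg m f t) (s ^+ m * f s).
Proof. by move=> cf s; apply: (avg_derive _ (T01 s) (cT cf) (Ts s)). Qed.

Lemma avg_continuousz m f : continuous f -> continuous (avg m f).
Proof.
by move=> cf s; exact: (@avg_continuous _ m f _ _ (T01 s) (cT cf) s (Ts s)).
Qed.

Lemma avg_boundz m f s (w : R) : continuous f ->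
  (forall t : R, `|t| <= `|s| -> `|f t| <= w) -> `|avg m f s| <= w.
Proof. by move=> cf; apply: (avg_bound _ (T01 s) (cT cf) (Ts s)). Qed.

Lemma avg_linz m f g (a b : R) s : continuous f -> continuous g ->
  avg m (fun t => a * f t + b * g t) s = a * avg m f s + b * avg m g s.
Proof. by move=> cf cg; apply: (avg_lin _ _ _ (T01 s) (cT cf) (cT cg) (Ts s)). Qed.

Lemma le_avgz m f g s : continuous f -> continuous g ->
  (forall t : R, `|t| <= `|s| -> 0 <= t * s -> f t <= g t) ->
  avg m f s <= avg m g s.
Proof. by move=> cf cg; apply: (le_avg _ (T01 s) (cT cf) (cT cg) (Ts s)). Qed.

Lemma avg_distz m f g s (w : R) : continuous f -> continuous g ->
  (forall t : R, `|t| <= `|s| -> `|f t - g t| <= w) ->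
  `|avg m f s - avg m g s| <= w.
Proof.
move=> cf cg fg.
have -> : avg m f s - avg m g s = avg m (fun t => 1 * f t + (- 1) * g t) s.
  by rewrite avg_linz// mul1r mulN1r.
apply: avg_boundz => [|t ts]; last by rewrite mul1r mulN1r fg.
by apply: continuousT_D; apply: continuousT_M => //; exact: continuousT_cst.
Qed.

Lemma prim_continuous f : continuous f -> continuous (prim f).
Proof. by move=> cf x; exact: is_derive_continuous (prim_deriveT cf x). Qed.

Lemma prim_dist f g s (w : R) : continuous f -> continuous g ->
  (forall t : R, `|t| <= `|s| -> `|f t - g t| <= w) ->
  `|prim f s - prim g s| <= `|s| * w.
Proof.
move=> cf cg fg.
have E h : prim h s = s * avg 0 h s.
  have := avgE 0 h s; rewrite expr1 => ->.
  by congr (prim _ s); apply/funext => t; rewrite expr0 mul1r.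
by rewrite !E -mulrBr normrM ler_wpM2l// avg_distz.
Qed.

(** Integrating the pointwise bound, instead of multiplying its supremum by |s|, is what produces
    the contraction factor of the Picard map. *)
Lemma prim_dist_le f g (phi Phi : R -> R) s : continuous f -> continuous g ->
  (forall t : R, 0 <= t -> is_derive t 1 Phi (phi t)) -> Phi 0 = 0 ->
  (forall t : R, `|f t - g t| <= phi `|t|) ->
  `|prim f s - prim g s| <= Phi `|s|.
Proof.
move=> cf cg dPhi Phi0 fg.
have key f1 g1 t : continuous f1 -> continuous g1 ->
    (forall t : R, `|f1 t - g1 t| <= phi `|t|) -> 0 <= t ->
    prim f1 t - prim g1 t <= Phi t.
  move=> cf1 cg1 fg1 t0.
  have dD (x : R) : 0 <= x <= t -> is_derive x 1
      (fun y => Phi y - (prim f1 y - prim g1 y)) (phi x - (f1 x - g1 x)).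
    move=> /andP[x0 _]; have d1 := dPhi _ x0.
    have d2 := prim_deriveT cf1 x; have d3 := prim_deriveT cg1 x.
    by isd; ring.
  have : Phi 0 - (prim f1 0 - prim g1 0) <= Phi t - (prim f1 t - prim g1 t).
    apply: (le_of_derive t0 dD) => x /andP[x0 _].
    by have := fg1 x; rewrite (gtr0_norm x0) ler_norml => /andP[_]; rewrite subr_ge0.
  by rewrite Phi0 !prim0; lra.
have key2 f1 g1 t : continuous f1 -> continuous g1 ->
    (forall t : R, `|f1 t - g1 t| <= phi `|t|) -> 0 <= t ->
    `|prim f1 t - prim g1 t| <= Phi t.
  move=> cf1 cg1 fg1 t0; rewrite ler_norml; apply/andP; split; last exact: key.
  rewrite lerNl opprB; apply: key => // y; by rewrite distrC.
have [s0|s0] := leP 0 s; first by rewrite (ger0_norm s0); exact: key2.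
have primN h : continuous h -> prim h s = - prim (fun t => h (- t)) (- s).
  move=> ch; have chN : continuous (fun t => h (- t)).
    exact: continuousT_comp ch opp_continuous.
  apply: (@prim_unique _ _ _ _ (fun t => - prim (fun t => h (- t)) (- t)) (T01 s)
    (cT ch)) => //.
  - move=> x _; have dN : is_derive x 1 (fun t : R => - t) (- 1).
      exact: is_deriveN_fun (is_derive_id_fun x).
    have dp := is_derive_comp_fun (prim_deriveT chN (- x)) dN.
    by isd; rewrite opprK; ring.
  - by rewrite oppr0 prim0 oppr0.
rewrite (ltr0_norm s0) !primN// -opprD normrN; apply: key2.
- exact: continuousT_comp cf opp_continuous.
- exact: continuousT_comp cg opp_continuous.
- by move=> t; rewrite -(normrN t); exact: fg.
- by rewrite oppr_ge0 ltW.
Qed.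

(* 1 / (2 - s)^2, extended by a constant beyond the equator s = 1. *)
Definition rho (s : R) : R := ((2 - Num.min s 1) ^+ 2)^-1.

Lemma rho_gt0 s : 0 < rho s.
Proof.
have m1 : Num.min s 1 <= 1 by rewrite ge_min lexx orbT.
by rewrite invr_gt0 exprn_gt0//; lra.
Qed.

Lemma rho_le1 s : rho s <= 1.
Proof.
have m1 : Num.min s 1 <= 1 by rewrite ge_min lexx orbT.
rewrite invf_le1 ?exprn_gt0//; last lra.
by rewrite exprn_ege1//; lra.
Qed.

Lemma rhoE s : s <= 1 -> rho s = ((2 - s) ^+ 2)^-1.
Proof. by move=> s1; rewrite /rho (min_idPl s1). Qed.

Lemma rho_continuous : continuous rho.
Proof.
apply: continuousT_V => [s|].
  have m1 : Num.min s 1 <= 1 by rewrite ge_min lexx orbT.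
  by rewrite expf_neq0// gt_eqF//; lra.
apply: (@continuousT_comp (fun x => x ^+ 2) (fun t => 2 - Num.min t 1)).
  exact: exprn_continuous.
exact: (continuousT_D (@continuousT_cst 2) (continuousT_N continuousT_min1)).
Qed.

(* exp (4 t), truncated above so as to be globally Lipschitz. *)
Definition texp (t : R) : R := expR (4 * Num.min t 1).

Lemma texp_gt0 t : 0 < texp t. Proof. exact: expR_gt0. Qed.

Lemma texpE t : t <= 1 -> texp t = expR (4 * t).
Proof. by move=> t1; rewrite /texp (min_idPl t1). Qed.

Lemma texp_le t : texp t <= expR 4.
Proof.
rewrite ler_expR; have : Num.min t 1 <= 1 by rewrite ge_min lexx orbT.
lra.
Qed.

Lemma texp_ndecr (s t : R) : s <= t -> texp s <= texp t.
Proof.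
move=> st; rewrite ler_expR ler_pM2l// le_min !ge_min st lexx !orbT.
by [].
Qed.

Lemma texp_lip (s t : R) : `|texp s - texp t| <= 4 * expR 4 * `|s - t|.
Proof.
wlog st : s t / s <= t => [h|].
  have [st|/ltW ts] := leP s t; first exact: h.
  by rewrite distrC [`|s - t|]distrC; exact: h.
rewrite distrC ger0_norm ?subr_ge0 ?texp_ndecr// distrC (ger0_norm _); last first.
  by rewrite subr_ge0.
pose a := Num.min s 1; pose b := Num.min t 1.
have ab : a <= b by rewrite /a /b le_min !ge_min st lexx !orbT.
have b1 : b <= 1 by rewrite ge_min lexx orbT.
have bats : b - a <= t - s.
  rewrite /a /b; have [s1|s1] := leP s 1; have [t1|t1] := leP t 1; lra.
apply: (@le_trans _ _ (4 * expR 4 * (b - a))); last first.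
  by rewrite ler_wpM2l// mulr_ge0// expR_ge0.
have d (x : R) : a <= x <= b -> is_derive x 1
    (fun y => 4 * expR 4 * y - expR (4 * y)) (4 * expR 4 - expR (4 * x) * 4).
  by move=> _; isd; ring.
have : 4 * expR 4 * a - expR (4 * a) <= 4 * expR 4 * b - expR (4 * b).
  apply: (le_of_derive ab d) => x xab.
  have : expR (4 * x) <= expR 4 by rewrite ler_expR; lra.
  lra.
by rewrite /texp -/a -/b; lra.
Qed.

Lemma texp_continuous : continuous texp.
Proof.
apply: (@continuousT_comp expR (fun t => 4 * Num.min t 1)).
  exact: continuous_expR.
by apply: continuousT_M; [exact: continuousT_cst|exact: continuousT_min1].
Qed.

(** With v = u minus its value at the pole, these functionals are, on the hemisphere and with primes
    in s, G''', G'' ([kof]), G' / s ([hof]), G / s^2 ([gof]) and the x-derivative of u ([rhog]). The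
    quotients absorb the singular factors at s = 0. *)
Definition src e l v (s : R) : R := l - e * texp (v s).
Definition kof e l K v (s : R) : R := K + prim (src e l v) s.
Definition hof e l K v : R -> R := avg 0 (kof e l K v).
Definition gof e l K v : R -> R := avg 1 (hof e l K v).
Definition rhog e l K v (s : R) : R := rho s * gof e l K v s.
Definition picard e l K v (s : R) : R := - prim (rhog e l K v) s.

Lemma src_continuous e l v : continuous v -> continuous (src e l v).
Proof.
move=> cv; apply: continuousT_D; first exact: continuousT_cst.
apply/continuousT_N/continuousT_M; first exact: continuousT_cst.
exact: continuousT_comp texp_continuous cv.
Qed.

Lemma kof_continuous e l K v : continuous v -> continuous (kof e l K v).
Proof.
move=> cv; apply: continuousT_D; first exact: continuousT_cst.
exact/prim_continuous/src_continuous.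
Qed.

Lemma hof_continuous e l K v : continuous v -> continuous (hof e l K v).
Proof. by move=> cv; exact/avg_continuousz/kof_continuous. Qed.

Lemma gof_continuous e l K v : continuous v -> continuous (gof e l K v).
Proof. by move=> cv; exact/avg_continuousz/hof_continuous. Qed.

Lemma rhog_continuous e l K v : continuous v -> continuous (rhog e l K v).
Proof.
by move=> cv; apply: continuousT_M; [exact: rho_continuous|exact: gof_continuous].
Qed.

Lemma picard_continuous e l K v : continuous v -> continuous (picard e l K v).
Proof. by move=> cv; exact/continuousT_N/prim_continuous/rhog_continuous. Qed.

(** * Contraction and parameter dependence in a weighted norm *)

Section estimates.
Context (M : R).
Hypothesis M0 : 0 <= M.

Definition lipc : R := 4 * expR 4 * M + 1.

Lemma lipc_ge1 : 1 <= lipc.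
Proof. by rewrite lerDr !mulr_ge0// expR_ge0. Qed.

(** The Gaussian form is dictated by the integral of lipc t weight(t) from 0 to s, which is
    (weight(s) - 1) / 2: the Picard map contracts by 1/2 on the whole line, whatever the size of
    [lipc]. *)
Definition weight (s : R) : R := expR (lipc * s ^+ 2).

Lemma weight_le (s t : R) : `|s| <= `|t| -> weight s <= weight t.
Proof.
move=> st; rewrite ler_expR ler_wpM2l//; first by have := lipc_ge1; lra.
by rewrite -(sqr_normr s) -(sqr_normr t) lerXn2r ?nnegrE.
Qed.

Lemma weight_ge s : 1 + s ^+ 2 <= weight s.
Proof.
apply: le_trans (expR_ge1Dx _); rewrite lerD2l -[leLHS]mul1r ler_wpM2r ?sqr_ge0//.
exact: lipc_ge1.
Qed.

Lemma weight_norm (s : R) : weight `|s| = weight s.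
Proof. by rewrite /weight sqr_normr. Qed.

(** The factor expR 4 is the upper bound of [texp], hence the effect of a change of [e] on the
    source. *)
Definition pdist e l K e' l' K' : R :=
  `|K - K'| + expR 4 * `|e - e'| + `|l - l'|.

Lemma pdist_ge0 e l K e' l' K' : 0 <= pdist e l K e' l' K'.
Proof. by rewrite !addr_ge0// mulr_ge0// expR_ge0. Qed.

Section compare.
Context (e l K e' l' K' D : R) (v v' : R -> R).
Hypothesis eM : 0 <= e <= M.
Hypothesis D0 : 0 <= D.
Hypothesis cv : continuous v.
Hypothesis cv' : continuous v'.
Hypothesis vv' : forall s : R, `|v s - v' s| <= D * weight s.

Local Notation P := (pdist e l K e' l' K').
Local Notation om := (fun s : R => P * (1 + s) + lipc * D * (s * weight s)).

Lemma om_le (s t : R) : `|s| <= `|t| -> om `|s| <= om `|t|.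
Proof.
move=> st; rewrite /= lerD// ?ler_wpM2l ?pdist_ge0 ?lerD2l//.
  by rewrite mulr_ge0//; have := lipc_ge1; lra.
by rewrite ler_pM ?expR_ge0 ?normr_ge0// !weight_norm weight_le.
Qed.

Lemma src_dist (s : R) :
  `|src e l v s - src e' l' v' s| <= expR 4 * `|e - e'| + `|l - l'| + lipc * D * weight s.
Proof.
have -> : src e l v s - src e' l' v' s =
    (l - l') - (e * (texp (v s) - texp (v' s)) + (e - e') * texp (v' s)).
  by rewrite /src; ring.
have h3 : `|(e - e') * texp (v' s)| <= expR 4 * `|e - e'|.
  by rewrite normrM mulrC ler_wpM2r// ger0_norm ?texp_le// ltW// texp_gt0.
have h2 : `|e * (texp (v s) - texp (v' s))| <= lipc * D * weight s.
  rewrite normrM ger0_norm; last by case/andP: eM.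
  apply: (@le_trans _ _ (M * (4 * expR 4 * (D * weight s)))).
    rewrite ler_pM//; [by case/andP: eM|by case/andP: eM|].
    by apply: (le_trans (texp_lip _ _)); rewrite ler_wpM2l ?mulr_ge0 ?expR_ge0.
  have -> : M * (4 * expR 4 * (D * weight s)) = 4 * expR 4 * M * (D * weight s).
    by ring.
  rewrite -[leRHS]mulrA ler_wpM2r ?mulr_ge0 ?expR_ge0//.
  by rewrite /lipc lerDl.
apply: (le_trans (ler_normB _ _)).
have := ler_normD (e * (texp (v s) - texp (v' s))) ((e - e') * texp (v' s)).
lra.
Qed.

Lemma kof_dist (s : R) : `|kof e l K v s - kof e' l' K' v' s| <= om `|s|.
Proof.
rewrite /kof opprD addrACA.
apply: (le_trans (ler_normD _ _)).
have : `|prim (src e l v) s - prim (src e' l' v') s| <=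
   `|s| * (expR 4 * `|e - e'| + `|l - l'| + lipc * D * weight s).
  apply: prim_dist; [exact: src_continuous|exact: src_continuous|] => t ts.
  apply: (le_trans (src_dist _)); rewrite lerD2l ler_wpM2l ?weight_le//.
  by rewrite mulr_ge0//; have := lipc_ge1; lra.
rewrite /= /pdist weight_norm.
have : 0 <= `|K - K'| * `|s| by rewrite mulr_ge0.
have : 0 <= expR 4 * `|e - e'| by rewrite mulr_ge0// expR_ge0.
have : 0 <= `|l - l'| by [].
lra.
Qed.

Lemma hof_dist (s : R) : `|hof e l K v s - hof e' l' K' v' s| <= om `|s|.
Proof.
apply: avg_distz; [exact: kof_continuous|exact: kof_continuous|] => t ts.
exact: le_trans (kof_dist _) (om_le ts).
Qed.

Lemma gof_dist (s : R) : `|gof e l K v s - gof e' l' K' v' s| <= om `|s|.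
Proof.
apply: avg_distz; [exact: hof_continuous|exact: hof_continuous|] => t ts.
exact: le_trans (hof_dist _) (om_le ts).
Qed.

(** One estimate serves three purposes: contraction (equal parameters), size of the first iterate
    (second triple zero), and Lipschitz dependence on the parameters. The integral in [kof] yields a
    factor |s|, the two averages cost nothing, and the last integral turns s weight(s) into half a
    weight. *)
Lemma picard_dist (s : R) :
  `|picard e l K v s - picard e' l' K' v' s| <= (P + D / 2) * weight s.
Proof.
rewrite /picard -opprD normrN.
pose Phi (t : R) := P * (t + t ^+ 2 / 2) + D / 2 * (weight t - 1).
have l1 := lipc_ge1.
have dPhi (t : R) : 0 <= t -> is_derive t 1 Phi (om t).
  by move=> _; rewrite /Phi /weight; isd; rewrite /=; field.
apply: (@le_trans _ _ (Phi `|s|)).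
  apply: (@prim_dist_le _ _ om Phi) => //; [exact: rhog_continuous..| |].
    by rewrite /Phi /weight expr0n/= mulr0 expR0; ring.
  move=> t; rewrite /rhog -mulrBr normrM ger0_norm ?(ltW (rho_gt0 _))//.
  apply: le_trans (gof_dist t); rewrite -[leRHS]mul1r ler_wpM2r// rho_le1//.
rewrite /Phi weight_norm [(P + D / 2) * _]mulrDl lerD//.
  rewrite ler_wpM2l ?pdist_ge0//; apply: le_trans (weight_ge s).
  rewrite -(sqr_normr s); have : 0 <= (`|s| - 1) ^+ 2 by exact: sqr_ge0.
  by rewrite sqr_normr; have := sqr_ge0 s; rewrite -(sqr_normr s); lra.
by rewrite ler_wpM2l ?divr_ge0//; lra.
Qed.

End compare.
End estimates.
End picard.

(** * Functions of class C^n on an interval *)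

Section smooth_interval.
Context {R : realType}.
Implicit Types (f g : R -> R) (c d x : R) (n m : nat).

Fixpoint Ck n c d f : Prop :=
  if n is n'.+1 then
    exists2 f' : R -> R, (forall x : R, c < x < d -> is_derive x 1 f (f' x)) & Ck n' c d f'
  else continuous_oo c d f.

Lemma itv_ball c d x : c < x < d -> exists2 r, 0 < r &
  forall y, `|y - x| < r -> c < y < d.
Proof.
move=> /andP[cx xd]; exists (Num.min (x - c) (d - x)).
  by rewrite lt_min !subr_gt0 cx.
by move=> y; rewrite lt_min !ltr_norml => /andP[]; lra.
Qed.

Lemma is_derive_eq_oo c d f g x a : c < x < d ->
  (forall y : R, c < y < d -> f y = g y) -> is_derive x 1 f a -> is_derive x 1 g a.
Proof.
move=> cx fg; have [r r0 xr] := itv_ball cx.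
by apply: (is_derive_near_eq r0) => y /xr/fg.
Qed.

Lemma continuous_oo_ext c d f g : (forall y : R, c < y < d -> f y = g y) ->
  continuous_oo c d f -> continuous_oo c d g.
Proof.
move=> fg cf x cx; have [r r0 xr] := itv_ball cx.
by apply: (continuous_near_eq r0 _ (cf x cx)) => y /xr/fg.
Qed.

Lemma Ck_ext n c d f g : (forall y : R, c < y < d -> f y = g y) ->
  Ck n c d f -> Ck n c d g.
Proof.
case: n => [|n] fg /=; first exact: continuous_oo_ext.
by move=> [f' df cf']; exists f' => // x cx; apply: is_derive_eq_oo cx fg (df x cx).
Qed.

Lemma Ck_continuous n c d f : Ck n c d f -> continuous_oo c d f.
Proof.
by case: n => [//|n] [f' df _] x cx; exact: is_derive_continuous (df x cx).
Qed.

Lemma CkS n c d f : Ck n.+1 c d f -> Ck n c d f.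
Proof.
elim: n f => [|n IH] f; first exact: Ck_continuous.
by move=> [f' df cf']; exists f' => //; exact: IH.
Qed.

Lemma Ck_cst n c d (a : R) : Ck n c d (fun=> a).
Proof.
elim: n a => [|n IH] a /=; first by move=> x _; exact: cst_continuous.
by exists (fun=> 0) => // x _; exact: is_derive_cst_fun.
Qed.

Lemma Ck_id n c d : Ck n c d (fun x => x).
Proof.
case: n => [|n] /=; first by move=> x _; exact: cvg_id.
by exists (fun=> 1); [move=> x _; exact: is_derive_id_fun|exact: Ck_cst].
Qed.

Lemma CkD n c d f g : Ck n c d f -> Ck n c d g -> Ck n c d (fun x => f x + g x).
Proof.
elim: n f g => [|n IH] f g /=.
  by move=> cf cg x cx; apply: continuousD; [exact: cf|exact: cg].
move=> [f' df cf'] [g' dg cg']; exists (fun x => f' x + g' x); last exact: IH.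
by move=> x cx; apply: is_deriveD_fun; [exact: df|exact: dg].
Qed.

Lemma CkM n c d f g : Ck n c d f -> Ck n c d g -> Ck n c d (fun x => f x * g x).
Proof.
elim: n f g => [|n IH] f g.
  by move=> cf cg x cx; apply: continuousM; [exact: cf|exact: cg].
move=> Cf Cg; have [Cf0 Cg0] := (CkS Cf, CkS Cg).
case: Cf => f' df cf'; case: Cg => g' dg cg'.
exists (fun x => f x * g' x + g x * f' x); last by apply: CkD; exact: IH.
by move=> x cx; apply: is_deriveM_fun; [exact: df|exact: dg].
Qed.

Lemma CkN n c d f : Ck n c d f -> Ck n c d (fun x => - f x).
Proof.
move=> Cf; apply: (Ck_ext _ (CkM (Ck_cst n c d (- 1)) Cf)) => x _.
by rewrite mulN1r.
Qed.

Lemma CkX n m c d f : Ck n c d f -> Ck n c d (fun x => f x ^+ m).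
Proof.
move=> Cf; elim: m => [|m IH].
  by apply: (Ck_ext _ (Ck_cst n c d 1)) => x _; rewrite expr0.
by apply: (Ck_ext _ (CkM Cf IH)) => x _; rewrite exprS.
Qed.

Lemma CkV n c d f : (forall x : R, c < x < d -> f x != 0) ->
  Ck n c d f -> Ck n c d (fun x => (f x)^-1).
Proof.
move=> f0; elim: n => [|n IH].
  by move=> cf x cx; apply: continuousV; [exact: f0|exact: cf].
move=> Cf; have CV := IH (CkS Cf); case: Cf => f' df cf'.
exists (fun x => - (f x ^- 2) * f' x).
  by move=> x cx; apply: is_deriveV_fun; [exact: f0|exact: df].
apply: CkM => //; apply: CkN; apply: (Ck_ext _ (CkX 2 CV)) => x _.
by rewrite exprVn.
Qed.

Lemma Ck_expR n c d f : Ck n c d f -> Ck n c d (fun x => expR (f x)).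
Proof.
elim: n => [|n IH].
  by move=> cf x cx; apply: continuous_comp; [exact: cf|exact: continuous_expR].
move=> Cf; have CE := IH (CkS Cf); case: Cf => f' df cf'.
exists (fun x => expR (f x) * f' x); last exact: CkM.
by move=> x cx; apply: is_derive_expR_fun; exact: df.
Qed.

Lemma Ck_affine n c d c' d' f (a b : R) : Ck n c' d' f ->
  (forall x : R, c < x < d -> c' < a + b * x < d') ->
  Ck n c d (fun x => f (a + b * x)).
Proof.
move=> + ab; elim: n f => [|n IH] f.
  move=> cf x cx; apply: continuous_comp; last exact/cf/ab.
  apply: continuousD; first exact: cst_continuous.
  by apply: continuousM; [exact: cst_continuous|exact: cvg_id].
move=> [f' df cf']; exists (fun x => b * f' (a + b * x)).
  move=> x cx; have dx : is_derive x 1 (fun t : R => a + b * t) b by isd; ring.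
  rewrite [b * _]mulrC.
  exact: (is_derive_comp_fun (g := fun t => a + b * t) (df _ (ab x cx)) dx).
by apply: CkM; [exact: Ck_cst|exact: IH].
Qed.

(** By the mean value theorem on either side of 0, the difference f - [prim g] is constant, so f
    inherits the derivative of [prim g] at 0 as well. This is used at the pole and, for reflected
    functions, at the equator. *)
Lemma is_derive_removable c d f g : c < 0 < d -> continuous_oo c d f ->
  continuous_oo c d g ->
  (forall x : R, c < x < d -> x != 0 -> is_derive x 1 f (g x)) ->
  forall x : R, c < x < d -> is_derive x 1 f (g x).
Proof.
move=> cd cf cg df x cx; have dp := prim_derive cd cg.
have fE (y : R) : c < y < d -> f 0 + prim g y = f y.
  move=> cy.
  have cD : continuous_oo c d (fun t => f t + - prim g t).
    move=> t ct; apply: continuousD; first exact: cf.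
    by apply: continuousN; exact: is_derive_continuous (dp _ ct).
  have dD (t : R) : c < t < d -> t != 0 -> is_derive t 1 (fun t => f t + - prim g t) 0.
    move=> ct t0; have d1 := df t ct t0; have d2 := dp t ct.
    by isd; ring.
  have cDw (a b : R) : c < a -> b < d -> {within `[a, b], continuous (fun t => f t + - prim g t)}.
    by move=> ca bd; apply: within_continuous_itv => t ab; apply: cD; lra.
  have [y0|y0|<-] := ltgtP 0 y; last by rewrite prim0 addr0.
    have cw : {within `[0, y], continuous (fun t => f t + - prim g t)} by apply: cDw; lra.
    have [|t _] := @MVT _ (fun t => f t + - prim g t) (fun=> 0) 0 y y0 _ cw.
      by move=> t; rewrite in_itv/= => ty; apply: dD; [lra|rewrite gt_eqF; lra].
    by rewrite mul0r prim0; lra.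
  have cw : {within `[y, 0], continuous (fun t => f t + - prim g t)} by apply: cDw; lra.
  have [|t _] := @MVT _ (fun t => f t + - prim g t) (fun=> 0) y 0 y0 _ cw.
    by move=> t; rewrite in_itv/= => ty; apply: dD; [lra|rewrite lt_eqF; lra].
  by rewrite mul0r prim0; lra.
apply: (is_derive_eq_oo cx fE).
by have d1 := dp x cx; isd; ring.
Qed.

(** Integration by parts shows that the derivative of [avg m f] is [avg m.+1 f'], again an average;
    at 0 the singularity is removable. *)
Lemma Ck_avg n m c d f : c < 0 < d -> Ck n c d f -> Ck n c d (avg m f).
Proof.
move=> cd; elim: n m f => [|n IH] m f; first exact: avg_continuous.
move=> Cf; have cf := Ck_continuous Cf; case: Cf => f' df cf'.
have cf'0 := Ck_continuous cf'.
exists (avg m.+1 f'); last exact: IH.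
apply: is_derive_removable => //; [exact: avg_continuous|exact: avg_continuous|].
move=> x cx x0.
have dp := prim_derive cd (continuous_oo_mono (m := m) cf).
have pE : prim (fun t => t ^+ m.+1 * f' t) x =
    x ^+ m.+1 * f x - m.+1%:R * prim (fun t => t ^+ m * f t) x.
  apply: (@prim_unique _ c d _ (fun y => y ^+ m.+1 * f y -
    m.+1%:R * prim (fun t => t ^+ m * f t) y)) => //.
  - exact: continuous_oo_mono.
  - move=> y cy; have d1 := dp y cy; have d2 := df y cy.
    by isd; rewrite /=; ring.
  - by rewrite expr0n mul0r prim0 mulr0 subrr.
have [r r0 xr] : exists2 r, 0 < r & forall y, `|y - x| < r -> y != 0.
  exists `|x|; first by rewrite normr_gt0.
  by move=> y; apply: contraTneq => ->; rewrite sub0r normrN ltxx.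
apply: (@is_derive_near_eq _ (fun y => prim (fun t => t ^+ m * f t) y * (y ^+ m.+1)^-1) _ _ r) => //.
  by move=> y /xr y0; rewrite /avg (negbTE y0).
have d1 := dp x cx.
have xm : x ^+ m.+1 != 0 by rewrite expf_neq0.
have d2 : is_derive x 1 (fun y => (y ^+ m.+1)^-1) (- ((x ^+ m.+1) ^- 2) * (m.+1%:R * x ^+ m)).
  by apply: is_deriveV_fun => //; isd; rewrite /=; ring.
isd; rewrite /avg (negbTE x0) pE !exprS.
move: (prim _ x) (f x) (m.+1%:R : R) (x ^+ m) (expf_neq0 m x0) => p q u w w0.
by field; rewrite x0 w0.
Qed.

Lemma Ck_derive1n n m c d f : Ck (n + m) c d f -> Ck m c d (derive1n n f).
Proof.
elim: n m => [|n IH] m; first by rewrite add0n.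
rewrite addSnnS => /IH [f' df cf']; rewrite derive1nS.
apply: Ck_ext cf' => x cx.
by have [_ <-] := df x cx; rewrite derive1E.
Qed.

Lemma smooth_derivable c d f : (forall n, Ck n c d f) ->
  forall n x, c < x < d -> derivable (derive1n n f) x 1.
Proof.
move=> Cf n x cx; have := @Ck_derive1n n 1 c d f (Cf _).
by move=> [f' df _]; have [] := df x cx.
Qed.

End smooth_interval.

(** * The family of shooting solutions *)

Opaque prim avg.

Lemma expr2n_ge {R : realType} n : n%:R + 1 <= 2 ^+ n :> R.
Proof.
elim: n => [|n IH]; first by rewrite expr0 add0r.
rewrite exprS -natr1; have : 1 <= 2 ^+ n :> R by rewrite exprn_ege1// ler1n.
lra.
Qed.

Lemma le0_geometric {R : realType} (a C : R) :
  (forall n, a <= C / 2 ^+ n) -> a <= 0.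
Proof.
move=> aC; rewrite leNgt; apply/negP => a0.
pose n := Num.bound (`|C| / a).
have := aC n; rewrite ler_pdivlMr ?exprn_gt0// leNgt => /negP; apply.
apply: (@le_lt_trans _ _ (a * n%:R)).
  rewrite mulrC -ler_pdivrMr//; apply: (@le_trans _ _ (`|C| / a)).
    by rewrite ler_pM2r ?invr_gt0// ler_norm.
  by apply/ltW/archi_boundP; rewrite divr_ge0// ltW.
by rewrite ltr_pM2l//; apply: lt_le_trans (expr2n_ge n); rewrite ltrDl.
Qed.

(** The numbers x_n - 2 C / 2^n increase and x_n + 2 C / 2^n decrease, so the supremum of the former
    lies in all the nested intervals. *)
Lemma geometric_limit {R : realType} (x : nat -> R) (C : R) :
  (forall n, `|x n.+1 - x n| <= C / 2 ^+ n) ->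
  exists X, forall n, `|x n - X| <= 2 * C / 2 ^+ n.
Proof.
move=> xC.
have C2 n : C / 2 ^+ n = 2 * (C / 2 ^+ n.+1).
  by rewrite exprS; field; rewrite expf_neq0//.
have up n k : x n - 2 * (C / 2 ^+ n) <= x (n + k)%N - 2 * (C / 2 ^+ (n + k)).
  elim: k => [|k IH]; first by rewrite addn0.
  apply: (le_trans IH); rewrite addnS.
  have := xC (n + k)%N; rewrite ler_norml => /andP[h _].
  by have := C2 (n + k)%N; lra.
have dn n k : x (n + k)%N + 2 * (C / 2 ^+ (n + k)) <= x n + 2 * (C / 2 ^+ n).
  elim: k => [|k IH]; first by rewrite addn0.
  apply: le_trans IH; rewrite addnS.
  have := xC (n + k)%N; rewrite ler_norml => /andP[_ h].
  by have := C2 (n + k)%N; lra.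
have C0 n : 0 <= C / 2 ^+ n by apply: le_trans (xC n).
have ud n m : x n - 2 * (C / 2 ^+ n) <= x m + 2 * (C / 2 ^+ m).
  have := up n m; have := dn m n; rewrite [(m + n)%N]addnC.
  by have := C0 (n + m)%N; lra.
pose Y := [set x n - 2 * (C / 2 ^+ n) | n in [set: nat]].
have Yub m : ubound Y (x m + 2 * (C / 2 ^+ m)) by move=> _ [n _ <-]; exact: ud.
have Y0 : Y !=set0 by exists (x 0%N - 2 * (C / 2 ^+ 0)); exists 0%N.
exists (sup Y) => n; rewrite -mulrA.
have h1 : x n - 2 * (C / 2 ^+ n) <= sup Y.
  by apply: ub_le_sup; [exists (x 0%N + 2 * (C / 2 ^+ 0)); exact: Yub|exists n].
have h2 : sup Y <= x n + 2 * (C / 2 ^+ n) by apply: ge_sup.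
by rewrite ler_norml; lra.
Qed.

Lemma ler_dist3 {R : realType} (a b c d : R) :
  `|a - d| <= `|b - a| + `|b - c| + `|c - d|.
Proof.
rewrite (distrC b a); have := ler_distD b a d; have := ler_distD c b d; lra.
Qed.

Lemma subr_le_approx {R : realType} (a a' x x' C C' : R) :
  `|x - a| <= C -> `|x' - a'| <= C' -> x' <= x -> a' - a <= C + C'.
Proof. by rewrite !ler_norml; lra. Qed.

Section solution.
Context {R : realType}.
Implicit Types (e l K : R) (n : nat).

Definition iterate e l K n : R -> R := iter n (picard e l K) (fun=> 0).

Lemma iterate_continuous e l K n : continuous (iterate e l K n).
Proof.
elim: n => [|n IH]; first exact: cst_continuous.
exact: picard_continuous.
Qed.

Lemma pdistxx e l K : pdist e l K e l K = 0.
Proof. by rewrite /pdist !subrr !normr0 mulr0 !addr0. Qed.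

(** The starting function 0 is thus itself a Picard image, for zero parameters, and the first step
    of the iteration becomes a case of [picard_dist]. *)
Lemma picard000 v : picard 0 0 0 v = (fun=> 0 : R).
Proof.
have s0 : src 0 0 v = (fun=> 0 : R) by apply/funext => s; rewrite /src mul0r subr0.
have p0 (s : R) : prim (fun=> 0 : R) s = 0.
  apply: (@prim_unique _ (- (`|s| + 1)) (`|s| + 1) _ (fun=> 0)) => //.
  - by have := normr_ge0 s; lra.
  - by move=> x _; exact: cst_continuous.
  - by have := ler_norm s; have := ler_norm (- s); rewrite normrN; lra.
have k0 : kof 0 0 0 v = (fun=> 0 : R).
  by apply/funext => s; rewrite /kof s0 p0 addr0.
have h0 : hof 0 0 0 v = (fun=> 0 : R).
  by apply/funext => s; rewrite /hof k0 avg_cst mul0r.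
have g0 : rhog 0 0 0 v = (fun=> 0 : R).
  by apply/funext => s; rewrite /rhog /gof h0 avg_cst mul0r mulr0.
by apply/funext => s; rewrite /picard g0 p0 oppr0.
Qed.

Lemma iterate_step M e l K n (s : R) : 0 <= e <= M ->
  `|iterate e l K n.+1 s - iterate e l K n s| <=
    pdist e l K 0 0 0 * weight M s / 2 ^+ n.
Proof.
move=> eM; have M0 : 0 <= M by apply: le_trans (andP eM).2; case/andP: eM.
elim: n s => [|n IH] s.
  rewrite expr0 divr1 /=.
  have := @picard_dist _ M M0 e l K 0 0 0 0 (fun=> 0) (fun=> 0) eM (lexx 0).
  rewrite picard000 mul0r addr0; apply; try exact: cst_continuous.
  by move=> t; rewrite subrr normr0 mul0r.
have -> : pdist e l K 0 0 0 * weight M s / 2 ^+ n.+1 =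
    (pdist e l K e l K + pdist e l K 0 0 0 / 2 ^+ n / 2) * weight M s.
  by rewrite pdistxx exprS; field; rewrite expf_neq0.
apply: (@picard_dist _ M M0 e l K e l K _ (iterate e l K n.+1) (iterate e l K n)) => //.
- by rewrite divr_ge0 ?pdist_ge0// exprn_ge0.
- exact: iterate_continuous.
- exact: iterate_continuous.
- by move=> t; rewrite mulrAC; exact: IH.
Qed.

Lemma sol_exists e l K : 0 <= e -> exists v : R -> R, forall n (s : R),
  `|iterate e l K n s - v s| <= 2 * (pdist e l K 0 0 0 * weight e s) / 2 ^+ n.
Proof.
move=> e0.
have := @choice R R (fun s X => forall n,
  `|iterate e l K n s - X| <= 2 * (pdist e l K 0 0 0 * weight e s) / 2 ^+ n).
case=> [s|v vP]; last by exists v => n s; exact: vP.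
by apply: geometric_limit => n; apply: iterate_step; rewrite e0 lexx.
Qed.

Definition sol e l K : R -> R :=
  if pselect (0 <= e) is left e0 then sval (cid (sol_exists l K e0)) else fun=> 0.

Lemma sol_rate e l K n (s : R) : 0 <= e -> `|iterate e l K n s - sol e l K s| <=
  2 * (pdist e l K 0 0 0 * weight e s) / 2 ^+ n.
Proof.
by rewrite /sol => e0; case: pselect => // e0'; case: cid => v vP; exact: vP.
Qed.

Lemma sol_continuous e l K : 0 <= e -> continuous (sol e l K).
Proof.
move=> e0 s; apply/cvgrPdist_le => /= ep ep0.
pose C := 2 * (pdist e l K 0 0 0 * weight e (`|s| + 1)).
have [n nC] : exists n, C / 2 ^+ n <= ep / 3.
  apply: contrapT => noN.
  have : ep / 3 <= 0.
    apply: (@le0_geometric _ _ C) => n; rewrite leNgt; apply/negP => /ltW h.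
    by apply: noN; exists n.
  lra.
have rate (t : R) : `|t| <= `|s| + 1 -> `|iterate e l K n t - sol e l K t| <= ep / 3.
  move=> ts; apply: (le_trans (sol_rate _ _ _ _ e0)); apply: le_trans nC.
  rewrite ler_pM2r ?invr_gt0 ?exprn_gt0// ler_pM2l// ler_wpM2l ?pdist_ge0//.
  apply: weight_le => //; by rewrite (@ger0_norm _ (`|s| + 1)).
have cn := @iterate_continuous e l K n s.
have cd : {for s, continuous (fun t => `|iterate e l K n s - iterate e l K n t|)}.
  apply: continuous_comp; last exact: norm_continuous.
  by apply: continuousB; [exact: cst_continuous|exact: cn].
have [|r r0 fr] := continuous_lt_near (z := ep / 3) cd.
  by rewrite subrr normr0; lra.
exists (Num.min r 1) => /=; first by rewrite lt_min r0 ltr01.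
move=> t /=; rewrite lt_min distrC => /andP[tr t1].
have h1 := fr _ tr.
have h2 : `|iterate e l K n s - sol e l K s| <= ep / 3 by apply: rate; lra.
have h3 : `|iterate e l K n t - sol e l K t| <= ep / 3.
  by apply: rate; have := ler_normB t s; have := ler_normD (t - s) s; rewrite subrK; lra.
have := ler_dist3 (sol e l K s) (iterate e l K n s) (iterate e l K n t)
  (sol e l K t).
lra.
Qed.

Lemma sol_fix e l K : 0 <= e -> picard e l K (sol e l K) = sol e l K.
Proof.
move=> e0; apply/funext => s; have ee : 0 <= e <= e by rewrite e0 lexx.
apply/eqP; rewrite -subr_eq0 -normr_le0.
apply: (@le0_geometric _ _ (2 * (pdist e l K 0 0 0 * weight e s))) => n.
have h1 := sol_rate l K n.+1 s e0.
have h2 : `|picard e l K (sol e l K) s - iterate e l K n.+1 s| <=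
   (pdist e l K e l K + 2 * pdist e l K 0 0 0 / 2 ^+ n / 2) * weight e s.
  apply: (@picard_dist _ e e0 e l K e l K _ (sol e l K) (iterate e l K n)) => //.
  - by rewrite divr_ge0 ?mulr_ge0 ?pdist_ge0// exprn_ge0.
  - exact: sol_continuous.
  - exact: iterate_continuous.
  - by move=> t; rewrite distrC mulrAC -(mulrA 2); exact: sol_rate.
have := ler_normD (picard e l K (sol e l K) s - iterate e l K n.+1 s)
  (iterate e l K n.+1 s - sol e l K s).
rewrite addrA subrK => /le_trans; apply.
apply: (@le_trans _ _ _ _ _ (lerD h2 h1)).
rewrite pdistxx exprS le_eqVlt; apply/orP; left; apply/eqP.
by field; rewrite expf_neq0.
Qed.

(** With P the parameter distance, the bound 2 P is invariant under the iteration because P + (2 P)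
    / 2 = 2 P; both sequences start at 0. *)
Lemma sol_dist M e l K e' l' K' (s : R) : 0 <= e <= M -> 0 <= e' <= M ->
  `|sol e l K s - sol e' l' K' s| <= 2 * pdist e l K e' l' K' * weight M s.
Proof.
move=> eM e'M; have e0 : 0 <= e by case/andP: eM.
have e'0 : 0 <= e' by case/andP: e'M.
have M0 : 0 <= M by apply: le_trans (andP eM).2.
have it n (t : R) : `|iterate e l K n t - iterate e' l' K' n t| <=
    2 * pdist e l K e' l' K' * weight M t.
  elim: n t => [|n IH] t.
    by rewrite subrr normr0 !mulr_ge0 ?pdist_ge0 ?expR_ge0.
  have -> : 2 * pdist e l K e' l' K' * weight M t =
     (pdist e l K e' l' K' + 2 * pdist e l K e' l' K' / 2) * weight M t by field.
  apply: (@picard_dist _ M M0) => //.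
  - by rewrite mulr_ge0 ?pdist_ge0.
  - exact: iterate_continuous.
  - exact: iterate_continuous.
rewrite -subr_le0.
apply: (@le0_geometric _ _ (2 * (pdist e l K 0 0 0 * weight e s) +
   2 * (pdist e' l' K' 0 0 0 * weight e' s))) => n.
have h1 := sol_rate l K n s e0; have h2 := sol_rate l' K' n s e'0.
have h3 := it n s.
have := ler_dist3 (sol e l K s) (iterate e l K n s) (iterate e' l' K' n s)
  (sol e' l' K' s).
by rewrite mulrDl; move: h1 h2 h3; clear; lra.
Qed.

(** * Monotone dependence on K *)

Section monotone.
Context (e l K K' : R).
Hypothesis e0 : 0 <= e.
Hypothesis KK' : K <= K'.

(** A smaller v makes G''' larger, and the surplus K' - K in G'' survives both averages; the weight
    t of the second one halves it. Through the minus sign in [picard], the order of the iterates is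
    preserved. *)
Lemma gof_mono (v v' : R -> R) (s : R) : continuous v -> continuous v' ->
  0 <= s -> (forall t : R, 0 <= t -> v' t <= v t) ->
  gof e l K v s + (K' - K) / 2 <= gof e l K' v' s.
Proof.
move=> cv cv' s0 vv'.
have kk (t : R) : 0 <= t -> kof e l K v t + (K' - K) <= kof e l K' v' t.
  move=> t0; rewrite /kof.
  have d (x : R) : 0 <= x <= t -> is_derive x 1
      (fun y => prim (src e l v') y - prim (src e l v) y)
      (src e l v' x - src e l v x).
    move=> _; have d1 := prim_deriveT (src_continuous (e := e) (l := l) cv) x.
    have d2 := prim_deriveT (src_continuous (e := e) (l := l) cv') x.
    exact: is_deriveD_fun d2 (is_deriveN_fun d1).
  have : prim (src e l v') 0 - prim (src e l v) 0 <=
         prim (src e l v') t - prim (src e l v) t.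
    apply: (le_of_derive t0 d) => x xt.
    rewrite /src; have : e * texp (v' x) <= e * texp (v x).
      by rewrite ler_wpM2l// texp_ndecr// vv'//; lra.
    lra.
  rewrite !prim0 /kof; set P := prim (src e l v') t; set Q := prim (src e l v) t.
  by clearbody P Q; lra.
have tpos (r t : R) : 0 <= r -> `|t| <= `|r| -> 0 <= t * r -> 0 <= t.
  move=> r0; have [->|rn0] := eqVneq r 0; first by rewrite normr0 normr_le0 => /eqP->.
  by move=> _; rewrite pmulr_lge0// lt_neqAle eq_sym rn0.
have hh (t : R) : 0 <= t -> hof e l K v t + (K' - K) <= hof e l K' v' t.
  move=> t0; rewrite /hof.
  have -> : avg 0 (kof e l K v) t + (K' - K) =
     avg 0 (fun y => 1 * kof e l K v y + (K' - K) * 1) t.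
    rewrite avg_linz; [|exact: kof_continuous|exact: cst_continuous].
    by rewrite avg_cst; field.
  apply: le_avgz.
  - apply: continuousT_D; apply: continuousT_M; try exact: continuousT_cst.
    exact: kof_continuous.
  - exact: kof_continuous.
  - by move=> x xt xt0; rewrite mul1r mulr1; apply: kk; exact: tpos xt xt0.
rewrite /gof.
have -> : avg 1 (hof e l K v) s + (K' - K) / 2 =
   avg 1 (fun y => 1 * hof e l K v y + (K' - K) * 1) s.
  rewrite avg_linz; [|exact: hof_continuous|exact: cst_continuous].
  by rewrite avg_cst; field.
apply: le_avgz.
- apply: continuousT_D; apply: continuousT_M; try exact: continuousT_cst.
  exact: hof_continuous.
- exact: hof_continuous.
- by move=> x xt xt0; rewrite mul1r mulr1; apply: hh; exact: tpos xt xt0.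
Qed.

Lemma picard_mono (v v' : R -> R) : continuous v -> continuous v' ->
  (forall t : R, 0 <= t -> v' t <= v t) ->
  forall s : R, 0 <= s -> picard e l K' v' s <= picard e l K v s.
Proof.
move=> cv cv' vv' t t0; rewrite /picard lerN2.
have cr := rhog_continuous (e := e) (l := l) (K := K) cv.
have cr' := rhog_continuous (e := e) (l := l) (K := K') cv'.
have rr (x : R) : 0 <= x -> rhog e l K v x <= rhog e l K' v' x.
  move=> x0; rewrite /rhog.
  have := gof_mono cv cv' x0 vv'; move: (gof e l K v x) (gof e l K' v' x) => q q'.
  have KK := KK'; move=> qq; rewrite ler_wpM2l ?(ltW (rho_gt0 _))//; lra.
move: (rhog e l K v) (rhog e l K' v') cr cr' rr => p p' cp cp' pp.
have d (x : R) : 0 <= x <= t -> is_derive x 1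
    (fun y => prim p' y - prim p y) (p' x - p x).
  move=> _; have d1 := prim_deriveT cp x; have d2 := prim_deriveT cp' x.
  by isd; ring.
have : prim p' 0 - prim p 0 <= prim p' t - prim p t.
  by apply: (le_of_derive t0 d) => x xt; rewrite subr_ge0 pp//; lra.
by rewrite !prim0 subrr subr_ge0.
Qed.

Lemma sol_mono (s : R) : 0 <= s -> sol e l K' s <= sol e l K s.
Proof.
have it n (t : R) : 0 <= t -> iterate e l K' n t <= iterate e l K n t.
  elim: n t => [//|n IH] t t0.
  by apply: picard_mono => //; exact: iterate_continuous.
move=> s0; rewrite -subr_le0.
apply: (@le0_geometric _ _ (2 * (pdist e l K 0 0 0 * weight e s) +
   2 * (pdist e l K' 0 0 0 * weight e s))) => n.
rewrite mulrDl.
exact: subr_le_approx (sol_rate l K n s e0) (sol_rate l K' n s e0) (it n s s0).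
Qed.

End monotone.
End solution.

(** * Sign of the shooting solutions *)

(* Here s = 1 - x, G = (1 - x^2)^2 u' = s^2 g, f = l exp (4 u) and l = 6 / alpha;
   the field [shk] is the equation for mass 4/3, and [shgge0] says that u
   increases towards the pole s = 0. *)
Record shooting {R : realType} (e l K : R) (G H k f g : R -> R) : Prop := Shooting {
  shG : forall s : R, 0 <= s <= 1 -> is_derive s 1 G (H s);
  shH : forall s : R, 0 <= s <= 1 -> is_derive s 1 H (k s);
  shk : forall s : R, 0 <= s <= 1 -> is_derive s 1 k (l - f s);
  shf : forall s : R, 0 <= s <= 1 ->
    is_derive s 1 f (- (4 * g s * f s / (2 - s) ^+ 2));
  shGE : forall s : R, 0 <= s <= 1 -> G s = s ^+ 2 * g s;
  shgc : forall s : R, 0 <= s <= 1 -> {for s, continuous g};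
  shH0 : H 0 = 0;
  shk0 : k 0 = K;
  shg0 : g 0 = K / 2;
  shf0 : f 0 = e;
  shfgt0 : forall s : R, 0 <= s <= 1 -> 0 < f s;
  shgge0 : forall s : R, 0 <= s <= 1 -> 0 <= g s }.

Section shooting_sign.
Context {R : realType} (e l K : R) (G H k f g : R -> R).
Hypothesis S : shooting e l K G H k f g.
Hypothesis l0e : 0 < l < e.

Lemma shG0 : G 0 = 0.
Proof. by rewrite (shGE S) ?lexx ?ler01// expr0n/= mul0r. Qed.

Lemma shGge0 s : 0 <= s <= 1 -> 0 <= G s.
Proof. by move=> s01; rewrite (shGE S)// mulr_ge0 ?sqr_ge0// (shgge0 S). Qed.

Lemma shf_nincr s t : 0 <= s -> s <= t -> t <= 1 -> f t <= f s.
Proof.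
move=> s0 st t1.
apply: (ge_of_derive01 s0 st t1 (shf S)) => x xst.
have x01 : 0 <= x <= 1 by lra.
rewrite oppr_le0 divr_ge0 ?sqr_ge0// mulr_ge0//; last exact/ltW/(shfgt0 S).
by rewrite mulr_ge0// (shgge0 S).
Qed.

Lemma shK_ge0 : 0 <= K.
Proof.
have := shgge0 S (s := 0); rewrite lexx ler01 (shg0 S) => /(_ isT); lra.
Qed.

(* With K = 0 the density above l would make G negative near 0. *)
Lemma shK_gt0 : 0 < K.
Proof.
have le' := l0e.
rewrite lt_neqAle shK_ge0 andbT; apply/eqP => K0.
have [d d01 fd] : exists2 d, 0 < d <= 1 & forall s, 0 <= s <= d -> l < f s.
  have cf : {for 0, continuous f}.
    by apply: is_derive_continuous (shf S _); rewrite lexx ler01.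
  have [r r0 fr] : exists2 r, 0 < r & forall y, `|y - 0| < r -> l < f y.
    by apply: continuous_gt_near cf _; rewrite (shf0 S); lra.
  exists (Num.min (r / 2) 1).
    by rewrite lt_min ge_min lexx orbT andbT; lra.
  move=> s; rewrite le_min => /andP[s0 /andP[sr _]]; apply: fr.
  by rewrite subr0 ger0_norm//; lra.
have kneg s : 0 < s <= d -> k s < 0.
  move=> sd; rewrite K0 -(shk0 S).
  apply: (gt_of_derive01 _ _ _ (shk S)); [lra|lra|lra|] => x xs.
  by rewrite subr_lt0 fd//; lra.
have Hneg s : 0 < s <= d -> H s < 0.
  move=> sd; rewrite -(shH0 S).
  apply: (gt_of_derive01 _ _ _ (shH S)); [lra|lra|lra|] => x xs.
  by apply: kneg; lra.
have : G d < 0.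
  rewrite -shG0.
  apply: (gt_of_derive01 _ _ _ (shG S)); [lra|lra|lra|] => x xs.
  by apply: Hneg; lra.
by apply/negP; rewrite -leNgt; apply: shGge0; lra.
Qed.

Lemma shg_pos0 : exists2 d, 0 < d <= 1 & forall s, 0 <= s <= d -> 0 < g s.
Proof.
have le' := l0e.
have cg : {for 0, continuous g} by apply: (shgc S); rewrite lexx ler01.
have [r r0 fr] : exists2 r, 0 < r & forall y, `|y - 0| < r -> 0 < g y.
  by apply: continuous_gt_near cg _; rewrite (shg0 S); have := shK_gt0; lra.
exists (Num.min (r / 2) 1); first by rewrite lt_min ge_min lexx orbT andbT; lra.
move=> s; rewrite le_min => /andP[s0 /andP[sr _]]; apply: fr.
by rewrite subr0 ger0_norm//; lra.
Qed.

Context (s1 : R).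
Hypothesis s101 : 0 <= s1 <= 1.
Hypothesis gs1 : g s1 = 0.

Lemma shs1_gt0 : 0 < s1.
Proof.
have s1' := s101.
rewrite lt_neqAle (andP s101).1 andbT; apply/eqP => s10.
by move: gs1; rewrite -s10 (shg0 S); have := shK_gt0; lra.
Qed.

Lemma shGs1 : G s1 = 0.
Proof. by rewrite (shGE S)// gs1 mulr0. Qed.

(** An interior zero of G >= 0 is a minimum. This is its first-order condition, and [shks1] the
    second-order one. *)
Lemma shHs1 : s1 < 1 -> H s1 = 0.
Proof.
have s1' := s101.
move=> s11; have s10 := shs1_gt0.
have [_ <-] := shG S s101.
have ab : s1 \in `]0, 1[%R by rewrite in_itv/= s10.
have [||_ ->//] := @derive1_at_min _ G 0 1 s1 ler01 _ ab.
- move=> t; rewrite in_itv/= => t01.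
  have t01' : 0 <= t <= 1 by lra.
  by have [] := shG S t01'.
- by move=> t; rewrite in_itv/= => t01; rewrite shGs1; apply: shGge0; lra.
Qed.

Lemma shks1 : s1 < 1 -> 0 <= k s1.
Proof.
have s1' := s101.
move=> s11; have s10 := shs1_gt0; have Hs1 := shHs1 s11.
rewrite leNgt; apply/negP => ks1.
have ck : {for s1, continuous k}.
  by apply: is_derive_continuous (shk S _); lra.
have [r r0 fr] := continuous_lt_near ck ks1.
pose d := Num.min (r / 2) (1 - s1).
have [dr d1 d0] : [/\ d <= r / 2, d <= 1 - s1 & 0 < d].
  by rewrite /d lt_min !ge_min !lexx orbT; split => //; lra.
have kneg s : s1 <= s <= s1 + d -> k s < 0.
  by move=> sd; apply: fr; rewrite ger0_norm; lra.
have Hneg s : s1 < s <= s1 + d -> H s < 0.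
  move=> sd; rewrite -Hs1.
  apply: (gt_of_derive01 _ _ _ (shH S)); [lra|lra|lra|] => x xs.
  by apply: kneg; lra.
have : G (s1 + d) < 0.
  rewrite -shGs1.
  apply: (gt_of_derive01 _ _ _ (shG S)); [lra|lra|lra|] => x xs.
  by apply: Hneg; lra.
by apply/negP; rewrite -leNgt; apply: shGge0; lra.
Qed.

(** Otherwise f >= l on [0, s1] by monotonicity, so H is concave there and vanishes at both ends,
    hence H >= 0. Then G increases up to G(s1) = 0, contradicting its positivity near the pole. *)
Lemma shfs1 : s1 < 1 -> f s1 < l.
Proof.
have s1' := s101.
move=> s11; have s10 := shs1_gt0; have Hs1 := shHs1 s11.
rewrite ltNge; apply/negP => lf.
have kdec s t : 0 <= s -> s <= t -> t <= s1 -> k t <= k s.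
  move=> s0 st t1; apply: (ge_of_derive01 _ st _ (shk S)); [lra|lra|] => x xs.
  by rewrite subr_le0; apply: le_trans lf _; apply: shf_nincr; lra.
have Hge0 t : 0 <= t <= s1 -> 0 <= H t.
  move=> t1; have [kt|kt] := leP 0 (k t).
    rewrite -(shH0 S); apply: (le_of_derive01 _ _ _ (shH S)); [lra|lra|lra|] => x xs.
    by apply: le_trans kt _; apply: kdec; lra.
  rewrite -Hs1; apply: (ge_of_derive01 _ _ _ (shH S)); [lra|lra|lra|] => x xs.
  by apply: le_trans (ltW kt); apply: kdec; lra.
have Gle0 t : 0 <= t <= s1 -> G t <= 0.
  move=> t1; rewrite -shGs1.
  apply: (le_of_derive01 _ _ _ (shG S)); [lra|lra|lra|] => x xs.
  by apply: Hge0; lra.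
have [d d01 gd] := shg_pos0.
pose t := Num.min d s1.
have [td ts1 t0] : [/\ t <= d, t <= s1 & 0 < t].
  by rewrite /t lt_min !ge_min !lexx orbT; split => //; lra.
have := Gle0 t; rewrite (shGE S); last lra.
have gt : 0 < g t by apply: gd; lra.
have : 0 < t ^+ 2 * g t by rewrite mulr_gt0// exprn_gt0.
by move=> ? /(_ _); lra.
Qed.

(* If the zero of G were interior, k would increase from there on up to
   k 1 <= 0, which forces G to become negative. *)
Lemma shs1E : k 1 <= 0 -> s1 = 1.
Proof.
have s1' := s101.
move=> k1; apply/eqP; rewrite eq_le (andP s101).2 /= leNgt; apply/negP => s11.
have s10 := shs1_gt0; have Hs1 := shHs1 s11; have fs1 := shfs1 s11.
have kneg s : s1 <= s < 1 -> k s < 0.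
  move=> ss1; apply: lt_le_trans k1.
  apply: (lt_of_derive01 _ _ _ (shk S)); [lra|lra|lra|] => x xs.
  by rewrite subr_gt0; apply: le_lt_trans fs1; apply: shf_nincr; lra.
have Hneg s : s1 < s <= 1 -> H s < 0.
  move=> sd; rewrite -Hs1.
  apply: (gt_of_derive01 _ _ _ (shH S)); [lra|lra|lra|] => x xs.
  by apply: kneg; lra.
have : G 1 < 0.
  rewrite -shGs1.
  apply: (gt_of_derive01 _ _ _ (shG S)); [lra|lra|lra|] => x xs.
  by apply: Hneg; lra.
by apply/negP; rewrite -leNgt; apply: shGge0; lra.
Qed.

(* The multiplier is (x - x1)(1 - x^2)^2 in the variable x = 1 - s; its fourth
   derivative dominates 120 (x - x1), 120 being the eigenvalue of P4 on the
   spherical harmonics of degree two. *)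
Lemma shk1_lt0 : e < 30 -> k 1 < 0.
Proof.
have s1' := s101.
move=> e30; have s10 := shs1_gt0.
pose O (s : R) := 4 * s1 * s ^+ 2 + - (4 + 4 * s1) * s ^+ 3 + (4 + s1) * s ^+ 4
  + - s ^+ 5.
pose O1 (s : R) := 8 * s1 * s + - (12 + 12 * s1) * s ^+ 2 + (16 + 4 * s1) * s ^+ 3
  + - (5 * s ^+ 4).
pose O2 (s : R) := 8 * s1 + - (24 + 24 * s1) * s + (48 + 12 * s1) * s ^+ 2
  + - (20 * s ^+ 3).
pose O3 (s : R) := - (24 + 24 * s1) + (96 + 24 * s1) * s + - (60 * s ^+ 2).
(* [Q] collects the boundary terms of the integration by parts, so only O'''' G + O f' survives in
   its derivative. Here O'''' = 120 (s1 - s) + 96 (1 - s1), and O f' = - 4 f G (s1 - s) because (2 -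
   s)^2 cancels. *)
pose Q (s : R) := O1 s * k s + - (O2 s * H s) + O3 s * G s + O s * (f s + - l).
have dQ (s : R) : 0 <= s <= 1 -> is_derive s 1 Q
    (G s * ((120 - 4 * f s) * (s1 - s) + 96 * (1 - s1))).
  move=> ss1; rewrite /Q/O1/O2/O3/O.
  have dG := shG S ss1; have dH := shH S ss1.
  have dk := shk S ss1; have df := shf S ss1.
  isd; rewrite ?(shGE S ss1) /=.
  field; lra.
have Qlt : Q 0 < Q s1.
  have [d d01 gd] := shg_pos0.
  pose t := Num.min d s1.
  have [td ts1 t0] : [/\ t <= d, t <= s1 & 0 < t].
    by rewrite /t lt_min !ge_min !lexx orbT; split => //; lra.
  have pos x : 0 <= x < s1 -> 0 < (120 - 4 * f x) * (s1 - x) + 96 * (1 - s1).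
    move=> xs; have : f x <= e by rewrite -(shf0 S); apply: shf_nincr; lra.
    move=> fx; have : 0 < (120 - 4 * f x) * (s1 - x) by rewrite mulr_gt0; lra.
    by have := s101; lra.
  have : Q 0 < Q t.
    apply: (lt_of_derive01 _ t0 _ dQ); [lra|lra|] => x xs.
    rewrite mulr_gt0 ?pos//; last lra.
    by rewrite (shGE S) ?mulr_gt0 ?exprn_gt0 ?gd//; lra.
  move=> /lt_le_trans; apply.
  apply: (le_of_derive01 _ ts1 _ dQ); [lra|lra|] => x xs.
  rewrite mulr_ge0//; first by apply: shGge0; lra.
  by apply/ltW/pos; lra.
have Q0 : Q 0 = 0 by rewrite /Q /O1 /O2 /O3 /O shG0 (shH0 S); ring.
rewrite Q0 in Qlt.
have E : Q s1 = - (s1 ^+ 2 * (2 - s1) ^+ 2) * k s1 - O2 s1 * H s1.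
  by rewrite /Q /O1 /O2 /O3 /O shGs1; ring.
have c0 : 0 < s1 ^+ 2 * (2 - s1) ^+ 2.
  by rewrite mulr_gt0// exprn_gt0//; have := s101; lra.
(* For an interior zero H vanishes; for s1 = 1 the multiplier x (1 - x^2)^2 is odd across the
   equator, so its second derivative vanishes there. *)
have OH : O2 s1 * H s1 = 0.
  have [s11|s11] := ltP s1 1; first by rewrite shHs1// mulr0.
  have s1E : s1 = 1 by lra.
  by rewrite /O2 s1E; ring.
rewrite E OH subr0 mulNr oppr_gt0 pmulr_rlt0// in Qlt.
have [s11|s11] := ltP s1 1; first by have := shks1 s11; lra.
by have <- : s1 = 1 by have := s101; lra.
Qed.

End shooting_sign.

(** * Moments and the Pohozaev identity *)

Lemma antiderivative01 {R : realType} (f : R -> R) :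
  (forall s : R, 0 <= s <= 1 -> {for s, continuous f}) ->
  exists2 J : R -> R, J 0 = 0 &
    forall s : R, 0 <= s <= 1 -> is_derive s 1 J (f s).
Proof.
move=> cf; pose cl (s : R) := Num.min (Num.max s 0) 1.
have cl01 s : 0 <= cl s <= 1.
  by rewrite /cl le_min ge_min lexx orbT le_max lexx orbT ler01.
have cfc : continuous (f \o cl).
  move=> s; apply: continuous_comp; last exact/cf/cl01.
  by apply: continuous_min; [apply: continuous_max|]; [exact: cvg_id|exact: cvg_cst..].
exists (prim (f \o cl)); first exact: prim0.
move=> s /andP[s0 s1]; have {2}-> : s = cl s.
  by rewrite /cl (max_idPl s0) (min_idPl s1).
exact: prim_deriveT.
Qed.

Section moments.
Context {R : realType} (e l K : R) (G H k f g : R -> R).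
Hypothesis S : shooting e l K G H k f g.

(** The moments of f of order 0, 1 and 2 on [0, s], integrated by parts through G''' = l - f into
    expressions in k, H and G. *)
Definition mom0 (s : R) := K - k s + l * s.
Definition mom1 (s : R) := H s - s * k s + l / 2 * s ^+ 2.
Definition mom2 (s : R) := 2 * (s * H s) - s ^+ 2 * k s - 2 * G s + l / 3 * s ^+ 3.

Lemma mom0_derive (s : R) : 0 <= s <= 1 -> is_derive s 1 mom0 (f s).
Proof. by move=> s01; have dk := shk S s01; rewrite /mom0; isd; ring. Qed.

Lemma mom1_derive (s : R) : 0 <= s <= 1 -> is_derive s 1 mom1 (s * f s).
Proof.
move=> s01; have dk := shk S s01; have dH := shH S s01.
by rewrite /mom1; isd; rewrite /=; field.
Qed.

Lemma mom2_derive (s : R) : 0 <= s <= 1 -> is_derive s 1 mom2 (s ^+ 2 * f s).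
Proof.
move=> s01; have dk := shk S s01; have dH := shH S s01; have dG := shG S s01.
by rewrite /mom2; isd; rewrite /=; field.
Qed.

Lemma mom1_at0 : mom1 0 = 0.
Proof. by rewrite /mom1 (shH0 S); ring. Qed.

Lemma mom2_at0 : mom2 0 = 0.
Proof. by rewrite /mom2 (shG0 S); ring. Qed.

Lemma mom1_ndecr (s t : R) : 0 <= s -> s <= t -> t <= 1 -> mom1 s <= mom1 t.
Proof.
move=> s0 st t1; apply: (le_of_derive01 s0 st t1 mom1_derive) => x xst.
by rewrite mulr_ge0//; [lra|apply/ltW/(shfgt0 S); lra].
Qed.

Lemma mom1_ge0 (s : R) : 0 <= s <= 1 -> 0 <= mom1 s.
Proof. by move=> s01; rewrite -mom1_at0; apply: mom1_ndecr; lra. Qed.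

Lemma mom2_ge0 (s : R) : 0 <= s <= 1 -> 0 <= mom2 s.
Proof.
move=> s01; rewrite -mom2_at0.
apply: (le_of_derive01 _ _ _ mom2_derive); [lra|lra|lra|] => x xs.
by rewrite mulr_ge0 ?sqr_ge0//; apply/ltW/(shfgt0 S); lra.
Qed.

(** In the second moment one factor r is bounded by s on [0, s] and by t on [s, t]. *)
Lemma mom2_le (s t : R) : 0 <= s -> s <= t -> t <= 1 ->
  mom2 t <= s * mom1 s + t * (mom1 t - mom1 s).
Proof.
move=> s0 st t1.
have dm (x : R) : 0 <= x <= 1 -> is_derive x 1
    (fun y => y * mom1 y - mom2 y) (mom1 x).
  move=> x01; have d1 := mom1_derive x01; have d2 := mom2_derive x01.
  by isd; rewrite /=; ring.
have ms : mom2 s <= s * mom1 s.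
  have : 0 * mom1 0 - mom2 0 <= s * mom1 s - mom2 s.
    apply: (le_of_derive01 _ _ _ dm); [lra|lra|lra|] => x xs.
    by apply: mom1_ge0; lra.
  by rewrite mom1_at0 mom2_at0; lra.
have dm' (x : R) : 0 <= x <= 1 -> is_derive x 1
    (fun y => y * (mom1 y - mom1 s) - mom2 y) (mom1 x - mom1 s).
  move=> x01; have d1 := mom1_derive x01; have d2 := mom2_derive x01.
  by isd; rewrite /=; ring.
have : s * (mom1 s - mom1 s) - mom2 s <= t * (mom1 t - mom1 s) - mom2 t.
  apply: (le_of_derive01 _ _ _ dm'); [lra|lra|lra|] => x xs.
  by rewrite subr_ge0 mom1_ndecr//; lra.
by rewrite subrr mulr0; lra.
Qed.

(** The equation is multiplied by G, a weight times u'. The left side G G''' is the derivative of G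
    k - H^2 / 2. On the right, f G is - s^2 (2 - s)^2 f' / 4, and integrating it by parts leaves a
    boundary term and moments of f, since the derivative of s^2 (2 - s)^2 / 4 is 2 s - 3 s^2 +
    s^3. *)
Lemma pohozaev : exists J m3 : R -> R,
  [/\ forall s : R, 0 <= s <= 1 -> is_derive s 1 J (G s),
      J 0 = 0,
      forall s : R, 0 <= s <= 1 -> is_derive s 1 m3 (s ^+ 3 * f s),
      m3 0 = 0 &
      forall s : R, 0 <= s <= 1 ->
        m3 s = 6 * J s - (k s - l * s) * s ^+ 3 - 3 * mom1 s * s ^+ 2
               + 3 * mom2 s * s - l / 4 * s ^+ 4
        /\ G s * k s - H s ^+ 2 / 2 = s ^+ 2 * (2 - s) ^+ 2 * f s / 4
             - 2 * mom1 s + 3 * mom2 s - m3 s + l * J s].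
Proof.
have [J J0 dJ] : exists2 J : R -> R, J 0 = 0 &
    forall s : R, 0 <= s <= 1 -> is_derive s 1 J (G s).
  by apply: antiderivative01 => s s01; exact: is_derive_continuous (shG S s01).
pose m3 (s : R) := 6 * J s - (k s - l * s) * s ^+ 3 - 3 * mom1 s * s ^+ 2
  + 3 * mom2 s * s - l / 4 * s ^+ 4.
have m30 : m3 0 = 0 by rewrite /m3 J0; ring.
have dm3 (s : R) : 0 <= s <= 1 -> is_derive s 1 m3 (s ^+ 3 * f s).
  move=> s01; have d1 := mom1_derive s01; have d2 := mom2_derive s01.
  have dk := shk S s01; have dJs := dJ _ s01.
  by rewrite /m3; isd; rewrite /= /mom1 /mom2; field.
exists J, m3; split => // s s01; split => //.
apply: (@eq_of_derive _ (fun s : R => G s * k s - H s ^+ 2 / 2)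
  (fun s : R => s ^+ 2 * (2 - s) ^+ 2 * f s / 4 - 2 * mom1 s + 3 * mom2 s - m3 s
    + l * J s) (fun s => G s * (l - f s)) 0); first lra.
- move=> x xs; have x01 : 0 <= x <= 1 by lra.
  have dG := shG S x01; have dH := shH S x01; have dk := shk S x01.
  by isd; rewrite /=; field.
- move=> x xs; have x01 : 0 <= x <= 1 by lra.
  have df := shf S x01; have dJx := dJ _ x01; have d3 := dm3 _ x01.
  have d1 := mom1_derive x01; have d2 := mom2_derive x01.
  by isd; rewrite /= (shGE S x01); field; lra.
- by rewrite J0 m30 mom1_at0 mom2_at0 (shG0 S) (shH0 S); ring.
Qed.

End moments.

(** * A priori bounds *)

Section concentration.
Context {R : realType} (e l K : R) (G H k f g : R -> R).
Hypothesis S : shooting e l K G H k f g.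
Hypothesis l0e : 0 < l < e.
Hypothesis l30 : l <= 30.
Hypothesis G1 : G 1 = 0.
Hypothesis k1 : k 1 <= 0.

Local Notation A := (mom0 l K k).
Local Notation b := (mom1 l H k).
Local Notation c := (mom2 l G H k).

Let f_le_e (s : R) : 0 <= s <= 1 -> f s <= e.
Proof. by move=> s01; rewrite -(shf0 S); apply: (shf_nincr S); lra. Qed.

Let f0 (s : R) : 0 <= s <= 1 -> 0 < f s. Proof. exact: (shfgt0 S). Qed.

Lemma shk1E : k 1 = 2 * l / 3 - 2 * b 1 + c 1.
Proof. by rewrite /mom1 /mom2 G1; field. Qed.

(** The identity at the equator, with [m] the third moment. Since G(1) = 0, both H(1) and k(1) are
    combinations of moments, and all terms in l^2 and l (b - c) cancel. The inequalities come from
    the integrands s^2 (1 - s) f and s (1 - s)^2 f. *)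
Lemma global_pohozaev : exists m : R,
  [/\ 0 <= m, 0 <= c 1 - m, c 1 - m <= b 1 - c 1 &
   (b 1 - c 1) ^+ 2 / 2 - 2 * (b 1 - c 1) + f 1 / 4 = (l / 6 - 1) * (c 1 - m)].
Proof.
have [J [m3 [dJ J0 dm3 m30 P]]] := pohozaev S.
exists (m3 1).
have d12 (s : R) : 0 <= s <= 1 ->
    is_derive s 1 (fun x => c x - m3 x) (s ^+ 2 * (1 - s) * f s).
  move=> s01; have d2 := mom2_derive S s01; have d3 := dm3 _ s01.
  by isd; ring.
have d01 (s : R) : 0 <= s <= 1 ->
    is_derive s 1 (fun x => b x - c x - (c x - m3 x)) (s * (1 - s) ^+ 2 * f s).
  move=> s01; have d2 := mom2_derive S s01; have d3 := dm3 _ s01.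
  have d1 := mom1_derive S s01; by isd; ring.
have i01 : 0 <= (1 : R) <= 1 by rewrite ler01 lexx.
split.
- rewrite -m30; apply: (le_of_derive01 _ _ _ dm3); [lra|lra|lra|] => x xs.
  by rewrite mulr_ge0 ?exprn_ge0//; [lra|apply/ltW/f0; lra].
- have : c 0 - m3 0 <= c 1 - m3 1.
    apply: (le_of_derive01 _ _ _ d12); [lra|lra|lra|] => x xs.
    rewrite mulr_ge0//; last by apply/ltW/f0; lra.
    by rewrite mulr_ge0 ?sqr_ge0//; lra.
  by rewrite m30 (mom2_at0 S) subrr.
- have : b 0 - c 0 - (c 0 - m3 0) <= b 1 - c 1 - (c 1 - m3 1).
    apply: (le_of_derive01 _ _ _ d01); [lra|lra|lra|] => x xs.
    rewrite mulr_ge0//; last by apply/ltW/f0; lra.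
    by rewrite mulr_ge0 ?sqr_ge0//; lra.
  by rewrite m30 (mom2_at0 S) (mom1_at0 S); lra.
- have [m3E] := P 1 i01.
  have HE : H 1 = c 1 - b 1 + l / 6 by rewrite /mom1 /mom2 G1; field.
  have J1E : J 1 = (m3 1 + (k 1 - l) + 3 * b 1 - 3 * c 1 + l / 4) / 6.
    by rewrite m3E; field.
  by rewrite G1 HE J1E shk1E => PE; lra.
Qed.

(** As l <= 30, the coefficient l / 6 - 1 is at most 4, and the identity bounds b - c by 12.
    Monotonicity of f gives 3 c <= 2 b, so b is at most three times b - c. *)
Lemma mom_bounds : [/\ 0 <= c 1, c 1 <= 24 & b 1 <= 36].
Proof.
have le' := l0e; have l30' := l30.
have i01 : 0 <= (1 : R) <= 1 by rewrite ler01 lexx.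
have [m [_ m0 m1 P]] := global_pohozaev.
have f1 := f0 i01.
have beta12 : b 1 - c 1 <= 12.
  set be := b 1 - c 1 in m1 P *; set y := c 1 - m in m0 m1 P.
  have : (l / 6 - 1) * y <= 4 * be.
    apply: (@le_trans _ _ (4 * y)); last lra.
    by rewrite ler_wpM2r//; lra.
  rewrite -P => be4; rewrite leNgt; apply/negP => be12.
  have : 12 * be < be ^+ 2 by rewrite expr2 ltr_pM2r//; lra.
  lra.
(* The weight 3 s^2 - 2 s is the derivative of s^3 - s^2, which is nonpositive and vanishes at both
   ends; integrating by parts against the decreasing f gives the sign. *)
pose P2 (s : R) := 3 * c s - 2 * b s - (s ^+ 3 - s ^+ 2) * f s.
have dP2 (s : R) : 0 <= s <= 1 -> is_derive s 1 P2
    (- ((s ^+ 2 - s ^+ 3) * (4 * g s * f s / (2 - s) ^+ 2))).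
  move=> s01; have d2 := mom2_derive S s01; have d1 := mom1_derive S s01.
  by have df := shf S s01; rewrite /P2; isd; rewrite /=; field; lra.
have : P2 1 <= P2 0.
  apply: (ge_of_derive01 _ _ _ dP2); [lra|lra|lra|] => x xs.
  rewrite oppr_le0 mulr_ge0//.
    have -> : x ^+ 2 - x ^+ 3 = x ^+ 2 * (1 - x) by ring.
    by rewrite mulr_ge0 ?sqr_ge0//; lra.
  rewrite divr_ge0 ?sqr_ge0// mulr_ge0//; last by apply/ltW/f0; lra.
  by rewrite mulr_ge0// (shgge0 S)//; lra.
rewrite /P2 (mom1_at0 S) (mom2_at0 S) !expr1n !expr0n/= => c3b.
have c0 : 0 <= c 1 by apply: (mom2_ge0 S).
by split; lra.
Qed.

(** At an interior maximum k = 0, so there H is the first moment minus l s^2 / 2; at s = 1 the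
    hypothesis k(1) <= 0 plays the same part. *)
Lemma shH_le s : 0 <= s <= 1 -> H s <= 36.
Proof.
have le' := l0e; have k1' := k1.
have [_ _ b36] := mom_bounds.
have cH : {within `[0, 1], continuous H}.
  by apply: within_continuous_itv => x x01; exact: is_derive_continuous (shH S x01).
have [t] := EVT_max ler01 cH; rewrite in_itv/= => t01 tmax s01.
apply: (@le_trans _ _ (H t)); first by apply: tmax; rewrite in_itv.
have bt : b t <= 36 by apply: le_trans b36; apply: (mom1_ndecr S); lra.
have HE : H t = b t + t * k t - l / 2 * t ^+ 2 by rewrite /mom1; ring.
have [->|t0] := eqVneq t 0; first by rewrite (shH0 S).
have [tE|t1] := eqVneq t 1; first by rewrite HE tE in bt *; rewrite expr1n; lra.
have tin : t \in `]0, 1[%R by rewrite in_itv/= !lt_neqAle eq_sym t0 t1 t01.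
have dH0 : is_derive t 1 H 0.
  apply: (derive1_at_max ler01 _ tin).
    move=> x; rewrite in_itv/= => x01.
    have x01' : 0 <= x <= 1 by lra.
    by have [] := shH S x01'.
  by move=> x; rewrite in_itv/= => x01; apply: tmax; rewrite in_itv/=; lra.
have kt : k t = 0.
  by have [_ <-] := shH S t01; have [_ ->] := dH0.
have : 0 <= l / 2 * t ^+ 2 by rewrite mulr_ge0 ?sqr_ge0//; lra.
by rewrite HE kt mulr0; lra.
Qed.

Lemma shG_le s : 0 <= s <= 1 -> G s <= 36 * s.
Proof.
move=> s01.
have d (x : R) : 0 <= x <= 1 -> is_derive x 1 (fun y => 36 * y - G y) (36 - H x).
  by move=> x01; have dG := shG S x01; isd; ring.
have : 36 * 0 - G 0 <= 36 * s - G s.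
  apply: (le_of_derive01 _ _ _ d); [lra|lra|lra|] => x xs.
  by rewrite subr_ge0 shH_le//; lra.
by rewrite (shG0 S); lra.
Qed.

(** k - l s decreases, and at s = 1 it equals - l / 3 - 2 b + c >= - 10 - 72. *)
Lemma sh_tail_ge s : 0 <= s <= 1 -> - 82 <= k s - l * s.
Proof.
have le' := l0e; have l30' := l30.
move=> s01; have [c0 c24 b36] := mom_bounds.
have d (x : R) : 0 <= x <= 1 -> is_derive x 1 (fun y => k y - l * y) (- f x).
  by move=> x01; have dk := shk S x01; isd; ring.
have : k 1 - l * 1 <= k s - l * s.
  apply: (ge_of_derive01 _ _ _ d); [lra|lra|lra|] => x xs.
  by rewrite oppr_le0; apply/ltW/f0; lra.
by rewrite shk1E; lra.
Qed.

Lemma shk_le s t : 0 <= s -> s <= t -> t <= 1 -> k t <= k s + l * (t - s).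
Proof.
move=> s0 st t1.
have d (x : R) : 0 <= x <= 1 -> is_derive x 1 (fun y => k y - l * y) (- f x).
  by move=> x01; have dk := shk S x01; isd; ring.
have : k t - l * t <= k s - l * s.
  apply: (ge_of_derive01 _ _ _ d); [lra|lra|lra|] => x xs.
  by rewrite oppr_le0; apply/ltW/f0; lra.
lra.
Qed.

Lemma shk_ge (s : R) : 0 <= s <= 1 -> K - e * s <= k s.
Proof.
have le' := l0e => s01.
have d (x : R) : 0 <= x <= 1 -> is_derive x 1 (fun y => k y + e * y) (l - f x + e).
  by move=> x01; have dk := shk S x01; isd; ring.
have : k 0 + e * 0 <= k s + e * s.
  apply: (le_of_derive01 _ _ _ d); [lra|lra|lra|] => y ys.
  by have : f y <= e by [apply: f_le_e; lra]; lra.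
by rewrite (shk0 S); lra.
Qed.

Lemma shH_ge (s : R) : 0 <= s <= 1 -> K * s - e * s ^+ 2 / 2 <= H s.
Proof.
move=> s01.
have d (x : R) : 0 <= x <= 1 -> is_derive x 1
   (fun y => H y - (K * y - e * y ^+ 2 / 2)) (k x - (K - e * x)).
  by move=> x01; have dk := shH S x01; isd; rewrite /=; field.
have : H 0 - (K * 0 - e * 0 ^+ 2 / 2) <= H s - (K * s - e * s ^+ 2 / 2).
  apply: (le_of_derive01 _ _ _ d); [lra|lra|lra|] => y ys.
  by rewrite subr_ge0 shk_ge//; lra.
by rewrite (shH0 S) expr0n/=; lra.
Qed.

Lemma shG_ge (s : R) : 0 <= s <= 1 -> K * s ^+ 2 / 2 - e * s ^+ 3 / 6 <= G s.
Proof.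
move=> s01.
have d (x : R) : 0 <= x <= 1 -> is_derive x 1
   (fun y => G y - (K * y ^+ 2 / 2 - e * y ^+ 3 / 6)) (H x - (K * x - e * x ^+ 2 / 2)).
  by move=> x01; have dk := shG S x01; isd; rewrite /=; field.
have : G 0 - (K * 0 ^+ 2 / 2 - e * 0 ^+ 3 / 6) <= G s - (K * s ^+ 2 / 2 - e * s ^+ 3 / 6).
  apply: (le_of_derive01 _ _ _ d); [lra|lra|lra|] => y ys.
  by rewrite subr_ge0 shH_ge//; lra.
by rewrite (shG0 S) !expr0n/=; lra.
Qed.

Lemma shg_le (s : R) : 0 <= s <= 1 -> g s <= K / 2 + 5.
Proof.
have l30' := l30; have le' := l0e => s01.
have kle (x : R) : 0 <= x <= 1 -> k x <= K + 30 * x.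
  move=> x01; have := @shk_le 0 x (lexx 0); rewrite (shk0 S) subr0.
  have : l * x <= 30 * x by rewrite ler_wpM2r//; lra.
  by case/andP: x01 => x0 x1 ? /(_ x0 x1); lra.
have dH (x : R) : 0 <= x <= 1 -> is_derive x 1
   (fun y => H y - (K * y + 15 * y ^+ 2)) (k x - (K + 30 * x)).
  by move=> x01; have dk := shH S x01; isd; rewrite /=; field.
have Hle (x : R) : 0 <= x <= 1 -> H x <= K * x + 15 * x ^+ 2.
  move=> x01.
  have : H x - (K * x + 15 * x ^+ 2) <= H 0 - (K * 0 + 15 * 0 ^+ 2).
    apply: (ge_of_derive01 _ _ _ dH); [lra|lra|lra|] => y ys.
    by rewrite subr_le0 kle//; lra.
  by rewrite (shH0 S) expr0n/=; lra.
have dG (x : R) : 0 <= x <= 1 -> is_derive x 1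
   (fun y => G y - (K / 2 * y ^+ 2 + 5 * y ^+ 3)) (H x - (K * x + 15 * x ^+ 2)).
  by move=> x01; have dk := shG S x01; isd; rewrite /=; field.
have : G s - (K / 2 * s ^+ 2 + 5 * s ^+ 3) <= G 0 - (K / 2 * 0 ^+ 2 + 5 * 0 ^+ 3).
  apply: (ge_of_derive01 _ _ _ dG); [lra|lra|lra|] => y ys.
  by rewrite subr_le0 Hle//; lra.
rewrite (shG0 S) !expr0n/= (shGE S)// => gE.
have [->|s0] := eqVneq s 0; first by rewrite (shg0 S); lra.
have s2 : 0 < s ^+ 2 by rewrite exprn_even_gt0.
have : s ^+ 2 * g s <= s ^+ 2 * (K / 2 + 5 * s).
  have -> : s ^+ 2 * (K / 2 + 5 * s) = K / 2 * s ^+ 2 + 5 * s ^+ 3 by ring.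
  lra.
by rewrite ler_pM2l//; lra.
Qed.

(** The logarithmic derivative of f is at least - 4 g, and 4 (K / 2 + 5) = 2 K + 20 by [shg_le]. *)
Lemma shf_ge (s : R) : 0 <= s <= 1 -> e * expR (- ((2 * K + 20) * s)) <= f s.
Proof.
move=> s01.
have d (x : R) : 0 <= x <= 1 -> is_derive x 1 (fun y => f y * expR ((2 * K + 20) * y))
   (f x * expR ((2 * K + 20) * x) * (2 * K + 20 - 4 * g x / (2 - x) ^+ 2)).
  by move=> x01; have df := shf S x01; isd; rewrite /=; field; lra.
have : f 0 * expR ((2 * K + 20) * 0) <= f s * expR ((2 * K + 20) * s).
  apply: (le_of_derive01 _ _ _ d); [lra|lra|lra|] => y ys.
  have y01 : 0 <= y <= 1 by lra.
  rewrite mulr_ge0// ?mulr_ge0 ?expR_ge0 ?(ltW (f0 y01))// subr_ge0.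
  have q1 : 1 <= (2 - y) ^+ 2 by rewrite exprn_ege1//; lra.
  have g1 := shg_le y01; have g0 := shgge0 S y01.
  rewrite ler_pdivrMr; last lra.
  apply: (@le_trans _ _ ((2 * K + 20) * 1)); first lra.
  by rewrite ler_wpM2l//; lra.
by rewrite mulr0 expR0 mulr1 (shf0 S) expRN ler_pdivrMr ?expR_gt0.
Qed.

(** This forces K to infinity with e: the decreasing f satisfies f(1) / 2 <= b(1) <= 36, while
    [shf_ge] bounds f(1) from below. *)
Lemma le_e_expK : e <= 72 * expR (2 * K + 20).
Proof.
have le' := l0e.
have [_ _ b36] := mom_bounds.
have d (x : R) : 0 <= x <= 1 -> is_derive x 1 (fun y => b y - f 1 / 2 * y ^+ 2) (x * (f x - f 1)).
  by move=> x01; have df := mom1_derive S x01; isd; rewrite /=; field.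
have : b 0 - f 1 / 2 * 0 ^+ 2 <= b 1 - f 1 / 2 * 1 ^+ 2.
  apply: (le_of_derive01 _ _ _ d); [lra|lra|lra|] => y ys.
  by rewrite mulr_ge0 ?subr_ge0 ?(shf_nincr S)//; lra.
rewrite (mom1_at0 S) expr0n expr1n /= => f72.
have := @shf_ge 1; rewrite ler01 lexx mulr1 expRN => /(_ isT).
rewrite ler_pdivrMr ?expR_gt0// => /le_trans; apply.
by rewrite ler_wpM2r ?expR_ge0//; lra.
Qed.

Lemma shK_le_e : K <= e.
Proof.
have le' := l0e; rewrite leNgt; apply/negP => eK.
by have := @shG_ge 1; rewrite G1 !expr1n ler01 lexx => /(_ isT); lra.
Qed.

(** The parabola K s - e s^2 / 2 below H has its maximum K^2 / (2 e) at s = K / e, and H <= 36. *)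
Lemma shKsqr_le : K ^+ 2 <= 72 * e.
Proof.
have le' := l0e; have K0 := shK_gt0 S l0e; have Ke := shK_le_e.
have e0 : 0 < e by lra.
have Ke01 : 0 <= K / e <= 1 by rewrite divr_ge0 ?ler_pdivrMr//; lra.
have h1 := shH_ge Ke01; have h2 := shH_le Ke01.
have E : K * (K / e) - e * (K / e) ^+ 2 / 2 = K ^+ 2 / (2 * e) by field; lra.
have : K ^+ 2 / (2 * e) <= 36 by lra.
by rewrite ler_pdivrMr; lra.
Qed.

(** For K >= 20 the exponent (2 K + 20) / K is at most 3, so f >= e exp (- 3) on [0, 1/K]; then e /
    (2 K^2) >= 1 / 144 by [shKsqr_le]. This later excludes the root 0 of the quantization. *)
Lemma mom1_bubble_ge : 20 <= K -> expR (- 3) / 144 <= b (K^-1).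
Proof.
have le' := l0e; move=> K20; have K0 : 0 < K by lra.
have K01 : 0 < K^-1 <= 1 by rewrite invr_gt0 K0 invf_le1//; lra.
have fge (x : R) : 0 <= x <= K^-1 -> e * expR (- 3) <= f x.
  move=> xK; have x01 : 0 <= x <= 1 by lra.
  apply: le_trans (shf_ge x01); rewrite ler_pM2l ?ler_expR ?lerN2; last lra.
  apply: (@le_trans _ _ ((2 * K + 20) * K^-1)); first by rewrite ler_wpM2l; lra.
  by rewrite ler_pdivrMr//; lra.
have d (x : R) : 0 <= x <= 1 -> is_derive x 1
    (fun y => b y - e * expR (- 3) / 2 * y ^+ 2) (x * (f x - e * expR (- 3))).
  by move=> x01; have df := mom1_derive S x01; isd; rewrite /=; field.
have : b 0 - e * expR (- 3) / 2 * 0 ^+ 2 <= b K^-1 - e * expR (- 3) / 2 * K^-1 ^+ 2.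
  apply: (le_of_derive01 _ _ _ d); [lra|lra|lra|] => y ys.
  by rewrite mulr_ge0 ?subr_ge0 ?fge//; lra.
rewrite (mom1_at0 S) expr0n /= => bK.
suff : expR (- 3) / 144 <= e * expR (- 3) / 2 * K^-1 ^+ 2 by lra.
have -> : e * expR (- 3) / 2 * K^-1 ^+ 2 = expR (- 3) * (e / (2 * K ^+ 2)).
  by field; lra.
rewrite ler_pM2l ?expR_gt0//.
have K2 : 0 < K ^+ 2 by rewrite exprn_gt0.
by rewrite ler_pdivlMr; have := shKsqr_le; lra.
Qed.

(** If s k > th throughout, H would grow by th ln (d K) between 1/K and d. But H <= 36 and H(1/K) >=
    - 15, which allows at most 51. *)
Lemma exists_small_slope (d th : R) : K^-1 <= d <= 1 -> 0 < K -> 0 < th ->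
  51 < th * ln (d * K) ->
  exists2 s : R, K^-1 <= s <= d & s * k s <= th.
Proof.
have le' := l0e; have l30' := l30.
move=> Kd K0 th0 thd; apply: contrapT => noS.
have Ki0 : 0 < K^-1 by rewrite invr_gt0.
have kbig (s : R) : K^-1 <= s <= d -> th < s * k s.
  by move=> sK; rewrite ltNge; apply/negP => sk; apply: noS; exists s.
have dL (x : R) : K^-1 <= x <= d ->
    is_derive x 1 (fun y => H y - th * ln y) (k x - th / x).
  move=> xK; have x01 : 0 <= x <= 1 by lra.
  have x0 : 0 < x by lra.
  have dH := shH S x01; have dln := is_derive1_ln x0.
  by isd; field; lra.
have : H K^-1 - th * ln K^-1 <= H d - th * ln d.
  apply: (le_of_derive _ dL); first lra.
  move=> x xK; rewrite subr_ge0 ler_pdivrMr; last lra.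
  by rewrite mulrC ltW// kbig; lra.
have d0 : 0 < d by lra.
rewrite lnV ?posrE//; rewrite lnM ?posrE// in thd.
have Hd := @shH_le d; have bK := @mom1_ge0 _ _ _ _ _ _ _ _ _ S K^-1.
have HE : H K^-1 = b K^-1 + K^-1 * k K^-1 - l / 2 * K^-1 ^+ 2.
  by rewrite /mom1; field; lra.
have : l / 2 * K^-1 ^+ 2 <= 15 * 1.
  by rewrite ler_pM ?sqr_ge0//; [lra|lra|rewrite exprn_ile1//; lra].
have := @kbig K^-1; rewrite lexx; move: Hd bK HE.
by move=> /(_ ltac:(lra)) ? /(_ ltac:(lra)) ? ? /(_ ltac:(lra)) ?; lra.
Qed.

End concentration.

(** * Mass quantization at the pole *)

Lemma sqr_2B_le4 {R : realType} (t : R) : 0 <= t <= 1 -> (2 - t) ^+ 2 <= 4.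
Proof.
move=> t01; have -> : (4 : R) = 2 ^+ 2 by ring.
by rewrite lerXn2r ?nnegrE//; lra.
Qed.

(** Here B, C and m are the first, second and third moments up to t, j the integral of G, and x = t
    k(t). In the identity the terms x^2 and B x have cancelled; each remaining term carries a factor
    of size [ep], because C / t stays below 36. *)
Lemma quantization_arith {R : realType} (ep l t B C m j x q : R) :
  0 < t < 1 -> t <= ep -> 0 < l <= 30 -> 0 <= B <= 36 -> 0 <= C <= 36 * t ->
  `|x| <= 82 * ep -> 0 <= j <= 18 * t ^+ 2 -> 0 <= m <= C -> 0 <= q <= 4 * ep ->
  B * (B - 4) = - (C / t * x) + l * t ^+ 2 * x / 3 - l ^+ 2 * t ^+ 4 / 4
    + B * l * t ^+ 2 - q / 2 - 6 * C + 2 * m - 2 * (l * j) ->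
  `|B * (B - 4)| <= 70 * (100 * ep).
Proof.
move=> t01 tep l30 B36 C36 x82 j18 mC q4 ->.
have ep0 : 0 <= ep by clear -t01 tep; lra.
have t0 : 0 < t by clear -t01; lra.
have t2 : 0 <= t ^+ 2 <= ep.
  rewrite sqr_ge0/= expr2; apply: le_trans tep.
  by rewrite -[leRHS]mulr1 ler_pM2l//; clear -t01; lra.
have t2' : t ^+ 2 <= 1 by rewrite exprn_ile1//; clear -t01; lra.
have e1 : `|C / t * x| <= 36 * (82 * ep).
  rewrite normrM ler_pM//.
  rewrite ger0_norm; last by rewrite divr_ge0//; [case/andP: C36|exact: ltW].
  by rewrite ler_pdivrMr//; case/andP: C36.
have l0 : 0 <= l by clear -l30; lra.
have lt : 0 <= l * t ^+ 2 <= 30 * ep.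
  case/andP: l30 => _ l30; case/andP: t2 => t20 t2.
  by rewrite mulr_ge0//= ler_pM.
have lt' : l * t ^+ 2 <= 30 * 1.
  by case/andP: l30 => _ l30; case/andP: t2 => t20 t2; rewrite ler_pM.
have e2 : `|l * t ^+ 2 * x| <= 30 * 1 * (82 * ep).
  by rewrite normrM ler_pM// ger0_norm//; case/andP: lt.
have e3 : 0 <= l ^+ 2 * t ^+ 4 <= 30 * ep * (30 * 1).
  have -> : l ^+ 2 * t ^+ 4 = l * t ^+ 2 * (l * t ^+ 2) by ring.
  case/andP: lt => lt0 lt1.
  by rewrite mulr_ge0//= ler_pM.
have e4 : 0 <= B * l * t ^+ 2 <= 36 * (30 * ep).
  rewrite -mulrA; case/andP: lt => lt0 lt1; case/andP: B36 => B0 B36.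
  by rewrite mulr_ge0//= ler_pM.
have e5 : 0 <= l * j <= 30 * (18 * ep).
  case/andP: j18 => j0 j18; case/andP: l30 => _ l30; case/andP: t2 => _ t2.
  rewrite mulr_ge0//= ler_pM//; apply: le_trans j18 _.
  by rewrite ler_pM2l.
have C' : 0 <= C <= 36 * ep by clear -C36 tep; lra.
move: e1 e2; rewrite !ler_norml => e1 e2.
clear -e1 e2 e3 e4 e5 q4 mC C' ep0.
by apply/andP; split; lra.
Qed.


(** Smallness of s k(s) passes to f only after doubling the radius: the decreasing f satisfies s f(2
    s) <= integral of f over [s, 2 s], which is at most k(s) + 82 by [sh_tail_ge]. *)
Lemma bubble_end {R : realType} (e l K : R) (G H k f g : R -> R)
    (d th s : R) :
  shooting e l K G H k f g -> 0 < l < e -> l <= 30 -> G 1 = 0 -> k 1 <= 0 ->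
  0 < s -> s <= d -> 2 * d <= 1 ->
  s * k s <= th ->
  (2 * s) ^+ 2 * f (2 * s) <= 4 * th + 448 * d /\
  2 * s * k (2 * s) <= 2 * th + 60 * d.
Proof.
move=> S l0e l30 G1 k1 s0 sd d1 ks.
have s01 : 0 <= s <= 1 by lra.
have t01 : 0 <= 2 * s <= 1 by lra.
have ss : s * s <= d * 1 by rewrite ler_pM//; lra.
split.
- have dA (x : R) : 0 <= x <= 1 -> is_derive x 1
      (fun y => mom0 l K k y - f (2 * s) * y) (f x - f (2 * s)).
    by move=> x01; have dm := mom0_derive S x01; isd; ring.
  have : mom0 l K k s - f (2 * s) * s <= mom0 l K k (2 * s) - f (2 * s) * (2 * s).
    apply: (le_of_derive01 _ _ _ dA); [lra|lra|lra|] => y ys.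
    by rewrite subr_ge0 (shf_nincr S)//; lra.
  have k2 := sh_tail_ge S l0e l30 G1 t01.
  rewrite /mom0 => h.
  have h2 : f (2 * s) * s <= k s + 82.
    have : l * s >= 0 by rewrite mulr_ge0//; lra.
    lra.
  have : s * (f (2 * s) * s) <= s * (k s + 82) by rewrite ler_wpM2l//; lra.
  lra.
- have := shk_le S (s := s) (t := 2 * s).
  move=> /(_ ltac:(lra)) /(_ ltac:(lra)) /(_ ltac:(lra)) k2.
  have : s * k (2 * s) <= s * (k s + l * (2 * s - s)) by rewrite ler_wpM2l//; lra.
  have : l * (s * s) <= 30 * d by rewrite ler_pM//; [lra|rewrite mulr_ge0; lra|lra].
  lra.
Qed.

(** The Pohozaev identity localized at a radius where the boundary terms t^2 f and t k are small.
    Only an upper bound on t k is assumed; [sh_tail_ge] supplies t k >= - 82 t. *)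
Lemma mom1_quantized {R : realType} (e l K : R) (G H k f g : R -> R)
    (ep t : R) :
  shooting e l K G H k f g -> 0 < l < e -> l <= 30 -> G 1 = 0 -> k 1 <= 0 ->
  0 < t < 1 -> t <= ep -> t ^+ 2 * f t <= ep ->
  t * k t <= ep -> `|mom1 l H k t * (mom1 l H k t - 4)| <= 70 * (100 * ep).
Proof.
move=> S l0e l30 G1 k1.
have f0 := shfgt0 S; move=> t01 tep ftep ktep; have t01' : 0 <= t <= 1 by clear -t01; lra.
have [J [m3 [dJ J0 dm3 m30 P]]] := pohozaev S.
have ep0 : 0 <= ep by clear -t01 tep; lra.
have [_ _ b1_36] := mom_bounds S l0e l30 G1.
have ft0 := f0 _ t01'.
have bt0 := mom1_ge0 S t01'.
have bt36 : mom1 l H k t <= 36.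
  by apply: le_trans b1_36; apply: (mom1_ndecr S) => //; clear -t01; lra.
have ct0 := mom2_ge0 S t01'.
have ctb : mom2 l G H k t <= 36 * t.
  have := mom2_le S (lexx 0) (andP t01').1 (andP t01').2.
  rewrite (mom1_at0 S) mul0r add0r subr0 => /le_trans; apply.
  by rewrite mulrC ler_wpM2r//; clear -t01; lra.
have kt : - (82 * t) <= t * k t.
  have kt := sh_tail_ge S l0e l30 G1 t01'.
  have lt : 0 <= l * t by rewrite mulr_ge0//; clear -t01 l0e; lra.
  rewrite -mulNr mulrC ler_wpM2l//; first by clear -t01; lra.
  by clear -kt lt; lra.
have J_le : J t <= 18 * t ^+ 2.
  have d (x : R) : 0 <= x <= 1 -> is_derive x 1 (fun y => 18 * y ^+ 2 - J y) (36 * x - G x).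
    by move=> x01; have dG := dJ _ x01; isd; rewrite /=; ring.
  have : 18 * 0 ^+ 2 - J 0 <= 18 * t ^+ 2 - J t.
    apply: (le_of_derive01 _ _ _ d) => //; [clear -t01; lra..|] => y ys.
    by rewrite subr_ge0 (shG_le S l0e l30 G1 k1)//; clear -t01 ys; lra.
  by rewrite J0 expr0n/= mulr0 subr0 subr_ge0.
have J_ge : 0 <= J t.
  rewrite -J0; apply: (le_of_derive01 _ _ _ dJ) => //; [clear -t01; lra..|] => y ys.
  by apply: (shGge0 S); clear -t01 ys; lra.
have m3ge : 0 <= m3 t.
  rewrite -m30; apply: (le_of_derive01 _ _ _ dm3) => //; [clear -t01; lra..|] => y ys.
  have y01 : 0 <= y <= 1 by clear -t01 ys; lra.
  rewrite mulr_ge0 ?(ltW (f0 _ y01)) ?exprn_ge0//; clear -y01; lra.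
have m3le : m3 t <= mom2 l G H k t.
  have d (x : R) : 0 <= x <= 1 -> is_derive x 1 (fun y => mom2 l G H k y - m3 y) (x ^+ 2 * (1 - x) * f x).
    move=> x01; have d1 := dm3 _ x01; have d2 := mom2_derive S x01.
    by isd; rewrite /=; ring.
  have : mom2 l G H k 0 - m3 0 <= mom2 l G H k t - m3 t.
    apply: (le_of_derive01 _ _ _ d) => //; [clear -t01; lra..|] => y ys.
    have y01 : 0 <= y <= 1 by clear -t01 ys; lra.
    rewrite (mulr_ge0 _ (ltW (f0 _ y01)))// mulr_ge0 ?sqr_ge0//; clear -y01; lra.
  by rewrite (mom2_at0 S) m30 subrr subr_ge0.
have HE : H t = mom1 l H k t + t * k t - l / 2 * t ^+ 2 by rewrite /mom1; ring.
have GE : G t = (k t * t ^+ 2 + 2 * mom1 l H k t * t - mom2 l G H k t) / 2 - l / 3 * t ^+ 3.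
  by rewrite /mom1 /mom2; field.
have [_] := P _ t01'; rewrite GE HE => PE.
apply: (@quantization_arith _ ep l t (mom1 l H k t) (mom2 l G H k t) (m3 t) (J t) (t * k t)
  (t ^+ 2 * (2 - t) ^+ 2 * f t)) => //.
- by clear -l0e l30; lra.
- by rewrite bt0.
- by rewrite ct0.
- by rewrite ler_norml; clear -kt ktep tep ep0; lra.
- by rewrite J_ge.
- by rewrite m3ge.
- apply/andP; split; first by rewrite (mulr_ge0 _ (ltW ft0))// mulr_ge0 ?sqr_ge0.
  have -> : t ^+ 2 * (2 - t) ^+ 2 * f t = (2 - t) ^+ 2 * (t ^+ 2 * f t) by ring.
  by rewrite ler_pM ?sqr_ge0 ?sqr_2B_le4// mulr_ge0 ?sqr_ge0// ltW.
- have -> : mom2 l G H k t / t * (t * k t) = mom2 l G H k t * k t by field; clear -t01; lra.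
  by clear -PE; lra.
Qed.

(** The logarithmic derivative of x^2 f is (2 - 4 x g / (2 - x)^2) / x. Expressing x^2 g = G by
    moments, a first moment of at least 2 inside radius s gives x g >= 2 - 18 s / x - 41 x, so x^2 f
    decreases up to integrable errors. *)
Lemma tail_decay {R : realType} (e l K : R) (G H k f g : R -> R)
    (s r : R) :
  shooting e l K G H k f g -> 0 < l < e -> l <= 30 -> G 1 = 0 -> k 1 <= 0 ->
  0 < s -> s <= r -> r <= 1 -> 2 <= mom1 l H k s ->
  r ^+ 2 * f r <= s ^+ 2 * f s * expR 59.
Proof.
move=> S l0e l30 G1 k1 s0 sr r1 b2.
have f0 := shfgt0 S.
have [c1_0 c1_24 b1_36] := mom_bounds S l0e l30 G1.
have bs36 : mom1 l H k s <= 36 by apply: le_trans b1_36; apply: (mom1_ndecr S); lra.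
(* The exponential integrates the two error terms; its values at s and r differ by at most the
   factor exp (18 + 41). *)
pose M (x : R) := x ^+ 2 * f x * expR (18 * s / x - 41 * x).
pose M' (x : R) := x * f x * expR (18 * s / x - 41 * x)
   * (2 - 4 * (x * g x) / (2 - x) ^+ 2 - 18 * s / x - 41 * x).
have dM (x : R) : s <= x <= r -> is_derive x 1 M (M' x).
  move=> xs; have x01 : 0 <= x <= 1 by lra.
  have df := shf S x01; have x0 : x != 0 by rewrite gt_eqF//; lra.
  have dV := is_deriveV_fun x0 (is_derive_id_fun x).
  by rewrite /M /M'; isd; rewrite /=; field; lra.
have : M r <= M s.
  apply: (ge_of_derive sr dM) => x xs; have x01 : 0 <= x <= 1 by lra.
  have x0 : 0 < x by lra.
  rewrite /M' mulr_ge0_le0//.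
    by rewrite !mulr_ge0 ?expR_ge0//; [lra|apply/ltW/f0].
  have Gx : x * (x * g x) = (k x - l * x) * x ^+ 2 / 2 + mom1 l H k x * x - mom2 l G H k x / 2
     + l / 6 * x ^+ 3.
    have -> : x * (x * g x) = G x by rewrite (shGE S x01); ring.
    by rewrite /mom1 /mom2; field.
  have tail := sh_tail_ge S l0e l30 G1 x01.
  have t2 : - 82 * x ^+ 2 <= (k x - l * x) * x ^+ 2 by rewrite ler_wpM2r// sqr_ge0.
  have l3 : 0 <= l / 6 * x ^+ 3.
    by rewrite mulr_ge0 ?exprn_ge0 ?(ltW x0)// divr_ge0// ltW// (andP l0e).1.
  have cx := mom2_le S (ltW s0) (ltW (andP xs).1) (andP x01).2.
  have bx := mom1_ndecr S (ltW s0) (ltW (andP xs).1) (andP x01).2.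
  have bxx : x * (mom1 l H k x - mom1 l H k s) >= 0.
    by rewrite mulr_ge0 ?(ltW x0)// subr_ge0.
  have sb : s * mom1 l H k s <= s * 36 by rewrite ler_wpM2l// ltW.
  have xb : x * 2 <= x * mom1 l H k s by rewrite ler_wpM2l// ltW.
  have xg : x * (2 - 18 * s / x - 41 * x) <= x * (x * g x).
    have -> : x * (2 - 18 * s / x - 41 * x) = 2 * x - 18 * s - 41 * x ^+ 2.
      by field; rewrite gt_eqF.
    by rewrite Gx; clear -cx t2 l3 bxx sb xb; lra.
  rewrite ler_pM2l// in xg.
  have g0 : 0 <= x * g x by rewrite mulr_ge0 ?(shgge0 S)// ltW.
  have : x * g x <= 4 * (x * g x) / (2 - x) ^+ 2.
    rewrite ler_pdivlMr; last by rewrite exprn_gt0//; clear -x01; lra.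
    rewrite mulrC ler_wpM2r//.
    exact: sqr_2B_le4.
  by clear -xg; lra.
rewrite /M => Mle.
have r0 : 0 < r by lra.
have s1 : 18 * s / s = 18 by rewrite mulfK// gt_eqF.
have er : expR (- 41) <= expR (18 * s / r - 41 * r).
  rewrite ler_expR; have : 0 <= 18 * s / r by rewrite divr_ge0 ?mulr_ge0// ltW.
  by clear -r1; lra.
have es : expR (18 * s / s - 41 * s) <= expR 18 by rewrite s1 ler_expR; clear -s0; lra.
have fr0 : 0 <= r ^+ 2 * f r.
  by rewrite mulr_ge0 ?sqr_ge0//; apply/ltW/f0; rewrite r1 ltW.
have fs0 : 0 <= s ^+ 2 * f s.
  by rewrite mulr_ge0 ?sqr_ge0//; apply/ltW/f0; rewrite (le_trans sr r1) ltW.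
have : r ^+ 2 * f r * expR (- 41) <= s ^+ 2 * f s * expR 18.
  apply: (le_trans (ler_wpM2l fr0 er)); apply: (le_trans Mle).
  exact: ler_wpM2l.
have -> : expR (59 : R) = expR 18 * expR 41 by rewrite -expRD -natrD.
by rewrite mulrA expRN ler_pdivrMr ?expR_gt0.
Qed.

(** The local identity is used only to push the first moment above 2. The decay of x^2 f then makes
    f(1) and the second moment small, the global identity gives |b - c - 4| <= 10 ep (36 + E), and
    k(1) = 2 l / 3 - 2 (b - c) - c yields the constant 20 + 1. *)
Lemma quantization {R : realType} (e l K : R) (G H k f g : R -> R)
    (E ep s : R) :
  shooting e l K G H k f g -> 0 < l < e -> l <= 30 -> G 1 = 0 -> k 1 <= 0 ->
  expR 59 <= E ->
  0 < s < 1 -> s <= ep -> s ^+ 2 * f s <= ep -> s * k s <= ep ->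
  expR (- 3) / 144 <= mom1 l H k s ->
  70 * (100 * ep) < expR (- 3) / 72 -> ep * (36 + E) <= 1 ->
  `|k 1 - (2 * l / 3 - 8)| <= 21 * (ep * (36 + E)).
Proof.
move=> S l0e l30 G1 k1.
have f0 := shfgt0 S.
move: (expR (- 3)) (fun r => @tail_decay _ _ _ _ _ _ _ _ _ s r S l0e l30 G1 k1) (expR_gt0 (59 : R)).
move: (expR 59) => E59 c0 td E0 EE s01 sep fep kep bc epc ep1.
have s01' : 0 <= s <= 1 by clear -s01; lra.
have [_ _ b1_36] := mom_bounds S l0e l30 G1.
have ep0 : 0 < ep by clear -s01 sep; lra.
have bs0 := mom1_ge0 S s01'.
(* If b < 2 then 2 b <= b (4 - b) <= 7000 ep < exp (- 3) / 72, against the lower bound on b. *)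
have bs2 : 2 <= mom1 l H k s.
  have := mom1_quantized S l0e l30 G1 k1 s01 sep fep kep; rewrite ler_norml => /andP[q _].
  rewrite leNgt; apply/negP => b2.
  have : mom1 l H k s * 2 <= mom1 l H k s * (4 - mom1 l H k s) by rewrite ler_wpM2l//; clear -b2; lra.
  by clear -q epc bc; lra.
pose ep' := ep * (36 + E); rewrite -/ep' in ep1 *.
have epE : ep * E59 <= ep * E by rewrite ler_pM2l.
have epE0 : 0 < ep * E59 by rewrite mulr_gt0.
have decay (r : R) : s <= r <= 1 -> r ^+ 2 * f r <= ep * E59.
  move=> /andP[sr r1]; apply: (@le_trans _ _ (s ^+ 2 * f s * E59)).
    by apply: td => //; clear -s01; lra.
  by rewrite ler_pM2r.
have f1 : f 1 <= ep'.
  have := decay 1; rewrite expr1n mul1r lexx andbT => /(_ ltac:(clear -s01; lra)).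
  by rewrite /ep'; clear -epE ep0; lra.
have f1_0 : 0 < f 1 by apply: f0; rewrite lexx ler01.
have bs36 : mom1 l H k s <= 36.
  by apply: le_trans b1_36; apply: (mom1_ndecr S) => //; clear -s01; lra.
have cs : mom2 l G H k s <= 36 * ep.
  have := mom2_le S (lexx 0) (andP s01').1 (andP s01').2.
  rewrite (mom1_at0 S) mul0r add0r subr0 => /le_trans; apply.
  by rewrite mulrC ler_pM//; clear -s01; lra.
have c1 : mom2 l G H k 1 <= ep'.
  have d (x : R) : 0 <= x <= 1 -> is_derive x 1 (fun y => mom2 l G H k y - ep * E59 * y)
      (x ^+ 2 * f x - ep * E59).
    by move=> x01; have dm := mom2_derive S x01; isd; rewrite /=; ring.
  have : mom2 l G H k 1 - ep * E59 * 1 <= mom2 l G H k s - ep * E59 * s.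
    apply: (ge_of_derive01 _ _ _ d) => //; [clear -s01; lra..|] => y ys.
    by rewrite subr_le0 decay//; clear -ys s01; lra.
  have : 0 <= ep * E59 * s by rewrite mulr_ge0//; [exact: ltW|clear -s01; lra].
  by rewrite /ep'; clear -cs epE; lra.
have bs1 : mom1 l H k s <= mom1 l H k 1 by apply: (mom1_ndecr S) => //; clear -s01; lra.
have [m [m_0 m0 m1 P]] := global_pohozaev S G1.
have cm : mom2 l G H k 1 - m <= ep' by clear -m_0 c1; lra.
have be1 : 1 <= mom1 l H k 1 - mom2 l G H k 1 by clear -bs2 bs1 c1 ep1; lra.
have c1_0 : 0 <= mom2 l G H k 1 by clear -m_0 m0; lra.
clear -l0e l30 G1 P cm be1 c1_0 c1 f1 f1_0 m0 ep1.
have bE : mom1 l H k 1 = (mom1 l H k 1 - mom2 l G H k 1) + mom2 l G H k 1 by rewrite subrK.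
rewrite (shk1E l H k G1) bE.
move: P m0 c1 c1_0 cm be1 f1 f1_0; move: (mom1 l H k 1 - mom2 l G H k 1) => be.
move: (mom2 l G H k 1) (f 1) => c1 f1 P m0 c1le c1_0 cm be1 f1le f1_0.
have ep'0 : 0 <= ep' by clear -c1le c1_0; lra.
have {be1}: `|be - 4| <= 10 * ep'.
  have : `|be * (be - 4)| <= 10 * ep'.
    have -> : be * (be - 4) = 2 * ((l / 6 - 1) * (c1 - m)) - f1 / 2.
      by rewrite -P; field.
    have : `|(l / 6 - 1) * (c1 - m)| <= 4 * ep'.
      by rewrite normrM ler_pM//; [rewrite ler_norml; clear -l0e l30; lra|rewrite ger0_norm].
    by rewrite !ler_norml; clear -f1le f1_0 ep'0; lra.
  rewrite normrM ger0_norm; last by clear -be1; lra.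
  by apply: le_trans; rewrite -[leLHS]mul1r ler_wpM2r.
by rewrite !ler_norml; clear -c1le c1_0; lra.
Qed.

Lemma shooting_asymptotics {R : realType} (eta : R) : 0 < eta ->
  exists E : R, forall (e l K : R) (G H k f g : R -> R),
    shooting e l K G H k f g -> 0 < l < e -> l <= 30 -> G 1 = 0 -> k 1 <= 0 ->
    E <= e -> `|k 1 - (2 * l / 3 - 8)| <= eta.
Proof.
move=> eta0; have := expR_gt0 (59 : R).
have := fun e l K G H k f g ep s =>
  @quantization R e l K G H k f g (expR 59) ep s.
move: (expR 59) => E59 quant E590.
have := expR_gt0 (- 3 : R); have := @mom1_bubble_ge R; move: (expR (- 3)) quant.
move=> c0 quant bubble c00.
pose ep := Num.min (Num.min 1 (eta / 21) / (36 + E59)) (c0 / (72 * (72 * 100))).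
have m0 : 0 < Num.min 1 (eta / 21) by rewrite lt_min ltr01 divr_gt0.
have ep0 : 0 < ep.
  by rewrite lt_min !divr_gt0//; lra.
have E0 : 0 < 36 + E59 by lra.
have epE : ep * (36 + E59) <= Num.min 1 (eta / 21).
  by rewrite -ler_pdivlMr// ge_min lexx.
have ep1 : ep * (36 + E59) <= 1 by rewrite (le_trans epE)// ge_min lexx.
have epeta : ep * (36 + E59) <= eta / 21.
  by rewrite (le_trans epE)// ge_min lexx orbT.
have epc : 70 * (100 * ep) < c0 / 72.
  have : ep <= c0 / (72 * (72 * 100)) by rewrite ge_min lexx orbT.
  rewrite ler_pdivlMr; last by rewrite !mulr_gt0.
  by rewrite ltr_pdivlMr//; lra.
have ep36 : ep * 36 <= 1.
  by apply: le_trans ep1; rewrite ler_pM2l//; lra.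
move: ep ep0 ep1 epeta epc ep36 {epE} => ep ep0 ep1 epeta epc ep36.
(* With th = d, [bubble_end] gives bounds 452 d and 62 d, both below ep. *)
pose d := ep / 600.
have [d0 d1 dep] : [/\ 0 < d, 20 * d <= 1 & 600 * d = ep].
  by rewrite /d; clear -ep0 ep36; split; lra.
(* For K > M this makes d ln (d K) > 51, as [exists_small_slope] requires. *)
pose M := expR (51 / d + 1) / d.
have M1 : 1 / d <= M.
  rewrite ler_pM2r ?invr_gt0//; apply: le_trans (expR_ge1Dx _).
  have : 0 <= 51 / d by rewrite divr_ge0// ltW.
  lra.
have M20 : 20 <= M by apply: le_trans M1; rewrite ler_pdivlMr.
have ME : expR (51 / d + 1) = d * M by rewrite [RHS]mulrC divfK// gt_eqF.
clearbody M d.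
(* Chosen so that [le_e_expK] forces K > M. *)
exists (72 * expR (2 * M + 20) + 1) => e l K G H k f g S l0e l30 G1 k1 Ee.
have MK : M < K.
  rewrite ltNge; apply/negP => KM.
  have := le_e_expK S l0e l30 G1.
  have : expR (2 * K + 20) <= expR (2 * M + 20) by rewrite ler_expR; clear -KM; lra.
  by clear -Ee; lra.
have K0 : 0 < K by clear -MK M20; lra.
have Kd : K^-1 <= d.
  rewrite -[leRHS]invrK lef_pV2 ?posrE ?invr_gt0//.
  by rewrite -[leLHS]mul1r; clear -M1 MK; lra.
have thd : 51 < d * ln (d * K).
  have dK : expR (51 / d + 1) < d * K by rewrite ME ltr_pM2l.
  have h : 51 / d + 1 < ln (d * K).
    by rewrite -ltr_expR lnK// posrE (lt_trans (expR_gt0 _) dK).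
  apply: (@lt_trans _ _ (d * (51 / d + 1))); last by rewrite ltr_pM2l.
  by rewrite mulrDr mulr1 mulrCA divff ?gt_eqF// mulr1 ltrDl.
have K0i : 0 < K^-1 by rewrite invr_gt0.
have Kd1 : K^-1 <= d <= 1 by rewrite Kd; clear -d0 d1; lra.
have [s sK sk] := exists_small_slope S l0e l30 G1 k1 Kd1 K0 d0 thd.
have [s0 sd] : 0 < s /\ s <= d by clear -sK K0i; lra.
have dd : 2 * d <= 1 by clear -d0 d1; lra.
have [fe ke] := bubble_end S l0e l30 G1 k1 s0 sd dd sk.
have s2 : 0 < 2 * s < 1 by clear -s0 sd d0 d1; lra.
have s2ep : 2 * s <= ep by clear -sd d0 dep; lra.
have fe' : (2 * s) ^+ 2 * f (2 * s) <= ep.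
  by apply: (le_trans fe); clear -d0 dep; lra.
have ke' : 2 * s * k (2 * s) <= ep by apply: (le_trans ke); clear -d0 dep; lra.
have K2s : K^-1 <= 2 * s by clear -sK K0i; lra.
apply: (@le_trans _ _ (21 * (ep * (36 + E59)))).
  apply: (quant _ _ _ _ _ _ _ _ ep (2 * s) S l0e l30 G1 k1 (lexx _) s2 s2ep fe' ke' _ epc ep1).
  apply: (le_trans (bubble _ _ _ _ _ _ _ _ S l0e l30 G1 k1 _)).
    by clear -MK M20; lra.
  exact: (mom1_ndecr S (ltW K0i) K2s (ltW (andP s2).2)).
by clear -epeta; lra.
Qed.

(** * The critical shooting parameter *)

Lemma ivt_segment {R : realType} (f : R -> R -> R) (p0 p1 q0 q1 : R) :
  (forall M : R, 0 <= M -> exists2 C : R, 0 < C &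
    forall e l e' l' : R, 0 <= e <= M -> 0 <= e' <= M -> 0 <= l -> 0 <= l' ->
    `|f e l - f e' l'| <= C * (`|e - e'| + `|l - l'|)) ->
  0 < p0 -> 0 < p1 -> 0 < q0 -> 0 < q1 -> f p0 q0 < 0 -> 0 < f p1 q1 ->
  exists2 t : R, 0 <= t <= 1 & f (p0 + t * (p1 - p0)) (q0 + t * (q1 - q0)) = 0.
Proof.
move=> flip p00 p10 q00 q10 k0 k1.
pose M := p0 + p1; have M0 : 0 <= M by rewrite /M; lra.
have [C C0 lip] := flip _ M0.
pose F (t : R) := f (p0 + t * (p1 - p0)) (q0 + t * (q1 - q0)).
have rng (a b t : R) : 0 < a -> 0 < b -> 0 <= t <= 1 -> 0 <= a + t * (b - a) <= a + b.
  move=> a0 b0 t01; have : 0 <= t * b <= 1 * b.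
    by rewrite mulr_ge0 ?ler_wpM2r//; lra.
  have : 0 <= t * a <= 1 * a by rewrite mulr_ge0 ?ler_wpM2r//; lra.
  lra.
pose cl (t : R) := Num.min (Num.max t 0) 1.
have cl01 t : 0 <= cl t <= 1.
  by rewrite /cl le_min ge_min lexx orbT le_max lexx orbT ler01.
have clc (s : R) : {for s, continuous cl}.
  by apply: continuous_min; [apply: continuous_max|]; [exact: cvg_id|exact: cvg_cst..].
have Flip (s t : R) : 0 <= s <= 1 -> 0 <= t <= 1 ->
    `|F s - F t| <= C * (`|p1 - p0| + `|q1 - q0|) * `|s - t|.
  move=> s01 t01.
  have [p1s _] := andP (rng _ _ _ q00 q10 s01); have [p1t _] := andP (rng _ _ _ q00 q10 t01).
  have := lip _ _ _ _ (rng _ _ _ p00 p10 s01) (rng _ _ _ p00 p10 t01) p1s p1t.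
  have E (a b : R) : a + s * (b - a) - (a + t * (b - a)) = (b - a) * (s - t) by ring.
  by rewrite !E !normrM -mulrDl mulrA.
pose L := C * (`|p1 - p0| + `|q1 - q0|) + 1.
have L0 : 0 < L by rewrite ltr_wpDl// mulr_ge0 ?addr_ge0// ltW.
have cF : continuous (F \o cl).
  move=> s; apply/cvgrPdist_le => /= ep ep0.
  have cd : {for s, continuous (fun t => `|cl s - cl t|)}.
    apply: continuous_comp; last exact: norm_continuous.
    by apply: continuousB; [exact: cst_continuous|exact: clc].
  have [|r r0 fr] := continuous_lt_near (z := ep / L) cd.
    by rewrite subrr normr0 divr_gt0.
  exists r => //= t /=; rewrite distrC => tr.
  apply: (le_trans (Flip _ _ (cl01 _) (cl01 _))).
  have := fr _ tr; rewrite ltr_pdivlMr// => h.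
  apply: le_trans (ltW h); rewrite mulrC ler_wpM2l// /L.
  by rewrite lerDl.
have cl0 : cl 0 = 0 by rewrite /cl (max_idPl (lexx 0)) (min_idPl ler01).
have cl1 : cl 1 = 1 by rewrite /cl (max_idPl ler01) (min_idPl (lexx 1)).
have F0 : (F \o cl) 0 < 0 by rewrite /= cl0 /F !mul0r !addr0.
have F1 : 0 < (F \o cl) 1 by rewrite /= cl1 /F !mul1r !subrKC.
have [t _ Ft] : exists2 c, c \in `[0, 1]%R & (F \o cl) c = 0.
  apply: IVT => //; first exact: continuous_subspaceT.
  by rewrite ge_min le_max (ltW F0) (ltW F1) orbT.
by exists (cl t).
Qed.

Section family.
Context {R : realType}.
Implicit Types (e l K M : R).

Definition ksol e l K : R -> R := kof e l K (sol e l K).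
Definition hsol e l K : R -> R := hof e l K (sol e l K).
Definition gsol e l K : R -> R := gof e l K (sol e l K).

Opaque prim avg sol.

Lemma gsol_continuous e l K : 0 <= e -> continuous (gsol e l K).
Proof. by move=> e0; exact/gof_continuous/sol_continuous. Qed.

Lemma hsol_continuous e l K : 0 <= e -> continuous (hsol e l K).
Proof. by move=> e0; exact/hof_continuous/sol_continuous. Qed.

Lemma ksol_continuous e l K : 0 <= e -> continuous (ksol e l K).
Proof. by move=> e0; exact/kof_continuous/sol_continuous. Qed.

Lemma sol_derive e l K (s : R) : 0 <= e ->
  is_derive s 1 (sol e l K) (- (rho s * gsol e l K s)).
Proof.
move=> e0; rewrite -{1}(sol_fix l K e0) /picard /gsol -/(rhog e l K (sol e l K) s).
have cr := rhog_continuous (e := e) (l := l) (K := K) (@sol_continuous _ e l K e0).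
exact/is_deriveN_fun/prim_deriveT.
Qed.

Lemma sol_at0 e l K : 0 <= e -> sol e l K 0 = 0.
Proof. by move=> e0; rewrite -(sol_fix l K e0) /picard prim0 oppr0. Qed.

Lemma ksol_derive e l K (s : R) : 0 <= e ->
  is_derive s 1 (ksol e l K) (l - e * texp (sol e l K s)).
Proof.
move=> e0; rewrite /ksol /kof.
have cs := src_continuous (e := e) (l := l) (@sol_continuous _ e l K e0).
by have dp := prim_deriveT cs s; isd; rewrite add0r.
Qed.

Lemma ksol_at0 e l K : ksol e l K 0 = K.
Proof. by rewrite /ksol /kof prim0 addr0. Qed.

Lemma hsol_derive e l K (s : R) : 0 <= e ->
  is_derive s 1 (fun t => t * hsol e l K t) (ksol e l K s).
Proof.
move=> e0; have := @avg_derivez _ 0 _ (@ksol_continuous e l K e0) s.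
rewrite expr0 mul1r /=; congr (is_derive s 1 _ _).
Qed.

Lemma gsol_derive e l K (s : R) : 0 <= e ->
  is_derive s 1 (fun t => t ^+ 2 * gsol e l K t) (s * hsol e l K s).
Proof.
by move=> e0; have := @avg_derivez _ 1 _ (@hsol_continuous e l K e0) s.
Qed.

Lemma gsol_at0 e l K : gsol e l K 0 = K / 2.
Proof.
Transparent avg.
by rewrite /gsol /gof /avg eqxx /hof /avg eqxx /kof prim0 addr0 divr1.
Opaque avg.
Qed.

Lemma gsol_mono e l K K' (s : R) : 0 <= e -> K <= K' -> 0 <= s ->
  gsol e l K s + (K' - K) / 2 <= gsol e l K' s.
Proof.
move=> e0 KK' s0; apply: gof_mono => //.
- exact: sol_continuous.
- exact: sol_continuous.
- by move=> t t0; exact: sol_mono.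
Qed.

Lemma family_lipschitz M : 0 <= M -> exists2 C : R, 0 < C &
  forall e l K e' l' K' (s : R), 0 <= e <= M -> 0 <= e' <= M -> 0 <= s <= 1 ->
  `|gsol e l K s - gsol e' l' K' s| <= C * pdist e l K e' l' K' /\
  `|ksol e l K s - ksol e' l' K' s| <= C * pdist e l K e' l' K'.
Proof.
move=> M0; pose C := 2 + 2 * lipc M * weight M 1.
have C0 : 0 < C.
  by rewrite ltr_pwDl// !mulr_ge0 ?expR_ge0//; have := lipc_ge1 M0; lra.
exists C => // e l K e' l' K' s eM e'M s01.
have P0 := pdist_ge0 e l K e' l' K'.
have e0 : 0 <= e by case/andP: eM.
have e'0 : 0 <= e' by case/andP: e'M.
have D0 : 0 <= 2 * pdist e l K e' l' K' by rewrite mulr_ge0.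
have vv' (t : R) : `|sol e l K t - sol e' l' K' t| <=
   2 * pdist e l K e' l' K' * weight M t by exact: sol_dist.
have omC : pdist e l K e' l' K' * (1 + `|s|) +
   lipc M * (2 * pdist e l K e' l' K') * (`|s| * weight M `|s|) <=
   C * pdist e l K e' l' K'.
  have s1 : `|s| <= 1 by rewrite ger0_norm; lra.
  have w1 : `|s| * weight M `|s| <= 1 * weight M 1.
    by rewrite ler_pM ?expR_ge0// weight_le// normr_id normr1.
  move: (weight M `|s|) (weight M 1) (lipc M) (lipc_ge1 M0) @C C0 w1.
  move=> w w1 L L1 C C0 ww.
  have : pdist e l K e' l' K' * (1 + `|s|) <= pdist e l K e' l' K' * 2.
    by rewrite ler_wpM2l//; lra.
  have : L * (2 * pdist e l K e' l' K') * (`|s| * w) <=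
     L * (2 * pdist e l K e' l' K') * (1 * w1).
    by rewrite ler_wpM2l// mulr_ge0//; lra.
  by rewrite /C; lra.
split.
  apply: le_trans omC.
  exact: (@gof_dist _ M M0 e l K e' l' K' _ _ _ eM D0
    (@sol_continuous _ e l K e0) (@sol_continuous _ e' l' K' e'0) vv' s).
apply: le_trans omC.
exact: (@kof_dist _ M M0 e l K e' l' K' _ _ _ eM D0
    (@sol_continuous _ e l K e0) (@sol_continuous _ e' l' K' e'0) vv' s).
Qed.

Opaque ksol gsol hsol.

Definition admissible e l K :=
  (forall s : R, 0 <= s <= 1 -> 0 <= gsol e l K s) /\
  exists2 s : R, 0 <= s <= 1 & gsol e l K s = 0.

(** The derivative of k is at least - e exp 4, so k >= 1 on the hemisphere, and the averages keep a
    positive lower bound. *)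
Lemma gsol_large e l (s : R) : 0 <= e -> 0 <= l -> 0 <= s <= 1 ->
  0 < gsol e l (e * expR 4 + 1) s.
Proof.
move=> e0 l0 s01; set K := _ + 1.
have pos (m : nat) (f : R -> R) (t : R) : continuous f -> 0 <= t <= 1 -> (forall r : R, 0 <= r <= 1 -> 1 <= f r) ->
    1 / m.+1%:R <= avg m f t.
  move=> cf t01 f1; rewrite -(avg_cst m 1 t).
  apply: le_avgz => // [|r rt r0]; first exact: cst_continuous.
  apply: f1; have [tz|tn] := eqVneq t 0.
    by move: rt; rewrite tz normr0 normr_le0 => /eqP ->; lra.
  have t0 : 0 < t by rewrite lt_neqAle eq_sym tn; case/andP: t01.
  have {}r0 : 0 <= r by move: r0; rewrite pmulr_lge0.
  by move: rt; rewrite !ger0_norm//; lra.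
have k1 (r : R) : 0 <= r <= 1 -> 1 <= ksol e l K r.
  move=> r01.
  have d (x : R) : 0 <= x <= r -> is_derive x 1 (fun y => ksol e l K y + e * expR 4 * y)
      (l - e * texp (sol e l K x) + e * expR 4).
    by move=> _; have dk := ksol_derive l K x e0; isd; ring.
  have : ksol e l K 0 + e * expR 4 * 0 <= ksol e l K r + e * expR 4 * r.
    apply: (le_of_derive _ d) => [|x xr]; first lra.
    have : e * texp (sol e l K x) <= e * expR 4 by rewrite ler_wpM2l ?texp_le.
    move: (texp _) => q; lra.
  rewrite ksol_at0 mulr0 addr0; have : e * expR 4 * r <= e * expR 4 * 1.
    by rewrite ler_wpM2l ?mulr_ge0 ?expR_ge0//; lra.
  rewrite /K; move: (ksol _ _ _ _) => q; lra.
have h1 (r : R) : 0 <= r <= 1 -> 1 <= hsol e l K r.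
  move=> r01; have := pos 0 (ksol e l K) r; rewrite divr1; apply => //.
  exact: ksol_continuous.
apply: (@lt_le_trans _ _ (1 / 2)); first lra.
by apply: (pos 1 (hsol e l K) s) => //; exact: hsol_continuous.
Qed.

(** The critical K is the supremum of those for which g reaches a value <= 0; K = 0 is one, as g(0)
    = K / 2. Larger K have g > 0, so g >= 0 at the supremum by continuity in K; if g had a positive
    minimum there, the Lipschitz bound would exclude such K nearby. *)
Lemma admissible_exists e l : 0 <= e -> 0 <= l -> exists K, admissible e l K.
Proof.
move=> e0 l0.
have [C C0 lip] := family_lipschitz e0.
have ee : 0 <= e <= e by rewrite e0 lexx.
have lipK K K' (s : R) : 0 <= s <= 1 -> `|gsol e l K s - gsol e l K' s| <= C * `|K - K'|.
  have <- : pdist e l K e l K' = `|K - K'|.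
    by rewrite /pdist !subrr normr0 mulr0 !addr0.
  by move=> s01; have [] := lip e l K e l K' s ee ee s01.
pose A := [set K | exists2 s : R, 0 <= s <= 1 & gsol e l K s <= 0].
have A0 : A 0 by exists 0; rewrite ?lexx ?ler01// gsol_at0 mul0r.
have Aub : ubound A (e * expR 4 + 1).
  move=> K [s s01 gs]; rewrite leNgt; apply/negP => KK.
  have s0 : 0 <= s by case/andP: s01.
  have h := gsol_mono l e0 (ltW KK) s0; have h2 := gsol_large e0 l0 s01.
  move: h h2 gs KK; move: (gsol _ _ _ _) (gsol _ _ _ _) => a b; lra.
have hsup : has_sup A by split; [exists 0|exists (e * expR 4 + 1)].
have nA K : sup A < K -> forall s : R, 0 <= s <= 1 -> 0 < gsol e l K s.
  move=> AK s s01; rewrite ltNge; apply/negP => gs.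
  have : K <= sup A by apply: ub_le_sup; [case: hsup|exists s].
  by rewrite leNgt AK.
exists (sup A).
have pos (s : R) : 0 <= s <= 1 -> 0 <= gsol e l (sup A) s.
  move=> s01; rewrite leNgt; apply/negP => gs.
  pose d := - gsol e l (sup A) s / C.
  have d0 : 0 < d by rewrite divr_gt0// oppr_gt0.
  have Ad : sup A < sup A + d by rewrite ltrDl.
  have h1 := nA _ Ad _ s01; have := lipK (sup A + d) (sup A) s s01.
  have -> : sup A + d - sup A = d by rewrite addrC addKr.
  have dE : C * d = - gsol e l (sup A) s by rewrite /d mulrC divfK ?gt_eqF.
  rewrite (gtr0_norm d0) dE ler_norml; move: gs h1; move: (gsol e l (sup A) s) (gsol e l (sup A + d) s) => a b; clear; lra.
split => //; apply: contrapT => nz.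
have gpos (s : R) : 0 <= s <= 1 -> 0 < gsol e l (sup A) s.
  move=> s01; rewrite lt_neqAle pos// andbT; apply/eqP => g0.
  by apply: nz; exists s.
have cg : {within `[0, 1], continuous (gsol e l (sup A))}.
  by apply: within_continuous_itv => x _; exact: gsol_continuous.
have [t] := EVT_min ler01 cg; rewrite in_itv/= => t01 tmin.
pose d := gsol e l (sup A) t / C.
have d0 : 0 < d by rewrite divr_gt0 ?gpos.
have [K [s s01 gs] dK] := sup_adherent d0 hsup.
have := lipK (sup A) K s s01.
have KA : K <= sup A by apply: ub_le_sup; [case: hsup|exists s].
have h3 : C * `|sup A - K| < gsol e l (sup A) t.
  rewrite ger0_norm ?subr_ge0//.
  have : C * (sup A - K) < C * d by rewrite ltr_pM2l//; lra.
  by rewrite /d [C * (_ / _)]mulrC divfK ?gt_eqF.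
have := tmin s; rewrite in_itv/= => /(_ s01).
move: h3 gs; move: (gsol e l (sup A) t) (gsol e l (sup A) s) (gsol e l K s) => a b c.
by rewrite ler_norml; lra.
Qed.

Definition Kadm e l : R :=
  if pselect (0 <= e /\ 0 <= l) is left H
  then sval (cid (admissible_exists H.1 H.2)) else 0.

Lemma KadmP e l : 0 <= e -> 0 <= l -> admissible e l (Kadm e l).
Proof.
by rewrite /Kadm => e0 l0; case: pselect => [H|[]//]; case: cid.
Qed.

(** For K' > K, take a zero s of g at the primed parameters. Lowering K' to K costs at least (K' -
    K) / 2 there by [gsol_mono], while returning to the unprimed e, l moves the value by at most C
    times their distance and must end at a nonnegative one. *)
Lemma Kadm_lipschitz M : 0 <= M -> exists2 C : R, 0 < C &
  forall e l e' l', 0 <= e <= M -> 0 <= e' <= M -> 0 <= l -> 0 <= l' ->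
  `|Kadm e l - Kadm e' l'| <= C * (`|e - e'| + `|l - l'|).
Proof.
move=> M0; have [C C0 lip] := family_lipschitz M0.
pose C' := 2 * C * (expR 4 + 1).
have C'0 : 0 < C' by rewrite !mulr_gt0// addr_gt0 ?expR_gt0.
exists C' => // e l e' l' eM e'M l0 l'0.
have key a b a' b' : 0 <= a <= M -> 0 <= a' <= M -> 0 <= b -> 0 <= b' ->
    Kadm a' b' - Kadm a b <= C' * (`|a - a'| + `|b - b'|).
  move=> aM a'M b0 b'0; set K := Kadm a b; set K' := Kadm a' b'.
  have a0 : 0 <= a by case/andP: aM.
  have a'0 : 0 <= a' by case/andP: a'M.
  have [pos _] := KadmP a0 b0; have [_ [s s01 gs]] := KadmP a'0 b'0.
  have [KK|/ltW KK] := leP K' K.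
    apply: (@le_trans _ _ 0); first by rewrite subr_le0.
    by rewrite mulr_ge0 ?addr_ge0// ltW.
  have s0 : 0 <= s by case/andP: s01.
  have pd : pdist a b K a' b' K <= (expR 4 + 1) * (`|a - a'| + `|b - b'|).
    rewrite /pdist subrr normr0 add0r mulrDl mul1r !mulrDr.
    have : 0 <= expR 4 * `|b - b'| by rewrite mulr_ge0// expR_ge0.
    have := normr_ge0 (a - a'); lra.
  have h1 := gsol_mono b' a'0 KK s0; rewrite -/K' in gs; rewrite gs in h1.
  have h2 := pos _ s01; rewrite -/K in h2.
  have [h3 _] := lip a b K a' b' K s aM a'M s01.
  have h4 : C * pdist a b K a' b' K <= C * ((expR 4 + 1) * (`|a - a'| + `|b - b'|)).
    by rewrite (ler_pM2l C0); exact: pd.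
  have [_ {}h3] := andP (etrans (esym (ler_norml _ _)) h3).
  have {}h3 := le_trans h3 h4.
  have E : C' * (`|a - a'| + `|b - b'|) =
     2 * (C * ((expR 4 + 1) * (`|a - a'| + `|b - b'|))).
    by rewrite /C' -!mulrA.
  rewrite E; move: h1 h2 h3; move: (C * ((expR 4 + 1) * _)).
  move: (gsol a b K s) (gsol a' b' K s); clear => u w x; lra.
rewrite ler_norml; apply/andP; split.
  by have := key e l e' l' eM e'M l0 l'0; rewrite lerNl opprB.
by have := key e' l' e l e'M eM l'0 l0; rewrite distrC [`|l' - l|]distrC.
Qed.

Definition kappa e l : R := ksol e l (Kadm e l) 1.

Lemma kappa_lipschitz M : 0 <= M -> exists2 C : R, 0 < C &
  forall e l e' l', 0 <= e <= M -> 0 <= e' <= M -> 0 <= l -> 0 <= l' ->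
  `|kappa e l - kappa e' l'| <= C * (`|e - e'| + `|l - l'|).
Proof.
move=> M0; have [C C0 lip] := family_lipschitz M0.
have [C1 C10 lipK] := Kadm_lipschitz M0.
pose C' := C * (C1 + (expR 4 + 1)).
have C'0 : 0 < C' by rewrite mulr_gt0// !addr_gt0 ?expR_gt0.
exists C' => // e l e' l' eM e'M l0 l'0.
have [_ h] : `|gsol e l (Kadm e l) 1 - gsol e' l' (Kadm e' l') 1| <=
    C * pdist e l (Kadm e l) e' l' (Kadm e' l') /\
   `|kappa e l - kappa e' l'| <= C * pdist e l (Kadm e l) e' l' (Kadm e' l').
  by apply: lip => //; rewrite ler01 lexx.
apply: (le_trans h); rewrite /C' -mulrA ler_pM2l// /pdist.
have := lipK _ _ _ _ eM e'M l0 l'0.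
have : 0 <= expR 4 * `|l - l'| by rewrite mulr_ge0// expR_ge0.
have := normr_ge0 (e - e').
move: (`|Kadm e l - Kadm e' l'|) => q; lra.
Qed.

Lemma kappa_ivt (p0 p1 q0 q1 : R) : 0 < p0 -> 0 < p1 -> 0 < q0 -> 0 < q1 ->
  kappa p0 q0 < 0 -> 0 < kappa p1 q1 ->
  exists2 t : R, 0 <= t <= 1 &
    kappa (p0 + t * (p1 - p0)) (q0 + t * (q1 - q0)) = 0.
Proof. exact: ivt_segment kappa_lipschitz. Qed.

End family.

(** * Symmetric profiles *)

(** Testing G''' = l - f against s (2 - s) = 1 - x^2 gives a weighted integral of l - f equal to
    k(1) >= 0, although f > l near the pole. *)
Lemma shf_dip {R : realType} (e l K : R) (G H k f g : R -> R) :
  shooting e l K G H k f g -> 0 < l < e -> G 1 = 0 -> 0 <= k 1 ->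
  exists2 s : R, 0 <= s <= 1 & f s < l.
Proof.
move=> S le' G1 k1; apply: contrapT => nS.
have fl (s : R) : 0 <= s <= 1 -> l <= f s.
  by move=> s01; rewrite leNgt; apply/negP => fs; apply: nS; exists s.
have i00 : 0 <= (0 : R) <= 1 by rewrite lexx ler01.
have [r r0 fr] : exists2 r, 0 < r & forall y, `|y - 0| < r -> l < f y.
  apply: continuous_gt_near (is_derive_continuous (shf S i00)) _.
  by rewrite (shf0 S); lra.
pose d := Num.min (r / 2) (1 / 2).
have [d0 d1 dr] : [/\ 0 < d, d < 1 & d < r].
  by rewrite /d; have [] := leP (r / 2) (1 / 2); split; lra.
pose Z (s : R) := s * (2 - s) * k s - (2 - 2 * s) * H s - 2 * G s.
have dZ (s : R) : 0 <= s <= 1 -> is_derive s 1 Z (s * (2 - s) * (l - f s)).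
  move=> s01; have dk := shk S s01; have dH := shH S s01; have dG := shG S s01.
  by rewrite /Z; isd; ring.
have Z1 : Z 1 <= Z d.
  apply: (ge_of_derive01 _ _ _ dZ); [lra|lra|lra|] => x xs.
  have x01 : 0 <= x <= 1 by lra.
  have fx := fl x x01; rewrite mulr_ge0_le0//; last lra.
  by rewrite mulr_ge0; lra.
have Zd : Z d < Z 0.
  apply: (gt_of_derive01 _ _ _ dZ); [lra|lra|lra|] => x xs.
  have fx : l < f x by apply: fr; rewrite subr0 ger0_norm; lra.
  by rewrite pmulr_rlt0 ?mulr_gt0; lra.
move: Z1 Zd; rewrite /Z G1 (shH0 S) (shG0 S); lra.
Qed.

Section symmetric_profiles.
Context {R : realType}.

Opaque sol ksol hsol gsol Kadm.

Lemma shooting_sol (e l K : R) : 0 < e ->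
  (forall s : R, 0 <= s <= 1 -> 0 <= gsol e l K s) ->
  shooting e l K (fun t => t ^+ 2 * gsol e l K t) (fun t => t * hsol e l K t)
    (ksol e l K) (fun t => e * texp (sol e l K t)) (gsol e l K).
Proof.
move=> e0 g0; have e0' := ltW e0.
have v0 (s : R) : 0 <= s <= 1 -> sol e l K s <= 0.
  move=> s01; rewrite -(sol_at0 l K e0').
  apply: (ge_of_derive (andP s01).1 (fun x _ => sol_derive l K x e0')) => x xs.
  by rewrite oppr_le0 mulr_ge0 ?(ltW (rho_gt0 _)) ?g0//; lra.
split.
- by move=> s _; exact: gsol_derive.
- by move=> s _; exact: hsol_derive.
- by move=> s _; exact: ksol_derive.
- move=> s s01.
  have cv := @sol_continuous _ e l K e0' s.
  have [|r r0 vr] := continuous_lt_near (z := 1) cv.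
    by have := v0 s s01; move: (sol _ _ _ _) => q; lra.
  have E (y : R) : `|y - s| < r -> e * expR (4 * sol e l K y) = e * texp (sol e l K y).
    by move=> yr; rewrite texpE// ltW// vr.
  apply: (is_derive_near_eq r0 E).
  have dv := sol_derive l K s e0'; isd.
  rewrite texpE ?(le_trans (v0 s s01))// rhoE; last by case/andP: s01.
  by move: (gsol _ _ _ _) (expR _) => q p; field; lra.
- by [].
- by move=> s _; exact: gsol_continuous.
- by rewrite mul0r.
- exact: ksol_at0.
- exact: gsol_at0.
- by rewrite sol_at0// texpE// mulr0 expR0 mulr1.
- by move=> s _; rewrite mulr_gt0 ?texp_gt0.
- exact: g0.
Qed.

(** The two conditions at s = 1 are those for even reflection. The last clause yields non-constancy
    and a lower bound on K in the blow-up argument. *)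
Definition symmetric_profile (e l K : R) :=
  [/\ forall s : R, 0 <= s <= 1 -> 0 <= gsol e l K s, gsol e l K 1 = 0,
      ksol e l K 1 = 0 &
      exists2 s : R, 0 <= s <= 1 & e * texp (sol e l K s) < l].

Lemma kappa_le0_gsol1 (e l : R) : 0 < l < e -> kappa e l <= 0 ->
  gsol e l (Kadm e l) 1 = 0.
Proof.
move=> le' k0; have e0 : 0 < e by lra. have l0 : 0 < l by lra.
have [g0 [s s01 gs]] := KadmP (ltW e0) (ltW l0).
have S := shooting_sol e0 g0.
by have s1 := shs1E S le' s01 gs k0; rewrite -s1.
Qed.

Lemma kappa0_profile (e l : R) : 0 < l < e -> kappa e l = 0 ->
  symmetric_profile e l (Kadm e l).
Proof.
move=> le' k0; have e0 : 0 < e by lra. have l0 : 0 < l by lra.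
have [g0 _] := KadmP (ltW e0) (ltW l0).
have g1 : gsol e l (Kadm e l) 1 = 0 by apply: kappa_le0_gsol1 => //; rewrite k0.
split => //.
apply: (shf_dip (shooting_sol e0 g0) le'); first by rewrite g1 mulr0.
by rewrite -/(kappa e l) k0.
Qed.

Lemma kappa_lt0 (e l : R) : 0 < l < e -> e < 30 -> kappa e l < 0.
Proof.
move=> le' e30; have e0 : 0 < e by lra. have l0 : 0 < l by lra.
have [g0 [s s01 gs]] := KadmP (ltW e0) (ltW l0).
exact: (shk1_lt0 (shooting_sol e0 g0) le' s01 gs e30).
Qed.

Lemma kappa_asymptotics (eta : R) : 0 < eta -> exists E : R, forall e l : R,
  0 < l < e -> l <= 30 -> kappa e l <= 0 -> E <= e ->
  `|kappa e l - (2 * l / 3 - 8)| <= eta.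
Proof.
move=> eta0; have [E HE] := shooting_asymptotics eta0.
exists E => e l le' l30 k0 Ee; have e0 : 0 < e by lra. have l0 : 0 < l by lra.
have [g0 _] := KadmP (ltW e0) (ltW l0).
apply: (HE e l (Kadm e l) _ _ _ _ _ (shooting_sol e0 g0)) => //.
by rewrite (kappa_le0_gsol1 le' k0) mulr0.
Qed.

Opaque kappa.

Lemma profile_exists (l : R) : 12 < l < 30 ->
  exists e K : R, l < e /\ symmetric_profile e l K.
Proof.
move=> l30; have [|E HE] := @kappa_asymptotics ((l - 12) / 6); first lra.
pose p0 := (l + 30) / 2; pose p1 := Num.max E (p0 + 1).
have [lp0 p030] : l < p0 /\ p0 < 30 by rewrite /p0; lra.
have [Ep1 p0p1] : E <= p1 /\ p0 + 1 <= p1 by rewrite /p1 !le_max !lexx orbT.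
clearbody p0 p1.
have [l0 l30'] : 0 < l /\ l <= 30 by lra.
have [p00 p10] : 0 < p0 /\ 0 < p1 by lra.
have lp1 : 0 < l < p1 by lra.
have k0 : kappa p0 l < 0 by apply: kappa_lt0; lra.
have k1 : 0 < kappa p1 l.
  (* If kappa <= 0, it lies within (l - 12) / 6 of 2 (l - 12) / 3, hence is positive. *)
  rewrite ltNge; apply/negP => k1.
  have := HE p1 l lp1 l30' k1 Ep1.
  by move: (kappa p1 l) k1 => q; rewrite ler_norml; clear -l30; lra.
have [t t01] := kappa_ivt p00 p10 l0 l0 k0 k1.
rewrite subrr mulr0 addr0; clear k0 k1 => kt.
have le' : 0 < l < p0 + t * (p1 - p0).
  have : 0 <= t * (p1 - p0) by rewrite mulr_ge0; lra.
  lra.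
exists (p0 + t * (p1 - p0)), (Kadm (p0 + t * (p1 - p0)) l); split; first by case/andP: le'.
exact: kappa0_profile.
Qed.

Lemma blowup_profile_exists (eta B : R) : 0 < eta -> exists e l K a : R,
  [/\ 0 < l, `|l - 12| <= eta, B <= a, e = l * expR (4 * a) & symmetric_profile e l K].
Proof.
move=> eta0; pose th := Num.min eta 3 / 5.
have [th0 theta th3] : [/\ 0 < th, 5 * th <= eta & 5 * th <= 3].
  by rewrite /th; have [] := leP eta 3; split; lra.
have [E HE] := kappa_asymptotics th0.
pose a := Num.max (Num.max B 1) ((E + 30) / 2).
have [Ba a1 Ea] : [/\ B <= a, 1 <= a & (E + 30) / 2 <= a].
  by rewrite /a !le_max !lexx !orbT.
pose A := expR (4 * a).
have aA : 1 + 4 * a <= A by exact: expR_ge1Dx.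
pose q1 := 12 + 5 * th.
have A0 : 0 < A by lra.
(* The path (l A, l) starts where e = 29 < 30 and ends at l = q1 slightly above 12, where the
   asymptotics force kappa > 0. *)
have k0 : kappa 29 (29 / A) < 0.
  apply: kappa_lt0; last lra.
  by rewrite divr_gt0//= ltr_pdivrMr//; lra.
have q1A : q1 * 5 <= q1 * A by rewrite ler_pM2l /q1; lra.
have EA : E <= q1 * A.
  have : 12 * A <= q1 * A by rewrite ler_pM2r// /q1; lra.
  lra.
have q10 : 0 < q1 by rewrite /q1; clear -th0; lra.
have q1lt : 0 < q1 < q1 * A by clear -q10 q1A; lra.
have q130 : q1 <= 30 by rewrite /q1; clear -th3; lra.
have k1 : 0 < kappa (q1 * A) q1.
  rewrite ltNge; apply/negP => k1.
  have := HE (q1 * A) q1 q1lt q130 k1 EA.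
  by move: (kappa (q1 * A) q1) k1 => q; rewrite ler_norml /q1; clear -th0; lra.
have [//||||t t01] := kappa_ivt _ _ _ _ k0 k1.
- by rewrite mulr_gt0.
- by rewrite divr_gt0.
- by [].
clear k0 k1.
set l := 29 / A + t * (q1 - 29 / A).
have -> : 29 + t * (q1 * A - 29) = l * A by rewrite /l; field; lra.
have p29 : 0 < 29 / A by rewrite divr_gt0.
have p29' : 29 / A <= 29 / 5 by rewrite ler_pM2l// lef_pV2 ?posrE//; clear -aA a1; lra.
have [l0 lq] : 0 < l /\ l <= q1.
  have : 0 <= t * (q1 - 29 / A) <= 1 * (q1 - 29 / A).
    by rewrite mulr_ge0 ?ler_wpM2r//; rewrite /q1; clear -t01 p29' th0; lra.
  by rewrite /l; clear -p29 => h; split; lra.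
have lA : l * 5 <= l * A by rewrite ler_pM2l//; clear -aA a1; lra.
have le' : 0 < l < l * A by clear -lA l0; lra.
have lA0 : 0 < l * A by rewrite mulr_gt0.
have l30 : l <= 30 by exact: le_trans lq q130.
move=> kt; have prof := kappa0_profile le' kt.
exists (l * A), l, (Kadm (l * A) l), a; split => //.
have [g0 g1 ks1 [s s01 fs]] := prof.
have S := shooting_sol lA0 g0.
have G1 : 1 ^+ 2 * gsol (l * A) l (Kadm (l * A) l) 1 = 0 by rewrite g1 mulr0.
have ks1' : ksol (l * A) l (Kadm (l * A) l) 1 <= 0 by rewrite ks1.
have fge := shf_ge S le' l30 s01.
have Ke := shK_le_e S le' G1.
have K0 := shK_ge0 S.
(* Largeness of e at the zero of kappa, with no lower bound on l: f drops below l = e exp (- 4 a),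
   so [shf_ge] gives 2 K + 20 > 4 a, and K <= e. The asymptotics with kappa = 0 then place l near
   12. *)
have EK : E <= l * A.
  have h := le_lt_trans fge fs.
  have : A * expR (- ((2 * Kadm (l * A) l + 20) * s)) < 1.
    by rewrite -(ltr_pM2l l0) mulr1 mulrA.
  rewrite -expRD -[X in _ < X]expR0 ltr_expR.
  move: (Kadm (l * A) l) Ke K0; clear -s01 Ea => K Ke K0.
  have : (2 * K + 20) * s <= (2 * K + 20) * 1 by rewrite ler_wpM2l; lra.
  lra.
have := HE (l * A) l le' l30 ltac:(by rewrite kt) EK.
by rewrite kt !ler_norml; clear -theta; lra.
Qed.

End symmetric_profiles.

(** * Even reflection *)

Section reflection.
Context {R : realType}.
Implicit Types (phi : R -> R).

Definition oddext phi (x : R) : R := if 0 <= x then phi x else - phi (- x).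

Lemma oddext_continuous b phi :
  (forall t : R, 0 <= t < b -> {for t, continuous phi}) -> phi 0 = 0 ->
  continuous_oo (- b) b (oddext phi).
Proof.
move=> cphi phi0 x x1; have [x0|x0|xE] := ltgtP 0 x.
- apply: (continuous_near_eq (r := x) _ _ (cphi x _)) => //; last lra.
  by move=> y; rewrite ltr_norml /oddext => yx; rewrite ifT//; lra.
- have cN : {for x, continuous (fun y => - phi (- y))}.
    apply: continuousN; apply: continuous_comp; first exact: opp_continuous.
    by apply: cphi; lra.
  apply: (continuous_near_eq (r := - x) _ _ cN); first lra.
  move=> y; rewrite ltr_norml /oddext => yx.
  by rewrite ifF//; apply/negbTE; rewrite -ltNge; lra.
- rewrite -{x}xE in x1 *.
  have c0 : {for 0, continuous phi} by apply: cphi; lra.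
  have c1 : {for 0, continuous (fun y : R => phi `|y|)}.
    by apply: continuous_comp; [exact: norm_continuous|rewrite normr0].
  apply/cvgrPdist_lt => /= ep ep0.
  have [|r1 r10 fr1] := continuous_lt_near (z := ep) c1; first by rewrite normr0 phi0.
  have [|r2 r20 fr2] := continuous_gt_near (z := - ep) c1.
    by rewrite normr0 phi0 oppr_lt0.
  have fr (y : R) : `|y| < Num.min r1 r2 -> `|phi `|y| | < ep.
    rewrite lt_min => /andP[y1 y2]; rewrite ltr_norml.
    by rewrite fr1 ?fr2// subr0.
  exists (Num.min r1 r2) => /=; first by rewrite lt_min r10.
  move=> y /=; rewrite sub0r normrN => yr.
  have -> : oddext phi 0 = 0 by rewrite /oddext lexx.
  rewrite sub0r normrN; have := fr y yr.
  rewrite /oddext; have [y0|y0] := leP 0 y; first by rewrite (ger0_norm y0).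
  by rewrite (ltr0_norm y0) normrN.
Qed.

Lemma evenext_continuous b phi :
  (forall t : R, 0 <= t < b -> {for t, continuous phi}) ->
  continuous_oo (- b) b (fun x => phi `|x|).
Proof.
move=> cphi x x1; apply: continuous_comp; first exact: norm_continuous.
by apply: cphi; rewrite normr_ge0 ltr_norml; lra.
Qed.

(** The condition phi'(0) = 0 makes the odd extension of phi' continuous, so the kink at 0 is
    removable. *)
Lemma evenext_derive phi phi' :
  (forall t : R, 0 <= t < 1 -> is_derive t 1 phi (phi' t)) ->
  (forall t : R, 0 <= t < 1 -> {for t, continuous phi'}) -> phi' 0 = 0 ->
  forall x : R, - 1 < x < 1 -> is_derive x 1 (fun y => phi `|y|) (oddext phi' x).
Proof.
move=> dphi cphi' phi'0; apply: is_derive_removable; first lra.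
- by apply: evenext_continuous => t t01; exact: is_derive_continuous (dphi t t01).
- exact: oddext_continuous.
move=> x x1 xn0; have [x0|x0|xE] := ltgtP 0 x.
- have -> : oddext phi' x = phi' x by rewrite /oddext ifT//; lra.
  apply: (@is_derive_near_eq _ phi _ _ x) => //; last by apply: dphi; lra.
  by move=> y; rewrite ltr_norml => yx; rewrite ger0_norm//; lra.
- have -> : oddext phi' x = phi' (- x) * - 1.
    by rewrite mulrN1 /oddext ifF//; apply/negbTE; rewrite -ltNge; lra.
  apply: (@is_derive_near_eq _ (fun y => phi (- y)) _ _ (- x)); first lra.
    by move=> y; rewrite ltr_norml => yx; rewrite ler0_norm//; lra.
  have dN : is_derive (- x) 1 phi (phi' (- x)) by apply: dphi; lra.
  exact: (is_derive_comp_fun (g := fun t => - t) dN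
    (is_deriveN_fun (is_derive_id_fun x))).
- by rewrite xE eqxx in xn0.
Qed.

Lemma oddext_derive phi phi' :
  (forall t : R, 0 <= t < 1 -> is_derive t 1 phi (phi' t)) ->
  (forall t : R, 0 <= t < 1 -> {for t, continuous phi'}) -> phi 0 = 0 ->
  forall x : R, - 1 < x < 1 -> is_derive x 1 (oddext phi) (phi' `|x|).
Proof.
move=> dphi cphi' phi0; apply: is_derive_removable; first lra.
- by apply: oddext_continuous => // t t01; exact: is_derive_continuous (dphi t t01).
- exact: evenext_continuous.
move=> x x1 xn0; have [x0|x0|xE] := ltgtP 0 x.
- rewrite gtr0_norm//.
  apply: (@is_derive_near_eq _ phi _ _ x) => //; last by apply: dphi; lra.
  by move=> y; rewrite ltr_norml => yx; rewrite /oddext ifT//; lra.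
- rewrite ltr0_norm//.
  apply: (@is_derive_near_eq _ (fun y => - phi (- y)) _ _ (- x)); first lra.
    move=> y; rewrite ltr_norml => yx.
    by rewrite /oddext ifF//; apply/negbTE; rewrite -ltNge; lra.
  have dN : is_derive (- x) 1 phi (phi' (- x)) by apply: dphi; lra.
  have d1 := is_derive_comp_fun (g := fun t => - t) dN
    (is_deriveN_fun (is_derive_id_fun x)).
  by isd; ring.
- by rewrite xE eqxx in xn0.
Qed.

Lemma is_derive_1B phi (t a : R) : is_derive (1 - t) 1 phi a ->
  is_derive t 1 (fun y => phi (1 - y)) (- a).
Proof.
move=> d; have d1 : is_derive t 1 (fun y : R => 1 - y) (- 1) by isd; ring.
by have := is_derive_comp_fun (g := fun y => 1 - y) d d1; rewrite mulrN1.
Qed.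

Lemma continuous_1B (f : R -> R) (t : R) : continuous f ->
  {for t, continuous (fun y : R => f (1 - y))}.
Proof.
move=> cf; apply: (@continuous_comp _ _ _ (fun t : R => 1 - t) f); last exact: cf.
by apply: continuousB; [exact: cst_continuous|exact: cvg_id].
Qed.

End reflection.

(** * The reflected profile and its regularity *)

Section profile_function.
Context {R : realType} (e l K a : R).
Hypothesis l0e : 0 < l < e.
Hypothesis ea : e = l * expR (4 * a).
Hypothesis prof : symmetric_profile e l K.

Opaque sol ksol hsol gsol.

Definition uprof (x : R) : R := a + sol e l K (1 - `|x|).

Let e0 : 0 < e. Proof. by have := l0e; lra. Qed.
Let e0' : 0 <= e. Proof. exact: ltW. Qed.
Let S : shooting e l K (fun t => t ^+ 2 * gsol e l K t)
  (fun t => t * hsol e l K t) (ksol e l K)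
  (fun t => e * texp (sol e l K t)) (gsol e l K).
Proof. by apply: shooting_sol => //; case: prof. Qed.

Lemma sol_le0 (s : R) : 0 <= s <= 1 -> sol e l K s <= 0.
Proof.
move=> s01; rewrite -(sol_at0 l K e0').
apply: (ge_of_derive (andP s01).1 (fun x _ => sol_derive l K x e0')) => x xs.
rewrite oppr_le0 mulr_ge0 ?(ltW (rho_gt0 _))//.
by case: prof => g0 _ _ _; apply: g0; lra.
Qed.

(** The truncation in [texp] is inactive below 1. As the solution is <= 0 on the hemisphere, this
    leaves room on a neighbourhood of the pole, including some s < 0. *)
Lemma sol_lt1 : exists2 d : R, 0 < d <= 1 & forall s : R, - d < s < 1 -> sol e l K s < 1.
Proof.
have cv := @sol_continuous _ e l K e0' 0.
have [|r r0 vr] := continuous_lt_near (z := 1) cv; first by rewrite sol_at0.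
exists (Num.min r 1); first by rewrite lt_min r0 ltr01 ge_min lexx orbT.
move=> s; have [s0 s1|s0 s1] := leP 0 s.
  by apply: le_lt_trans ltr01; apply: sol_le0; lra.
apply: vr; rewrite subr0 ltr0_norm//.
have : Num.min r 1 <= r by rewrite ge_min lexx.
lra.
Qed.

(** Bootstrap on the pair (v, k): averages keep the class C^n, so v' = - rho g and k' = l - e exp (4
    v) are C^n. This crosses the pole, where the equation is singular. *)
Lemma sol_Ck : exists2 d : R, 0 < d <= 1 & forall n, Ck n (- d) 1 (sol e l K).
Proof.
have [d d0 v1] := sol_lt1; exists d => //.
have dd : (- d < (0 : R) < 1)%R by lra.
suff both n : Ck n (- d) 1 (sol e l K) /\ Ck n (- d) 1 (ksol e l K).
  by move=> n; have [] := both n.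
elim: n => [|n [Cv Ckk]].
  split; first by move=> x _; exact: sol_continuous.
  by move=> x _; exact: ksol_continuous.
have Cg : Ck n (- d) 1 (gsol e l K).
  Transparent gsol hsol.
  by rewrite /gsol /gof; apply: Ck_avg => //; rewrite /hof; apply: Ck_avg.
split.
  exists (fun s => - (rho s * gsol e l K s)); first by move=> x _; exact: sol_derive.
  apply/CkN/CkM => //.
  apply: (@Ck_ext _ _ _ _ (fun s => ((2 - s) ^+ 2)^-1)).
    by move=> s s1; rewrite rhoE//; lra.
  apply: CkV; first by move=> s s1; rewrite expf_neq0// gt_eqF//; lra.
  apply: CkX; apply: CkD; first exact: Ck_cst.
  exact/CkN/Ck_id.
exists (fun s => l - e * texp (sol e l K s)); first by move=> x _; exact: ksol_derive.
apply: CkD; first exact: Ck_cst.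
apply/CkN/CkM; first exact: Ck_cst.
apply: (@Ck_ext _ _ _ _ (fun s => expR (4 * sol e l K s))).
  by move=> s s1; rewrite texpE// ltW// v1.
by apply/Ck_expR/CkM => //; exact: Ck_cst.
Qed.

(** For an even u, G and its second derivative are odd in x and the first derivative is even; the
    minus sign in [Hh] comes from x = 1 - s. *)
Let Gh := oddext (fun t => (1 - t) ^+ 2 * gsol e l K (1 - t)).
Let Hh (x : R) := - ((1 - `|x|) * hsol e l K (1 - `|x|)).
Let Kh := oddext (fun t => ksol e l K (1 - t)).

Lemma uprof_exp (x : R) : `|x| <= 1 ->
  l * expR (4 * uprof x) = e * texp (sol e l K (1 - `|x|)).
Proof.
move=> x1; rewrite texpE; last first.
  by apply: (le_trans (sol_le0 _)) => //; have := normr_ge0 x; lra.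
by rewrite /uprof mulrDr expRD mulrA -ea.
Qed.

Lemma uprof_derive (x : R) : - 1 < x < 1 ->
  is_derive x 1 uprof (Gh x / (1 - x ^+ 2) ^+ 2).
Proof.
move=> x1; have [_ g1 _ _] := prof.
have -> : Gh x / (1 - x ^+ 2) ^+ 2 =
    oddext (fun t => rho (1 - t) * gsol e l K (1 - t)) x.
  rewrite /Gh /oddext; case: leP => x0.
    rewrite rhoE; last lra.
    by move: (gsol _ _ _ _) => q; field; apply/andP; split; nra.
  rewrite rhoE; last lra.
  by move: (gsol _ _ _ _) => q; field; apply/andP; split; nra.
apply: (evenext_derive (phi := fun t => a + sol e l K (1 - t)) _ _ _ x1).
- move=> t t1; have d1 := is_derive_1B (sol_derive l K (1 - t) e0').
  by isd; rewrite opprK add0r.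
- move=> t t1; apply: continuousM; first exact: continuous_1B rho_continuous.
  exact: continuous_1B (@gsol_continuous _ e l K e0').
- by rewrite subr0 g1 mulr0.
Qed.

Lemma Gh_derive (x : R) : - 1 < x < 1 -> is_derive x 1 Gh (Hh x).
Proof.
move=> x1; have [_ g1 _ _] := prof.
apply: (oddext_derive (phi' := fun t => - ((1 - t) * hsol e l K (1 - t))) _ _ _ x1).
- by move=> t t1; apply: (is_derive_1B (gsol_derive l K (1 - t) e0')).
- move=> t t1; apply: continuousN; apply: (continuous_1B (f := fun s => s * hsol e l K s)) => s.
  by apply: continuousM; [exact: cvg_id|exact: hsol_continuous].
- by rewrite subr0 g1 mulr0.
Qed.

Lemma Hh_derive (x : R) : - 1 < x < 1 -> is_derive x 1 Hh (Kh x).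
Proof.
move=> x1; have [_ _ k1 _] := prof.
apply: (evenext_derive (phi := fun t => - ((1 - t) * hsol e l K (1 - t)))
   (phi' := fun t => ksol e l K (1 - t)) _ _ _ x1).
- move=> t t1; have d := is_derive_1B (hsol_derive l K (1 - t) e0').
  by rewrite -[ksol _ _ _ _]opprK; exact: (is_deriveN_fun d).
- by move=> t t1; apply: continuous_1B; exact: ksol_continuous.
- by rewrite subr0.
Qed.

Lemma Kh_derive (x : R) : - 1 < x < 1 ->
  is_derive x 1 Kh (l * expR (4 * uprof x) - l).
Proof.
move=> x1; have [_ _ k1 _] := prof.
rewrite uprof_exp; last by rewrite ler_norml; lra.
have -> : e * texp (sol e l K (1 - `|x|)) - l =
  - (l - e * texp (sol e l K (1 - `|x|))) by rewrite opprB.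
apply: (oddext_derive (phi' := fun t => - (l - e * texp (sol e l K (1 - t)))) _ _ _ x1).
- by move=> t t1; apply: (is_derive_1B (ksol_derive l K (1 - t) e0')).
- move=> t t1; apply: continuousN; apply: (continuous_1B (f := src e l (sol e l K))).
  exact/src_continuous/sol_continuous.
- by rewrite subr0.
Qed.

(** Each of the four functions has a derivative expressed smoothly by the others, so regularity
    across the equator follows by induction on all four together. *)
Lemma uprof_interior n : [/\ Ck n (- 1) 1 uprof, Ck n (- 1) 1 Gh,
  Ck n (- 1) 1 Hh & Ck n (- 1) 1 Kh].
Proof.
elim: n => [|n [Cu CG CH CK]].
  split=> x x1.
  - exact: is_derive_continuous (uprof_derive x1).
  - exact: is_derive_continuous (Gh_derive x1).
  - exact: is_derive_continuous (Hh_derive x1).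
  - exact: is_derive_continuous (Kh_derive x1).
split.
- exists (fun x => Gh x / (1 - x ^+ 2) ^+ 2) => //; first exact: uprof_derive.
  apply: CkM => //; apply: CkV.
    by move=> x x1; rewrite expf_neq0// gt_eqF//; nra.
  apply/CkX/CkD; first exact: Ck_cst.
  exact/CkN/CkX/Ck_id.
- by exists Hh; [exact: Gh_derive|exact: CH].
- by exists Kh; [exact: Hh_derive|exact: CK].
- exists (fun x => l * expR (4 * uprof x) - l); first exact: Kh_derive.
  apply: CkD; last exact: Ck_cst.
  by apply: CkM; [exact: Ck_cst|apply/Ck_expR/CkM => //; exact: Ck_cst].
Qed.

(** Continuity on (-2, 2) puts the poles in the interior, so boundary values at 1 and -1 can be
    taken there. *)
Lemma uprof_system : exists G0 H0 K0 : R -> R,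
  (forall x : R, - 1 < x < 1 -> [/\ is_derive x 1 uprof (G0 x / (1 - x ^+ 2) ^+ 2),
     is_derive x 1 G0 (H0 x), is_derive x 1 H0 (K0 x) &
     is_derive x 1 K0 (l * expR (4 * uprof x) - l)]) /\
  [/\ continuous_oo (- 2) 2 G0, continuous_oo (- 2) 2 H0, continuous_oo (- 2) 2 K0,
     G0 1 = 0 /\ G0 (- 1) = 0 & H0 1 = 0 /\ H0 (- 1) = 0].
Proof.
have [_ g1 k1 _] := prof.
exists Gh, Hh, Kh; split; first by move=> x x1; split;
  [exact: uprof_derive|exact: Gh_derive|exact: Hh_derive|exact: Kh_derive].
split.
- apply: oddext_continuous; last by rewrite subr0 g1 mulr0.
  move=> t _; apply: (continuous_1B (f := fun s => s ^+ 2 * gsol e l K s)).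
  apply: continuousT_M; [exact: exprn_continuous|exact: gsol_continuous].
- apply: (@evenext_continuous _ _ (fun t => - ((1 - t) * hsol e l K (1 - t)))).
  move=> t _; apply: continuousN; apply: (continuous_1B (f := fun s => s * hsol e l K s)).
  by apply: continuousT_M; [move=> s; exact: cvg_id|exact: hsol_continuous].
- apply: oddext_continuous; last by rewrite subr0.
  by move=> t _; apply: continuous_1B; exact: ksol_continuous.
- rewrite /Gh /oddext ler01 oppr_ge0 ler10 opprK subrr expr0n !mul0r oppr0.
  by [].
- by rewrite /Hh normrN normr1 subrr mul0r oppr0.
Qed.

Lemma uprof_smooth : exists2 d : R, 0 < d & forall n (x : R),
  - (1 + d) < x < 1 + d -> derivable (derive1n n uprof) x 1.
Proof.
have [d d0 Cv] := sol_Ck; exists d; first by case/andP: d0.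
move=> n x xd.
have [x1|x1] := ltP `|x| 1.
  apply: (@smooth_derivable _ (- 1) 1) => [m|]; first by have [] := uprof_interior m.
  by move: x1; rewrite ltr_norml.
have [x0|x0] := leP 0 x.
  rewrite ger0_norm// in x1.
  apply: (@smooth_derivable _ 0 (1 + d)) => [m|]; last lra.
  apply: (@Ck_ext _ _ _ _ (fun y => a + sol e l K (1 + (- 1) * y))).
    by move=> y y0; rewrite /uprof gtr0_norm ?mulN1r//; lra.
  apply: CkD; first exact: Ck_cst.
  by apply: (Ck_affine (Cv m)) => y yd; lra.
rewrite ltr0_norm// in x1.
apply: (@smooth_derivable _ (- (1 + d)) 0) => [m|]; last lra.
apply: (@Ck_ext _ _ _ _ (fun y => a + sol e l K (1 + 1 * y))).
  by move=> y y0; rewrite /uprof ltr0_norm ?opprK ?mul1r//; lra.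
apply: CkD; first exact: Ck_cst.
by apply: (Ck_affine (Cv m)) => y yd; lra.
Qed.

End profile_function.

(** * The Laplacian of an axial function *)

Section axial_operator.
Context {R : realType}.
Implicit Types (f g phi : R -> R) (c d x : R).

(** The Laplace-Beltrami operator of the 4-sphere on functions of the first coordinate x. *)
Definition axlap phi (x : R) : R :=
  (1 - x ^+ 2) * derive1n 2 phi x - 4 * x * derive1n 1 phi x.

Lemma derive1n_shift n phi : derive1n n (derive1 phi) = derive1n n.+1 phi.
Proof. by elim: n => [//|n IH]; rewrite derive1nS IH -derive1nS. Qed.

Lemma derivable_Ck c d phi :
  (forall n (x : R), c < x < d -> derivable (derive1n n phi) x 1) ->
  forall n, Ck n c d phi.
Proof.
move=> dphi n; elim: n phi dphi => [|n IH] phi dphi.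
  move=> x cx; have := dphi 0%N x cx; rewrite derive1n0 => dx.
  exact/differentiable_continuous/derivable1_diffP.
exists (derive1 phi).
  by move=> x cx; apply: DeriveDef; [exact: (dphi 0%N)|rewrite derive1E].
by apply: IH => m x cx; rewrite derive1n_shift; exact: dphi.
Qed.

Lemma Ck_derive1n_smooth c d phi : (forall n, Ck n c d phi) ->
  forall m n, Ck n c d (derive1n m phi).
Proof. by move=> Cphi m n; exact: Ck_derive1n (Cphi _). Qed.

Lemma axlap_smooth c d phi : (forall n, Ck n c d phi) ->
  forall n, Ck n c d (axlap phi).
Proof.
move=> Cphi n; have CD m := Ck_derive1n_smooth Cphi m n.
apply: CkD.
  apply: CkM; last exact: CD.
  by apply: CkD; [exact: Ck_cst|apply/CkN/CkX/Ck_id].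
apply/CkN/CkM; last exact: CD.
by apply: CkM; [exact: Ck_cst|exact: Ck_id].
Qed.

Lemma smooth_is_derive c d phi : (forall n, Ck n c d phi) ->
  forall n (x : R), c < x < d -> is_derive x 1 (derive1n n phi) (derive1n n.+1 phi x).
Proof.
move=> Cphi n x cx; apply: DeriveDef; first exact: smooth_derivable Cphi n x cx.
by rewrite derive1nS derive1E.
Qed.

Lemma is_derive_unique f x (a b : R) : is_derive x 1 f a -> is_derive x 1 f b -> a = b.
Proof. by move=> [_ <-] [_ <-]. Qed.

Lemma eq_by_continuity f g (p : R) : {for p, continuous f} -> {for p, continuous g} ->
  (forall r : R, 0 < r -> exists2 y, `|y - p| < r & f y = g y) -> f p = g p.
Proof.
move=> cf cg fg; pose D t := f t - g t.
have cD : {for p, continuous D} by exact: continuousB.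
apply/eqP; rewrite -subr_eq0 -/(D p); apply/eqP; case: (ltgtP (D p) 0) => // Dp.
  have [r r0 fr] := continuous_lt_near cD Dp; have [y yp fgy] := fg r r0.
  by have := fr y yp; rewrite /D fgy subrr ltxx.
have [r r0 fr] := continuous_gt_near cD Dp; have [y yp fgy] := fg r r0.
by have := fr y yp; rewrite /D fgy subrr ltxx.
Qed.

(** * From the first-order system to the equation and the mass *)

Section system.
Context (l : R) (U G H K : R -> R) (dl : R).
Hypothesis l0 : 0 < l.
Hypothesis dl0 : 0 < dl.
Hypothesis smoothU : forall n (x : R), - (1 + dl) < x < 1 + dl ->
  derivable (derive1n n U) x 1.
Hypothesis sys : forall x : R, - 1 < x < 1 ->
  [/\ is_derive x 1 U (G x / (1 - x ^+ 2) ^+ 2), is_derive x 1 G (H x),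
      is_derive x 1 H (K x) & is_derive x 1 K (l * expR (4 * U x) - l)].
Hypothesis bnd : [/\ continuous_oo (- 2) 2 G, continuous_oo (- 2) 2 H,
  continuous_oo (- 2) 2 K, G 1 = 0 /\ G (- 1) = 0 & H 1 = 0 /\ H (- 1) = 0].

Let CU n : Ck n (- (1 + dl)) (1 + dl) U.
Proof. exact: derivable_Ck. Qed.

Lemma is_derive_derive1 f x (a : R) : is_derive x 1 f a -> derive1 f x = a.
Proof. by move=> [_ <-]; rewrite derive1E. Qed.

Lemma derive1_ext c d f g h : (forall x : R, c < x < d -> g x = f x) ->
  (forall x : R, c < x < d -> is_derive x 1 g (h x)) ->
  forall x : R, c < x < d -> derive1 f x = h x.
Proof.
move=> gf dg x cx; apply: is_derive_derive1.
exact: is_derive_eq_oo cx gf (dg x cx).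
Qed.

Let nz (x : R) : - 1 < x < 1 -> (1 - x ^+ 2) != 0.
Proof. by move=> x1; rewrite gt_eqF//; nra. Qed.

Let GE (x : R) : - 1 < x < 1 -> (1 - x ^+ 2) ^+ 2 * derive1 U x = G x.
Proof.
move=> x1; have [dU _ _ _] := sys x1.
by rewrite (is_derive_derive1 dU) mulrC divfK// expf_neq0// nz.
Qed.

Lemma system_ode (x : R) : - 1 < x < 1 ->
  derive1n 3 (fun t : R => (1 - t ^+ 2) ^+ 2 * derive1 U t) x = l * expR (4 * U x) - l.
Proof.
set T := fun t : R => _ => x1.
have TG (y : R) : - 1 < y < 1 -> G y = T y by move=> y1; rewrite /T GE.
have T1 (y : R) : - 1 < y < 1 -> H y = derive1 T y.
  move=> y1; apply/esym; apply: (derive1_ext TG _ y1) => z z1.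
  by have [] := sys z1.
have T2 (y : R) : - 1 < y < 1 -> K y = derive1 (derive1 T) y.
  move=> y1; apply/esym; apply: (derive1_ext T1 _ y1) => z z1.
  by have [] := sys z1.
rewrite !derive1nS derive1n0.
apply: (derive1_ext (h := fun z => l * expR (4 * U z) - l) T2 _ x1) => z z1.
by have [] := sys z1.
Qed.

(** With W = [axlap U], successive differentiation of (1 - x^2)^2 U' gives (1 - x^2) W, then (1 -
    x^2) W' - 2 x W, then [axlap W] - 2 W: the third derivative in the equation is P4. *)
Lemma axlap_system (x : R) : - 1 <= x <= 1 ->
  axlap (axlap U) x - 2 * axlap U x = l * expR (4 * U x) - l.
Proof.
have dd := dl0.
pose W := axlap U.
have CW n : Ck n (- (1 + dl)) (1 + dl) W by exact: axlap_smooth.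
have inr (y : R) : - 1 < y < 1 -> - (1 + dl) < y < 1 + dl by lra.
have HE (y : R) : - 1 < y < 1 -> (1 - y ^+ 2) * W y = H y.
  move=> y1; have d1 := smooth_is_derive CU 1 (inr y y1).
  have dG : is_derive y 1 (fun t => (1 - t ^+ 2) ^+ 2 * derive1n 1 U t) (H y).
    apply: (is_derive_eq_oo y1 (f := G)); last by have [] := sys y1.
    by move=> t t1; rewrite derive1n1 GE.
  have dG2 : is_derive y 1 (fun t => (1 - t ^+ 2) ^+ 2 * derive1n 1 U t)
      ((1 - y ^+ 2) * W y).
    by isd; rewrite /W /axlap /=; ring.
  exact: is_derive_unique dG2 dG.
have KE (y : R) : - 1 < y < 1 -> (1 - y ^+ 2) * derive1n 1 W y - 2 * y * W y = K y.
  move=> y1; have d1 := smooth_is_derive CW 0 (inr y y1).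
  rewrite derive1n0 in d1.
  have dG : is_derive y 1 (fun t => (1 - t ^+ 2) * W t) (K y).
    by apply: (is_derive_eq_oo y1 (f := H)); [move=> t t1; rewrite HE|have [] := sys y1].
  have dG2 : is_derive y 1 (fun t => (1 - t ^+ 2) * W t)
      ((1 - y ^+ 2) * derive1n 1 W y - 2 * y * W y).
    by isd; rewrite /=; ring.
  exact: is_derive_unique dG2 dG.
have EE (y : R) : - 1 < y < 1 -> axlap W y - 2 * W y = l * expR (4 * U y) - l.
  move=> y1; have d1 := smooth_is_derive CW 1 (inr y y1).
  have d0 := smooth_is_derive CW 0 (inr y y1); rewrite derive1n0 in d0.
  have dG : is_derive y 1 (fun t => (1 - t ^+ 2) * derive1n 1 W t - 2 * t * W t)
      (l * expR (4 * U y) - l).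
    by apply: (is_derive_eq_oo y1 (f := K)); [move=> t t1; rewrite KE|have [] := sys y1].
  have dG2 : is_derive y 1 (fun t => (1 - t ^+ 2) * derive1n 1 W t - 2 * t * W t)
      (axlap W y - 2 * W y).
    by isd; rewrite /axlap /=; ring.
  exact: is_derive_unique dG2 dG.
(* At the poles the identity follows by continuity, along x (1 - q) with q -> 0, since U is smooth
   beyond them. *)
move=> x1; have [xi|xb] := boolP (- 1 < x < 1); first exact: EE.
have xr : - (1 + dl) < x < 1 + dl by lra.
have C1 : Ck 0 (- (1 + dl)) (1 + dl) (fun y => axlap W y - 2 * W y).
  apply: CkD; first exact: axlap_smooth.
  by apply/CkN/CkM; [exact: Ck_cst|exact: CW].
have C2 : Ck 0 (- (1 + dl)) (1 + dl) (fun y => l * expR (4 * U y) - l).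
  apply: CkD; last exact: Ck_cst.
  by apply: CkM; [exact: Ck_cst|apply/Ck_expR/CkM; [exact: Ck_cst|exact: CU]].
apply: (eq_by_continuity (C1 x xr) (C2 x xr)) => r r0.
pose q := Num.min (r / 2) (1 / 2).
have [q0 q1 qr] : [/\ 0 < q, q < 1 & q < r].
  by rewrite /q; have [] := leP (r / 2) (1 / 2); split; lra.
exists (x * (1 - q)).
  have -> : x * (1 - q) - x = - (x * q) by ring.
  rewrite normrN normrM (gtr0_norm q0).
  apply: (@le_lt_trans _ _ (1 * q)); last by rewrite mul1r.
  by rewrite ler_wpM2r ?(ltW q0)// ler_norml.
apply: EE; rewrite -ltr_norml normrM.
apply: (@le_lt_trans _ _ (1 * `|1 - q|)).
  by rewrite ler_wpM2r// ler_norml.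
by rewrite mul1r ger0_norm; lra.
Qed.

(** The normalization is automatic: in the explicit primitive [F] of the integrand the terms in G, H
    and K vanish at both poles, leaving the integral of 1 - x^2. *)
Lemma system_mass : mass U = 4 / 3.
Proof.
have [cG cH cK [G1 G1'] [H1 H1']] := bnd; have l0' := l0; have dd := dl0.
pose F (x : R) := l^-1 * ((1 - x ^+ 2) * K x + 2 * x * H x - 2 * G x) + (x - x ^+ 3 / 3).
have dF (x : R) : - 1 < x < 1 -> is_derive x 1 F ((1 - x ^+ 2) * expR (4 * U x)).
  move=> x1; have [_ dG dH dK] := sys x1.
  by rewrite /F; isd; rewrite /=; field; rewrite gt_eqF.
have CF : Ck 0 (- 2) 2 F.
  apply: CkD.
    apply: CkM; first exact: Ck_cst.
    apply: CkD.
      apply: CkD; first by apply: CkM => //; apply: CkD; [exact: Ck_cst|apply/CkN/CkX/Ck_id].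
      by apply: CkM => //; apply: CkM; [exact: Ck_cst|exact: Ck_id].
    by apply/CkN/CkM => //; exact: Ck_cst.
  apply: CkD; first exact: Ck_id.
  by apply/CkN/CkM; [apply/CkX/Ck_id|exact: Ck_cst].
have Ci : Ck 0 (- (1 + dl)) (1 + dl) (fun x => (1 - x ^+ 2) * expR (4 * U x)).
  apply: CkM; first by apply: CkD; [exact: Ck_cst|apply/CkN/CkX/Ck_id].
  by apply/Ck_expR/CkM; [exact: Ck_cst|exact: CU].
rewrite /mass /Rintegral (@continuous_FTC2 _ _ F).
- rewrite /= /F G1 G1' H1 H1'.
  have -> : (1 : R) - 1 ^+ 2 = 0 by ring.
  have -> : (1 : R) - (- 1) ^+ 2 = 0 by ring.
  by field; rewrite gt_eqF.
- lra.
- by apply: within_continuous_itv => x x1; apply: Ci; lra.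
- split.
  + by move=> x; rewrite in_itv/= => x1; have [] := dF x x1.
  + by apply/cvg_at_right_filter/CF; lra.
  + by apply/cvg_at_left_filter/CF; lra.
- by move=> x; rewrite in_itv/= => x1; apply: is_derive_derive1; exact: dF.
Qed.

Lemma system_ode_E : ode_E (6 / l) U.
Proof.
move=> x x1; rewrite system_mass system_ode//; field.
by rewrite gt_eqF.
Qed.

End system.
End axial_operator.

(** * Calculus on the sphere *)

Section sphere_calculus.
Context {R : realType}.
Local Notation V := 'rV[R]_5.
Implicit Types (F : V -> R) (y v : V) (i j : 'I_5).

Lemma is_derive_line F y v (a : R) :
  is_derive (0 : R) 1 (fun h : R => F (h *: v + y)) a <-> is_derive y v F a.
Proof.
have E : 'D_1 (fun h : R => F (h *: v + y)) (0 : R) = 'D_v F y.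
  rewrite /derive; set g1 := (X in lim (X @ _) = _); set g2 := (X in _ = lim (X @ _)).
  suff -> : g1 = g2 by [].
  by rewrite funeqE /g1 /g2 => h /=; rewrite addr0 scale0r add0r [_%:A]mulr1.
split=> -[df <-]; constructor.
- exact: (derivable1P _ _ _).2 df.
- exact: esym E.
- exact: (derivable1P _ _ _).1 df.
- exact: E.
Qed.

Lemma is_derive_dcomp (phi : R -> R) F y v (a b : R) :
  is_derive (F y) 1 phi a -> is_derive y v F b ->
  is_derive y v (fun z => phi (F z)) (a * b).
Proof.
move=> dphi /is_derive_line dF; apply/is_derive_line.
apply: (is_derive_comp_fun (g := fun h : R => F (h *: v + y)) _ dF).
by rewrite scale0r add0r.
Qed.

Lemma is_derive_dD F F' y v (a b : R) : is_derive y v F a -> is_derive y v F' b ->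
  is_derive y v (fun z => F z + F' z) (a + b).
Proof. exact: is_deriveD. Qed.

Lemma is_derive_dM F F' y v (a b : R) : is_derive y v F a -> is_derive y v F' b ->
  is_derive y v (fun z => F z * F' z) (F y * b + F' y * a).
Proof. exact: is_deriveM. Qed.

Lemma is_derive_coord y v i : is_derive y v (fun z : V => z 0 i) (v 0 i).
Proof.
apply/is_derive_line.
have -> : (fun h : R => (h *: v + y) 0 i) = (fun h : R => h * v 0 i + y 0 i).
  by apply/funext => h; rewrite !mxE.
by isd; ring.
Qed.

Lemma sqr_coord_sum_ge0 y : 0 <= \sum_(i < 5) y 0 i ^+ 2.
Proof. by apply: sumr_ge0 => i _; exact: sqr_ge0. Qed.

Lemma enorm_gt0 y : y != 0 -> 0 < enorm y.
Proof.
move=> y0; rewrite sqrtr_gt0 lt_neqAle sqr_coord_sum_ge0 andbT eq_sym.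
apply: contra y0; rewrite psumr_eq0; last by move=> i _; exact: sqr_ge0.
move=> /allP y0; apply/eqP/rowP => i; rewrite mxE.
have := y0 i; rewrite mem_index_enum => /(_ isT) /=.
by rewrite sqrf_eq0 => /eqP.
Qed.

Lemma enorm_sqr y : enorm y ^+ 2 = \sum_(i < 5) y 0 i ^+ 2.
Proof. by rewrite sqr_sqrtr// sqr_coord_sum_ge0. Qed.

Lemma enorm_neq0 y : 0 < enorm y -> y != 0.
Proof.
apply: contraTneq => ->; rewrite /enorm big1 ?sqrtr0 ?ltxx// => i _.
by rewrite mxE expr0n.
Qed.

Lemma enorm_continuous : continuous (@enorm R).
Proof.
have c : continuous (fun y : V => \sum_(i < 5) y 0 i ^+ 2).
  apply: (continuous_big add_continuous) => i _ y.
  apply: (@continuous_comp _ _ _ (fun y : V => y 0 i) (fun t : R => t ^+ 2)).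
    exact: coord_continuous.
  exact: exprn_continuous.
move=> y; apply: (@continuous_comp _ _ _ (fun y : V => \sum_(i < 5) y 0 i ^+ 2)
  (@Num.sqrt R)); [exact: c|exact: sqrt_continuous].
Qed.

Definition invn (y : V) : R := (enorm y)^-1.

Lemma invn_sqr y : y != 0 -> invn y ^+ 2 * (\sum_(i < 5) y 0 i ^+ 2) = 1.
Proof.
by move=> y0; rewrite -enorm_sqr -exprMn mulVf ?expr1n// gt_eqF// enorm_gt0.
Qed.

Lemma invn_continuous y : y != 0 -> {for y, continuous invn}.
Proof.
by move=> y0; apply: continuousV; [rewrite gt_eqF// enorm_gt0|exact: enorm_continuous].
Qed.

Lemma is_derive_sqr_sum y i :
  is_derive y (delta_mx 0 i) (fun z : V => \sum_(j < 5) z 0 j ^+ 2) (2 * y 0 i).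
Proof.
have D j : is_derive y (delta_mx 0 i) (fun z : V => z 0 j ^+ 2) (2 * y 0 j * (j == i)%:R).
  have -> : (fun z : V => z 0 j ^+ 2) = (fun z : V => z 0 j * z 0 j) by apply/funext.
  have d := is_derive_coord y (delta_mx 0 i) j.
  have dd := is_derive_dM d d.
  have E : y 0 j * (delta_mx 0 i : V) 0 j + y 0 j * (delta_mx 0 i : V) 0 j =
    2 * y 0 j * (j == i)%:R by rewrite mxE eqxx /=; ring.
  by rewrite -E.
have E : \sum_(j < 5) 2 * y 0 j * (j == i)%:R = 2 * y 0 i.
  by rewrite (bigD1 i)//= big1 ?eqxx ?mulr1 ?addr0// => j /negbTE ->; rewrite mulr0.
by have := is_derive_sum D; rewrite fct_sumE E.
Qed.

Lemma is_derive_invn y i : y != 0 ->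
  is_derive y (delta_mx 0 i) invn (- y 0 i * invn y ^+ 3).
Proof.
move=> y0; have e0 := enorm_gt0 y0.
have ds : is_derive (\sum_(j < 5) y 0 j ^+ 2) 1 (fun t : R => (Num.sqrt t)^-1)
    (- (enorm y) ^- 2 * (2 * enorm y)^-1).
  have s0 : 0 < \sum_(j < 5) y 0 j ^+ 2 by rewrite -enorm_sqr exprn_gt0.
  apply: is_derive_eq; first apply: (is_deriveV_fun (f := @Num.sqrt R)).
  - by rewrite gt_eqF.
  - exact: is_derive1_sqrt.
  - by rewrite /enorm; field; rewrite gt_eqF.
apply: is_derive_eq; first exact: (is_derive_dcomp ds (is_derive_sqr_sum y i)).
by rewrite /invn; field; rewrite gt_eqF.
Qed.

End sphere_calculus.

(** * Axial functions and their derivatives on the sphere *)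

Section axial_functions.
Context {R : realType}.
Local Notation V := 'rV[R]_5.
Implicit Types (F : V -> R) (y v : V) (i j : 'I_5) (phi : R -> R).

Definition axis (y : V) : R := invn y * y 0 ord0.

Definition daxis i (y : V) : R :=
  invn y * (i == ord0)%:R - y 0 ord0 * y 0 i * invn y ^+ 3.

Lemma axis_itv y : y != 0 -> - 1 <= axis y <= 1.
Proof.
move=> y0; rewrite -ler_norml -(@ler_pXn2r _ 2)// ?nnegrE// expr1n real_normK ?num_real//.
rewrite exprMn -(invn_sqr y0) ler_wpM2l ?sqr_ge0// (bigD1 ord0)//= lerDl.
by apply: sumr_ge0 => j _; exact: sqr_ge0.
Qed.

Lemma is_derive_axis y i : y != 0 -> is_derive y (delta_mx 0 i) axis (daxis i y).
Proof.
move=> y0.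
have d := is_derive_dM (is_derive_invn i y0) (is_derive_coord y (delta_mx 0 i) ord0).
have E : invn y * (delta_mx 0 i : V) 0 ord0 + y 0 ord0 * (- y 0 i * invn y ^+ 3) = daxis i y.
  by rewrite mxE eqxx /= eq_sym /daxis; ring.
by rewrite -E.
Qed.

Lemma near_neq0 y : y != 0 -> \forall z \near y, z != 0.
Proof.
move=> y0; have e0 := enorm_gt0 y0.
have N : \forall z \near y, 0 < enorm z := @enorm_continuous R y _ (lt_nbhsr e0).
by apply: filterS N => z /enorm_neq0.
Qed.

Lemma coord_continuous0 y i : {for y, continuous (fun z : V => z 0 i)}.
Proof. exact: coord_continuous. Qed.

Section smooth_profile.
Variables (U : R -> R) (dl : R).
Hypothesis dl0 : 0 < dl.
Hypothesis smU : forall n, Ck n (- (1 + dl)) (1 + dl) U.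

(** A class stable under partial derivatives and consisting of functions continuous off 0;
    smoothness of all orders then follows by induction on the list of partial derivatives. *)
Inductive sphere_alg : (V -> R) -> Prop :=
| sa_cst (c : R) : sphere_alg (fun=> c)
| sa_coord i : sphere_alg (fun y => y 0 i)
| sa_invn : sphere_alg invn
| sa_axis n : sphere_alg (fun y => derive1n n U (axis y))
| sa_add F G : sphere_alg F -> sphere_alg G -> sphere_alg (fun y => F y + G y)
| sa_mul F G : sphere_alg F -> sphere_alg G -> sphere_alg (fun y => F y * G y).

Lemma axis_itv_dl y : y != 0 -> - (1 + dl) < axis y < 1 + dl.
Proof. by have d0 := dl0; move=> /axis_itv; move: (axis y) => t; lra. Qed.

Lemma is_derive_axial n y i : y != 0 ->
  is_derive y (delta_mx 0 i) (fun z => derive1n n U (axis z))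
    (derive1n n.+1 U (axis y) * daxis i y).
Proof.
move=> y0; apply: is_derive_dcomp (is_derive_axis i y0).
exact: (smooth_is_derive smU n (axis_itv_dl y0)).
Qed.

Lemma sphere_alg_continuous F : sphere_alg F -> forall y, y != 0 -> {for y, continuous F}.
Proof.
elim=> [c|i||n|G H _ IG _ IH|G H _ IG _ IH] y y0.
- exact: cst_continuous.
- exact: coord_continuous0.
- exact: invn_continuous.
- apply: (@continuous_comp _ _ _ axis (derive1n n U)).
    by apply: continuousM; [exact: invn_continuous|exact: coord_continuous0].
  have [dU _] := smooth_is_derive smU n (axis_itv_dl y0).
  exact/differentiable_continuous/derivable1_diffP.
- exact: continuousD (IG y y0) (IH y y0).
- exact: continuousM (IG y y0) (IH y y0).
Qed.

Lemma sphere_alg_X F n : sphere_alg F -> sphere_alg (fun y => F y ^+ n.+1).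
Proof.
move=> aF; elim: n => [//|n IH].
have -> : (fun y => F y ^+ n.+2) = (fun y => F y * F y ^+ n.+1).
  by apply/funext => y; rewrite exprS.
exact: sa_mul.
Qed.

Lemma sphere_alg_daxis i : sphere_alg (daxis i).
Proof.
have -> : daxis i = (fun y => invn y * (i == ord0)%:R
    + (- 1) * (y 0 ord0 * y 0 i * invn y ^+ 3)).
  by apply/funext => y; rewrite mulN1r.
apply: sa_add; apply: sa_mul; try exact: sa_cst; first exact: sa_invn.
apply: sa_mul; first by apply: sa_mul; exact: sa_coord.
exact/sphere_alg_X/sa_invn.
Qed.

Lemma sphere_alg_partial F i : sphere_alg F ->
  exists2 G, sphere_alg G & forall y, y != 0 -> is_derive y (delta_mx 0 i) F (G y).
Proof.
elim=> [c|j||n|F1 F2 a1 [G1 b1 d1] a2 [G2 b2 d2]|F1 F2 a1 [G1 b1 d1] a2 [G2 b2 d2]].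
- by exists (fun=> 0); [exact: sa_cst|move=> y y0; exact: is_derive_cst].
- exists (fun=> (delta_mx 0 i : V) 0 j); first exact: sa_cst.
  by move=> y _; exact: is_derive_coord.
- exists (fun y => (- 1) * y 0 i * invn y ^+ 3).
    apply: sa_mul; last exact/sphere_alg_X/sa_invn.
    by apply: sa_mul; [exact: sa_cst|exact: sa_coord].
  by move=> y y0; rewrite mulN1r; exact: is_derive_invn.
- exists (fun y => derive1n n.+1 U (axis y) * daxis i y).
    by apply: sa_mul; [exact: sa_axis|exact: sphere_alg_daxis].
  by move=> y y0; exact: is_derive_axial.
- exists (fun y => G1 y + G2 y); first exact: sa_add.
  by move=> y y0; exact: is_derive_dD (d1 y y0) (d2 y y0).
- exists (fun y => F1 y * G2 y + F2 y * G1 y).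
    by apply: sa_add; exact: sa_mul.
  by move=> y y0; exact: is_derive_dM (d1 y y0) (d2 y y0).
Qed.

End smooth_profile.

Lemma eq_off0_near F G y : (forall z, z != 0 -> F z = G z) -> y != 0 ->
  \forall z \near y, F z = G z.
Proof. by move=> FG /near_neq0; apply: filterS => z; exact: FG. Qed.

Lemma is_derive_partial F y i (a : R) : is_derive y (delta_mx 0 i) F a -> partial i F y = a.
Proof. by move=> [_ <-]. Qed.

Lemma partial_eq_off0 F G i y (a : R) : (forall z, z != 0 -> G z = F z) -> y != 0 ->
  is_derive y (delta_mx 0 i) F a -> is_derive y (delta_mx 0 i) G a.
Proof.
move=> GF y0; apply: near_eq_is_derive.
by apply: eq_off0_near y0 => z z0; rewrite GF.
Qed.

Lemma sphere_alg_smooth U dl : 0 < dl -> (forall n, Ck n (- (1 + dl)) (1 + dl) U) ->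
  forall F, sphere_alg U F -> smooth_off0 F.
Proof.
move=> dl0 smU F aF s.
have [G aG FG] : exists2 G, sphere_alg U G &
    forall y, y != 0 -> foldr (@partial R) F s y = G y.
  elim: s => [|i s [G aG FG]]; first by exists F.
  have [G' aG' dG] := sphere_alg_partial dl0 smU i aG.
  exists G' => // y y0 /=.
  exact/is_derive_partial/(partial_eq_off0 FG y0)/dG.
move=> y y0; split.
  have GFy : \forall z \near y, G z = foldr (@partial R) F s z.
    by apply: filterS (eq_off0_near FG y0) => z ->.
  have cG := sphere_alg_continuous dl0 smU aG y0.
  rewrite /prop_for /continuous_at FG//; apply: cvg_trans cG.
  exact: near_eq_cvg GFy.
move=> i; have [G' aG' dG] := sphere_alg_partial dl0 smU i aG.
by have [d _] := partial_eq_off0 FG y0 (dG y y0).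
Qed.

Lemma hext_axial (f : V -> R) phi y : (forall xi, sphere4 R xi -> f xi = axial phi xi) ->
  y != 0 -> hext f y = phi (axis y).
Proof.
move=> fphi y0; rewrite /hext fphi; first by rewrite /axial mxE.
rewrite /sphere4 /= /enorm; under eq_bigr do rewrite mxE exprMn.
by rewrite -mulr_sumr invn_sqr// sqrtr1.
Qed.

Lemma smooth_sphere_axial phi dl : 0 < dl ->
  (forall n, Ck n (- (1 + dl)) (1 + dl) phi) -> smooth_sphere (axial phi).
Proof.
move=> dl0 smphi; rewrite /smooth_sphere.
have -> : hext (axial phi) = (fun y => derive1n 0 phi (axis y)).
  by apply/funext => y; rewrite /hext /axial mxE.
exact: (sphere_alg_smooth dl0 smphi (sa_axis _ 0)).
Qed.

Definition ddaxis i (y : V) : R := 3 * y 0 ord0 * y 0 i ^+ 2 * invn y ^+ 5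
  - 2 * (i == ord0)%:R * y 0 i * invn y ^+ 3 - y 0 ord0 * invn y ^+ 3.

Lemma is_derive_daxis y i : y != 0 -> is_derive y (delta_mx 0 i) (daxis i) (ddaxis i y).
Proof.
move=> y0; have di := is_derive_invn i y0.
have d0 := is_derive_coord y (delta_mx 0 i) ord0.
have d1 := is_derive_coord y (delta_mx 0 i) i.
have di3 := is_derive_dM di (is_derive_dM di di).
have dT := is_derive_dM (is_derive_dM d0 d1) di3.
have dd := is_derive_dD (is_derive_dM di (is_derive_cst ((i == ord0)%:R : R) y (delta_mx 0 i)))
  (is_derive_dM (is_derive_cst (- 1 : R) y (delta_mx 0 i)) dT).
have -> : daxis i = (fun z : V => invn z * (i == ord0)%:R +
   (- 1) * (z 0 ord0 * z 0 i * (invn z * (invn z * invn z)))).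
  by apply/funext => z; rewrite /daxis; ring.
move: dd; rewrite /cst; set a := (X in is_derive _ _ _ X -> _).
have <- : a = ddaxis i y; last by [].
rewrite /a /ddaxis !mxE !eqxx /= (eq_sym ord0); case: (i =P ord0) => [->|_] /=; ring.
Qed.

(** Agreement with an axial function is required on the sphere only, so that the lemma applies a
    second time to [laplace_beltrami f], which is known to be axial only there. *)
Lemma laplace_axial (f : V -> R) phi dl xi : 0 < dl ->
  (forall n, Ck n (- (1 + dl)) (1 + dl) phi) ->
  (forall z, sphere4 R z -> f z = axial phi z) -> sphere4 R xi ->
  laplace_beltrami f xi = axial (axlap phi) xi.
Proof.
move=> dl0 smphi fphi xi1.
have xi0 : xi != 0 by apply: enorm_neq0; rewrite xi1.
have hphi z : z != 0 -> hext f z = derive1n 0 phi (axis z) by exact: hext_axial fphi.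
have d1 i z : z != 0 -> partial i (hext f) z = derive1n 1 phi (axis z) * daxis i z.
  move=> z0; apply/is_derive_partial/(partial_eq_off0 hphi z0).
  exact: (is_derive_axial dl0 smphi 0 i z0).
have d2 i : partial i (partial i (hext f)) xi =
    derive1n 1 phi (axis xi) * ddaxis i xi
    + daxis i xi * (derive1n 2 phi (axis xi) * daxis i xi).
  apply/is_derive_partial/(partial_eq_off0 (d1 i) xi0)/is_derive_dM.
    exact: (is_derive_axial dl0 smphi 1 i xi0).
  exact: is_derive_daxis.
rewrite /laplace_beltrami; under eq_bigr do rewrite d2.
have i1 : invn xi = 1 by rewrite /invn xi1 invr1.
have x1 : axis xi = xi 0 ord0 by rewrite /axis i1 mul1r.
have := invn_sqr xi0; rewrite i1 expr1n mul1r => S1.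
have dE i : daxis i xi = (i == ord0)%:R - xi 0 ord0 * xi 0 i.
  by rewrite /daxis i1; ring.
have ddE i : ddaxis i xi = 3 * xi 0 ord0 * xi 0 i ^+ 2
    - 2 * (i == ord0)%:R * xi 0 i - xi 0 ord0.
  by rewrite /ddaxis i1; ring.
rewrite x1 /axial /axlap; move: (derive1n 1 phi _) (derive1n 2 phi _) => p q.
under eq_bigr do rewrite dE ddE.
move: S1; rewrite !big_ord_recl !big_ord0 /=.
move: (xi 0 ord0) => x; move: (xi 0 _) (xi 0 _) (xi 0 _) (xi 0 _) => x4 x3 x2 x1' S1.
(* On the unit sphere the coefficient of the first derivative becomes - 4 x and that of the second 1
   - x^2: the Laplacian and the squared gradient of the coordinate x. *)
transitivity (p * (3 * x * (x ^+ 2 + (x1' ^+ 2 + (x2 ^+ 2 + (x3 ^+ 2 + (x4 ^+ 2 + 0))))) - 7 * x)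
  + q * (1 - 2 * x ^+ 2 + x ^+ 2 *
      (x ^+ 2 + (x1' ^+ 2 + (x2 ^+ 2 + (x3 ^+ 2 + (x4 ^+ 2 + 0))))))); first by ring.
by rewrite S1; ring.
Qed.

End axial_functions.

(** * Integration on the sphere *)

Section sphere_integral.
Context {R : realType}.
Local Notation mu := (@lebesgue_measure R).
Implicit Types (phi f F : R -> R).

Lemma Rintegral_derive f F (a b : R) : a < b -> continuous f ->
  (forall x : R, is_derive x 1 F (f x)) -> \int[mu]_(x in `[a, b]) f x = F b - F a.
Proof.
move=> ab cf dF; have cF (x : R) : {for x, continuous F}.
  by apply: is_derive_continuous (dF x).
rewrite /Rintegral (@continuous_FTC2 _ _ F)//=.
- by apply: within_continuous_itv => x _; exact: cf.
- split; first by move=> x _; have [] := dF x.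
  + by apply/cvg_at_right_filter/cF.
  + by apply/cvg_at_left_filter/cF.
- by move=> x _; rewrite derive1E; have [_ ->] := dF x.
Qed.

Lemma Rintegral_scale f (a b r : R) : continuous f ->
  \int[mu]_(x in `[a, b]) (r * f x) = r * \int[mu]_(x in `[a, b]) f x.
Proof.
move=> cf; apply: RintegralZl => //; apply: integrable_itv.
by apply: within_continuous_itv => x _; exact: cf.
Qed.

Lemma latitude_integral phi : continuous phi ->
  \int[mu]_(t in `[0, pi]) (sin t ^+ 3 * phi (cos t)) =
  \int[mu]_(x in `[-1, 1]) ((1 - x ^+ 2) * phi x).
Proof.
move=> cphi.
have c1 : continuous (fun x : R => (1 - x ^+ 2) * phi x).
  apply: continuousT_M => //; apply: continuousT_D; first exact: cst_continuous.
  by apply: continuousT_N; exact: exprn_continuous.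
have dP := prim_deriveT c1; set P := prim _ in dP.
have dQ (t : R) : is_derive t 1 (fun t => - P (cos t)) (sin t ^+ 3 * phi (cos t)).
  have dPc := is_derive_comp_fun (dP (cos t)) (is_derive_cos t).
  isd.
  by have := cos2Dsin2 t; rewrite -[cos t ^+ 2 + _]addrC => <-; ring.
rewrite (Rintegral_derive _ c1 dP) ?(Rintegral_derive (pi_gt0 R) _ dQ).
- by rewrite cos0 cospi; ring.
- apply: continuousT_M; last by apply: continuousT_comp => //; exact: continuous_cos.
  by apply: (continuousT_comp (@exprn_continuous R 3)); exact: continuous_sin.
- lra.
Qed.

Lemma Rintegral_sin : \int[mu]_(t in `[0, pi]) sin t = 2.
Proof.
have d (t : R) : is_derive t 1 (fun t => - cos t) (sin t).
  by have dc := is_derive_cos t; isd; rewrite opprK.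
rewrite (Rintegral_derive (pi_gt0 R) (@continuous_sin R) d) cos0 cospi; ring.
Qed.

Lemma Rintegral_sin2 : \int[mu]_(t in `[0, pi]) sin t ^+ 2 = pi / 2.
Proof.
have d (t : R) : is_derive t 1 (fun t => (t - sin t * cos t) / 2) (sin t ^+ 2).
  have ds := is_derive_sin t; have dc := is_derive_cos t; isd.
  have := cos2Dsin2 t; move: (cos t) (sin t) => c s cs.
  have E : s ^+ 2 = (1 - c ^+ 2 + s ^+ 2) / 2 by lra.
  by rewrite [in RHS]E; field.
rewrite (Rintegral_derive (pi_gt0 R) _ d); last first.
  by apply: (continuousT_comp (@exprn_continuous R 2)); exact: continuous_sin.
by rewrite sinpi sin0; field.
Qed.

(** The three inner angles contribute 2 pi, 2 and pi / 2; the outer one is the latitude integral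
    under x = cos t. *)
Lemma sphere_vol_int_axial phi : continuous phi ->
  sphere_vol_int (axial phi) = 2 * pi ^+ 2 * \int[mu]_(x in `[-1, 1]) ((1 - x ^+ 2) * phi x).
Proof.
move=> cphi; rewrite -latitude_integral// /sphere_vol_int.
have cs n : continuous (fun t : R => sin t ^+ n).
  by apply: (continuousT_comp (@exprn_continuous R n)); exact: continuous_sin.
have E4 (t1 t2 t3 : R) : \int[mu]_(t4 in `[0, 2 * pi])
    (axial phi (spherical_point t1 t2 t3 t4) * (sin t1 ^+ 3 * sin t2 ^+ 2 * sin t3))
    = 2 * pi * (sin t1 ^+ 3 * phi (cos t1)) * sin t2 ^+ 2 * sin t3.
  have pi0 : 0 < 2 * pi :> R by rewrite mulr_gt0// pi_gt0.
  under eq_Rintegral do rewrite /axial mxE /=.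
  rewrite Rintegral_cst//= lebesgue_measure_itv/= lte_fin pi0/= subr0; ring.
have E3 (t1 t2 : R) : \int[mu]_(t3 in `[0, pi]) \int[mu]_(t4 in `[0, 2 * pi])
    (axial phi (spherical_point t1 t2 t3 t4) * (sin t1 ^+ 3 * sin t2 ^+ 2 * sin t3))
    = 4 * pi * (sin t1 ^+ 3 * phi (cos t1)) * sin t2 ^+ 2.
  under eq_Rintegral do rewrite E4.
  by rewrite Rintegral_scale ?Rintegral_sin; [ring|exact: continuous_sin].
have E2 (t1 : R) : \int[mu]_(t2 in `[0, pi]) \int[mu]_(t3 in `[0, pi]) \int[mu]_(t4 in `[0, 2 * pi])
    (axial phi (spherical_point t1 t2 t3 t4) * (sin t1 ^+ 3 * sin t2 ^+ 2 * sin t3))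
    = 2 * pi ^+ 2 * (sin t1 ^+ 3 * phi (cos t1)).
  under eq_Rintegral do rewrite E3.
  by rewrite Rintegral_scale ?Rintegral_sin2; [field|exact: cs].
under eq_Rintegral do rewrite E2.
rewrite Rintegral_scale//; apply: continuousT_M => //.
by apply: continuousT_comp => //; exact: continuous_cos.
Qed.

Lemma Rintegral_1Bsqr : \int[mu]_(x in `[-1, 1]) ((1 - x ^+ 2) * 1) = 4 / 3 :> R.
Proof.
have d (x : R) : is_derive x 1 (fun x : R => x - x ^+ 3 / 3) ((1 - x ^+ 2) * 1).
  by isd; rewrite /=; field.
rewrite (Rintegral_derive _ _ d); [by field|lra|].
apply: continuousT_M; last exact: cst_continuous.
apply: continuousT_D; first exact: cst_continuous.
by apply: continuousT_N; exact: exprn_continuous.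
Qed.

Lemma sphere_int_axial phi : continuous phi ->
  sphere_int (axial phi) = 3 / 4 * \int[mu]_(x in `[-1, 1]) ((1 - x ^+ 2) * phi x).
Proof.
move=> cphi; rewrite /sphere_int sphere_vol_int_axial//.
have -> : (fun=> 1) = axial (fun=> 1 : R) by [].
rewrite sphere_vol_int_axial; last exact: cst_continuous.
rewrite Rintegral_1Bsqr; have := pi_gt0 R; move: pi => p p0; field.
by rewrite gt_eqF.
Qed.

Lemma sphere_solution_axial (U : R -> R) (l dl : R) : 0 < l -> 0 < dl ->
  (forall n, Ck n (- (1 + dl)) (1 + dl) U) -> continuous U -> mass U = 4 / 3 ->
  (forall x : R, - 1 <= x <= 1 -> axlap (axlap U) x - 2 * axlap U x = l * expR (4 * U x) - l) ->
  sphere_solution (6 / l) (axial U).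
Proof.
move=> l0 dl0 smU cU mU sysU; split; first exact: smooth_sphere_axial smU.
move=> xi xi1; have xi0 : xi != 0 by apply: enorm_neq0; rewrite xi1.
have x1 : - 1 <= xi 0 ord0 <= 1.
  by have := axis_itv xi0; rewrite /axis /invn xi1 invr1 mul1r.
have c4 : continuous (fun x => expR (4 * U x)).
  apply: (continuousT_comp (@continuous_expR R)); apply: continuousT_M => //.
  exact: cst_continuous.
rewrite (sphere_int_axial c4) -/(mass U) mU.
have L1 z : sphere4 R z -> laplace_beltrami (axial U) z = axial (axlap U) z.
  exact: (laplace_axial dl0 smU).
rewrite /P4 (laplace_axial dl0 (axlap_smooth smU) L1 xi1) L1// /axial sysU//.
by field; rewrite gt_eqF.
Qed.

(** By continuity u > b on an interval to the left of the pole, which has positive measure, so the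
    value at the single point 1 is seen by the essential supremum. *)
Lemma le_Linfty_norm (u : R -> R) (b : R) : {for 1, continuous u} -> b < u 1 ->
  (b%:E <= Linfty_norm u)%E.
Proof.
move=> cu bu; have [r r0 ur] := continuous_gt_near cu bu.
have muT : (0 < mu setT)%E.
  apply: (@lt_le_trans _ _ (mu `[0, 1])); last by apply: le_measure; rewrite ?inE.
  by rewrite lebesgue_measure_itv/= lte_fin ltr01 sube0 lte_fin.
rewrite /Linfty_norm unlock /= muT leNgt; apply/negP; set c := ess_sup _ _ => cb.
have /ess_supP[N [mN N0 subN]] : (c <= c)%E by [].
pose q := Num.min r 1.
have q0 : 0 < q by rewrite lt_min r0 ltr01.
have qr : q <= r by rewrite ge_min lexx.
have q1 : q <= 1 by rewrite ge_min lexx orbT.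
have sub : `](1 - q), 1[ `<=` N.
  move=> x; rewrite /= in_itv/= => xq; apply: subN => /= xc.
  have xu : b < u x by apply: ur; rewrite ltr0_norm; lra.
  have : (b%:E < c)%E.
    apply: (lt_le_trans _ xc); rewrite patchE mem_set//=; last by rewrite in_itv/=; lra.
    by rewrite lte_fin; apply: (lt_le_trans xu); exact: ler_norm.
  by move=> /lt_trans /(_ cb); rewrite ltxx.
have : mu `](1 - q), 1[ = 0 by apply: subset_measure0 mN sub N0.
rewrite lebesgue_measure_itv/= lte_fin ltrBlDr ltrDl q0 => /eqP.
by rewrite -EFinB eqe; lra.
Qed.

End sphere_integral.

(** * Solutions from profiles *)

Lemma profile_solution (R : realType) (e l K a : R) :
  0 < l < e -> e = l * expR (4 * a) -> symmetric_profile e l K ->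
  let U := uprof e l K a in
  [/\ solution_E (6 / l) U, nonconstant U, mass U = 4 / 3 &
      forall b : R, b < a -> (b%:E <= Linfty_norm U)%E].
Proof.
move=> l0e ea prof U; have [l0 le] := andP l0e.
have e0 : 0 <= e by lra.
have [d d0 smU] := uprof_smooth l0e ea prof.
have [G [H [K0 [sys bnd]]]] := uprof_system l0e ea prof.
have CU := derivable_Ck smU.
have cU : continuous U.
  apply: continuousT_D; first exact: cst_continuous.
  apply: (@continuousT_comp _ (sol e l K) (fun x : R => 1 - `|x|)).
    exact: sol_continuous.
  apply: continuousT_D; first exact: cst_continuous.
  by apply: continuousT_N; exact: norm_continuous.
have U1 : U 1 = a by rewrite /U /uprof normr1 subrr sol_at0// addr0.
have mU : mass U = 4 / 3 by exact: system_mass l0 d0 smU sys bnd.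
split=> //.
- split; first exact: system_ode_E l0 d0 smU sys bnd.
  apply: (sphere_solution_axial l0 d0 CU cU mU) => x x1.
  exact: (axlap_system d0 smU sys x1).
(* A constant would be the pole value a, making f equal to e > l everywhere, whereas f < l at s. *)
- move=> [c Uc]; have [_ _ _ [s s01 es]] := prof.
  have s1 : `|1 - s| = 1 - s by rewrite ger0_norm//; lra.
  have := uprof_exp l0e ea prof (x := 1 - s).
  rewrite -/U Uc; last lra.
  rewrite s1 subKr => Es.
  have : U 1 = c by rewrite Uc//; lra.
  rewrite U1 => ac.
  by move: es; rewrite -Es -?ac -?ea; lra.
- by move=> b ba; apply: le_Linfty_norm; [exact: cU|rewrite U1].
Qed.

Lemma blowup_sequence (R : realType) (m : nat) : exists p : R * (R -> R),
  [/\ `|p.1 - 1 / 2| <= m.+1%:R^-1,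
      1 / 5 < p.1 < 31 / 60,
      solution_E p.1 p.2 /\ nonconstant p.2,
      mass p.2 = 4 / 3 &
      (m%:R%:E <= Linfty_norm p.2)%E].
Proof.
have eta0 : 0 < m.+1%:R^-1 / 10 :> R by rewrite divr_gt0.
have [e [l [K [a [l0 le ma ea prof]]]]] := blowup_profile_exists m.+1%:R eta0.
have m1 : m.+1%:R^-1 <= 1 :> R by rewrite invf_le1// ler1n.
move: le; rewrite ler_norml; set h := m.+1%:R^-1 in eta0 m1 * => lh.
have a0 : 0 < a by apply: lt_le_trans ma.
have l0e : 0 < l < e by rewrite l0 ea ltr_pMr// expR_gt1; lra.
have [sU nU mU LU] := profile_solution l0e ea prof.
exists (6 / l, uprof e l K a); split=> //=.
- have -> : 6 / l - 1 / 2 = (12 - l) / (2 * l) by field; rewrite gt_eqF.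
  rewrite ler_norml; apply/andP; split.
    by rewrite ler_pdivlMr; nra.
  by rewrite ler_pdivrMr; nra.
- by rewrite ltr_pdivlMr// ltr_pdivrMr//; lra.
- by apply: LU; apply: lt_le_trans ma; rewrite ltr_nat.
Qed.

Lemma le_sqrt_natr (R : realType) (k n : nat) : (k * k <= n)%N ->
  k%:R <= Num.sqrt (n%:R : R).
Proof.
move=> kn; rewrite -(@ler_pXn2r _ 2)// ?nnegrE ?sqrtr_ge0 ?ler0n//.
by rewrite sqr_sqrtr ?ler0n// expr2 -natrM ler_nat.
Qed.

Theorem theorem1p4 (R : realType) :
  (forall alpha : R, 1 / 5%:R < alpha < 1 / 2%:R ->
     exists u : R -> R, solution_E alpha u /\ nonconstant u) /\
  (exists (a : nat -> R) (u : nat -> R -> R),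
     [/\ forall m : nat,
           1 / 5%:R < a m < (473%:R + Num.sqrt 209329%:R) / 1800%:R,
         forall m : nat, solution_E (a m) (u m) /\ nonconstant (u m),
         a @ \oo --> (1 / 2%:R : R),
         forall m : nat, mass (u m) = 4%:R / 3%:R
       & (fun m : nat => Linfty_norm (u m)) @ \oo --> +oo%E]).
Proof.
split=> [alpha a1|].
  have al0 : 0 < alpha by lra.
  have l1 : 12 < 6 / alpha < 30.
    by rewrite ltr_pdivlMr// ltr_pdivrMr//; lra.
  have [e [K [le prof]]] := profile_exists l1.
  have l0 : 0 < 6 / alpha by rewrite divr_gt0.
  (* The pole value a is recovered from e = l exp (4 a). *)
  have ea : e = 6 / alpha * expR (4 * (ln (e / (6 / alpha)) / 4)).
    rewrite mulrCA divff// mulr1 lnK; last by rewrite posrE divr_gt0//; lra.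
    by rewrite mulrC divfK// gt_eqF.
  have l0e : 0 < 6 / alpha < e by rewrite l0.
  have [sU nU _ _] := profile_solution l0e ea prof.
  have E : 6 / (6 / alpha) = alpha by field; rewrite gt_eqF.
  rewrite E in sU.
  exact: ex_intro (conj sU nU).
have [p pP] := choice (@blowup_sequence R).
exists (fun m => (p m).1), (fun m => (p m).2); split.
- move=> m; have [_ p1 _ _ _] := pP m.
  (* Since (473 + 457) / 1800 = 31 / 60, the rational bound of [blowup_sequence] suffices. *)
  have s0 : 457 <= Num.sqrt (209329%:R : R) by apply: le_sqrt_natr; vm_compute.
  by move: (Num.sqrt _) s0 => s s0; lra.
- by move=> m; have [_ _ ? _ _] := pP m.
- apply/cvgrPdist_le => /= eps eps0.
  have /cvgrPdist_le/(_ eps eps0) := @cvg_harmonic R.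
  apply: filterS => m; rewrite sub0r normrN ger0_norm ?harmonic_ge0// => hm.
  by have [pm _ _ _ _] := pP m; rewrite distrC (le_trans pm).
- by move=> m; have [_ _ _ ? _] := pP m.
- apply/cvgeyPge => A; near=> m.
  have [_ _ _ _] := pP m; apply: le_trans; rewrite lee_fin.
  by near: m; exact: nbhs_infty_ger.
Unshelve. all: by end_near.
Qed.
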